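(* For every $k\in\mathbb{N}$ there is a logarithmic-space computable reduction that, given a $k$th-order lossy channel system $S$ and two configurations $C,C'$ of $S$, produces a priority channel system $S'$ of level $d=k+1$ and two configurations $D,D'$ of $S'$ such that $C\to^*C'$ in $S$ if and only if $D\to_{\#}^*D'$ in $S'$.
   Context: Higher-order lossy channel systems. A $k$th-order LCS is $S=(k,\Sigma,\mathrm{Ch},Q,\Delta)$ with $\Sigma$ a finite alphabet, $Q$ a finite set of control states, channels $c_{n,i}$ for $1\le n\le k$, $1\le i\le m$ (where $c_{n,i}$ is an $n$th-order channel), and $\Delta$ a finite set of rules $(q,\mathrm{op},q')$. Let $\Sigma^{*0}=\Sigma$ and let $\Sigma^{*(n+1)}$ be the set of finite sequences of elements of $\Sigma^{*n}$. Let $\leq_{*0}$ be equality on $\Sigma$; for $x=x_1\cdots x_\ell$ and $y=y_1\cdots y_r$ in $\Sigma^{*(n+1)}$ let $x\leq_{*(n+1)}y$ iff there are $1\le i_1<\cdots<i_\ell\le r$ with $x_j\leq_{*n}y_{i_j}$ for all $j$. A configuration is $(q,(x_{n,i})_{1\le n\le k,1\le i\le m})$ with $q\in Q$, $x_{n,i}\in\Sigma^{*n}$; configurations are ordered by equality of states and componentwise by $\leq_{*n}$. Steps $(q,(x_{n,i}))\to(q',(y_{n,i}))$ are of two kinds. Reliable steps, for a rule $(q,\mathrm{op},q')$, where channels not mentioned are unchanged and op is one of: (1) write $a\in\Sigma$ to $c_{1,i}$: $y_{1,i}=x_{1,i}\cdot a$; (2) read $a\in\Sigma$ from $c_{1,i}$: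 $x_{1,i}=a\cdot y_{1,i}$; (3) for $1\le n<k$, push a copy of the content of $c_{n,j}$ to $c_{n+1,i}$: $y_{n+1,i}=x_{n+1,i}\cdot x_{n,j}$, where $x_{n,j}$ is appended as one last element; (4) for $1\le n<k$, pop from $c_{n+1,j}$ to $c_{n,i}$: if $u\in\Sigma^{*n}$ is the first element of $x_{n+1,j}$, then $x_{n+1,j}=u\cdot y_{n+1,j}$ and $y_{n,i}=u$ (the previous content of $c_{n,i}$ is erased). Losing steps: $C\to C'$ for any $C'$ strictly smaller than $C$. Priority channel systems. $\Sigma_d=\{0,\ldots,d\}$. A PCS of level $d$ is $(\Sigma_d,\mathrm{Ch},Q,\Delta)$ with finitely many channels $c_1,\ldots,c_m$, a finite state set $Q$, and $\Delta\subseteq Q\times\mathrm{Ch}\times\{!,?\}\times\Sigma_d\times Q$. Configurations are in $Q\times(\Sigma_d^* )^m$. The relation $\to_{\#}$ consists of: read steps for $(q,c_i?a,q')$, removing a leading $a$ from channel $i$ and moving from $q$ to $q'$; write steps for $(q,c_i!a,q')$, appending $a$ at the right end of channel $i$ and moving from $q$ to $q'$; and internal superseding steps, which keep the state and rewrite the content $a_1\cdots a_\ell$ of one channel to $a_1\cdots a_{k'-1}a_{k'+1}\cdots a_\ell$ for some $1\le k'<\ell$ with $a_{k'}\le a_{k'+1}$. *)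

(* Defs.v *)
From HB Require Import structures.
From mathcomp Require Import all_boot.
From Stdlib Require Export Relation_Operators.

Set Implicit Arguments.
Unset Strict Implicit.
Unset Printing Implicit Defensive.

Fixpoint hseq (A : Type) (n : nat) : Type :=
  if n is n'.+1 then seq (hseq A n') else A.

Definition embeds (T : Type) (le : T -> T -> Prop) (x y : seq T) : Prop :=
  exists f : 'I_(size x) -> 'I_(size y),
    {homo f : i j / i < j} /\
    forall j, le (tnth (in_tuple x) j) (tnth (in_tuple y) (f j)).

Fixpoint hle (A : Type) (n : nat) : hseq A n -> hseq A n -> Prop :=
  if n is n'.+1 then embeds (@hle A n') else eq.

(* Orders are counted from 0 here: the channel of index [(n, i)] has order
   [n.+1], for [n : 'I_k]. Each constructor carries the proof that the channels
   it mentions exist; [HPush n _ j i] pushes from order [n.+1] to order [n.+2],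
   [HPop n _ j i] pops from order [n.+2] to order [n.+1]. *)
Inductive hop (k m s : nat) : Type :=
  | HWrite of 0 < k & 'I_m & 'I_s
  | HRead of 0 < k & 'I_m & 'I_s
  | HPush (n : nat) of n.+1 < k & 'I_m & 'I_m
  | HPop (n : nat) of n.+1 < k & 'I_m & 'I_m.

Lemma hop_comparable (k m s : nat) : comparable (hop k m s).
Proof.
move=> [h i a|h i a|n h j i|n h j i] [h' i' a'|h' i' a'|n' h' j' i'|n' h' j' i'];
  try by right.
1,2: have [<-|ne] := i =P i'; last by right; case.
1,2: have [<-|ne] := a =P a'; last by right; case.
1,2: by left; rewrite (bool_irrelevance h h').
all: have [en|ne] := n =P n'; last by right; case.
all: case: n' / en h' => h'; rewrite (bool_irrelevance h' h).
all: have [<-|ne] := j =P j'; last by right; case.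
all: have [<-|ne] := i =P i'; last by right; case.
all: by left.
Qed.

HB.instance Definition _ (k m s : nat) :=
  hasDecEq.Build (hop k m s) (compareP (@hop_comparable k m s)).

(* The alphabet, the channel indices and the states are named by initial
   segments of the natural numbers. *)
Record holcs (k : nat) : Type := HOLCS {
  h_letters : nat;
  h_chans : nat;
  h_states : nat;
  h_rules : seq ('I_h_states * hop k h_chans h_letters * 'I_h_states)
}.

Definition hcontents (k m s : nat) : Type :=
  {ffun forall n : 'I_k, {ffun 'I_m -> hseq 'I_s n.+1}}.

Definition hconfig (k : nat) (S : holcs k) : Type :=
  ('I_(h_states S) * hcontents k (h_chans S) (h_letters S))%type.

Definition hconfig_le (k : nat) (S : holcs k) (C C' : hconfig S) : Prop :=
  C.1 = C'.1 /\ forall n i, hle (C.2 n i) (C'.2 n i).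

Definition hunchanged (k m s : nat) (mentioned : seq ('I_k * 'I_m))
    (x y : hcontents k m s) : Prop :=
  forall n i, (n, i) \notin mentioned -> y n i = x n i.

Definition hop_step (k m s : nat) (op : hop k m s) (x y : hcontents k m s) :
    Prop :=
  match op with
  | HWrite k_gt0 i a =>
      let c := Ordinal k_gt0 in
      y c i = rcons (x c i) a /\ hunchanged [:: (c, i)] x y
  | HRead k_gt0 i a =>
      let c := Ordinal k_gt0 in
      x c i = a :: y c i /\ hunchanged [:: (c, i)] x y
  | HPush n n_lt j i =>
      let lo := Ordinal (ltnW n_lt) in
      let hi := Ordinal n_lt in
      y hi i = rcons (x hi i) (x lo j) /\ hunchanged [:: (hi, i)] x y
  | HPop n n_lt j i =>
      let lo := Ordinal (ltnW n_lt) in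
      let hi := Ordinal n_lt in
      x hi j = y lo i :: y hi j /\ hunchanged [:: (hi, j); (lo, i)] x y
  end.

Definition hreliable (k : nat) (S : holcs k) (C C' : hconfig S) : Prop :=
  exists op, (C.1, op, C'.1) \in h_rules S /\ hop_step op C.2 C'.2.

Definition hlosing (k : nat) (S : holcs k) (C C' : hconfig S) : Prop :=
  hconfig_le C' C /\ C' <> C.

Definition hstep (k : nat) (S : holcs k) (C C' : hconfig S) : Prop :=
  hreliable C C' \/ hlosing C C'.

Record hinstance (k : nat) : Type := HInstance {
  hi_sys : holcs k;
  hi_src : hconfig hi_sys;
  hi_tgt : hconfig hi_sys
}.

Definition hreachable (k : nat) (I : hinstance k) : Prop :=
  clos_refl_trans _ (@hstep k (hi_sys I)) (hi_src I) (hi_tgt I).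

(* In a rule [(q, i, w, a, q')] the boolean [w] is [true] for a write and
   [false] for a read. *)
Record pcs (d : nat) : Type := PCS {
  p_chans : nat;
  p_states : nat;
  p_rules : seq ('I_p_states * 'I_p_chans * bool * 'I_d.+1 * 'I_p_states)
}.

Definition pconfig (d : nat) (S : pcs d) : Type :=
  ('I_(p_states S) * {ffun 'I_(p_chans S) -> seq 'I_d.+1})%type.

Definition pwrite (d : nat) (S : pcs d) (C C' : pconfig S) : Prop :=
  exists i a, [/\ (C.1, i, true, a, C'.1) \in p_rules S,
    C'.2 i = rcons (C.2 i) a & forall j, j != i -> C'.2 j = C.2 j].

Definition pread (d : nat) (S : pcs d) (C C' : pconfig S) : Prop :=
  exists i a, [/\ (C.1, i, false, a, C'.1) \in p_rules S,
    C.2 i = a :: C'.2 i & forall j, j != i -> C'.2 j = C.2 j].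

Definition psupersede (d : nat) (S : pcs d) (C C' : pconfig S) : Prop :=
  C'.1 = C.1 /\
  exists i u (a b : 'I_d.+1) v, [/\ a <= b, C.2 i = u ++ [:: a, b & v],
    C'.2 i = u ++ b :: v & forall j, j != i -> C'.2 j = C.2 j].

Definition pstep (d : nat) (S : pcs d) (C C' : pconfig S) : Prop :=
  [\/ pread C C', pwrite C C' | psupersede C C'].

Record pinstance (d : nat) : Type := PInstance {
  pi_sys : pcs d;
  pi_src : pconfig pi_sys;
  pi_tgt : pconfig pi_sys
}.

Definition preachable (d : nat) (I : pinstance d) : Prop :=
  clos_refl_trans _ (@pstep d (pi_sys I)) (pi_src I) (pi_tgt I).

(* All the codes are self-delimiting, hence are simply concatenated. A finite
   set is presented by listing its elements, so its cardinal is written in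
   unary; the name of an element is then no longer than the listing, and unary
   and binary names are interchangeable in logarithmic space. *)
Definition enc_seq (T : Type) (enc : T -> seq bool) (x : seq T) : seq bool :=
  flatten [seq true :: enc a | a <- x] ++ [:: false].

Definition enc_nat (n : nat) : seq bool := nseq n true ++ [:: false].

Fixpoint enc_hseq (s n : nat) : hseq 'I_s n -> seq bool :=
  if n is n'.+1 then enc_seq (@enc_hseq s n')
  else fun a : 'I_s => enc_nat a.

Definition enc_hop (k m s : nat) (op : hop k m s) : seq bool :=
  match op with
  | HWrite _ i a => enc_nat 0 ++ enc_nat i ++ enc_nat a
  | HRead _ i a => enc_nat 1 ++ enc_nat i ++ enc_nat a
  | HPush n _ j i => enc_nat 2 ++ enc_nat n ++ enc_nat j ++ enc_nat i
  | HPop n _ j i => enc_nat 3 ++ enc_nat n ++ enc_nat j ++ enc_nat i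
  end.

Definition enc_hrule (k m s q : nat) (r : 'I_q * hop k m s * 'I_q) : seq bool :=
  enc_nat r.1.1 ++ enc_hop r.1.2 ++ enc_nat r.2.

Definition enc_holcs (k : nat) (S : holcs k) : seq bool :=
  enc_nat (h_letters S) ++ enc_nat (h_chans S) ++ enc_nat (h_states S) ++
  enc_seq (@enc_hrule _ _ _ _) (h_rules S).

Definition enc_hconfig (k : nat) (S : holcs k) (C : hconfig S) : seq bool :=
  enc_nat C.1 ++
  flatten [seq enc_hseq (C.2 n i) | n <- enum 'I_k, i <- enum 'I_(h_chans S)].

Definition enc_hinstance (k : nat) (I : hinstance k) : seq bool :=
  enc_holcs (hi_sys I) ++ enc_hconfig (hi_src I) ++ enc_hconfig (hi_tgt I).

Definition enc_prule (d m q : nat) (r : 'I_q * 'I_m * bool * 'I_d.+1 * 'I_q) :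
    seq bool :=
  let: (p, i, w, a, p') := r in
  enc_nat p ++ enc_nat i ++ [:: w] ++ enc_nat a ++ enc_nat p'.

Definition enc_pcs (d : nat) (S : pcs d) : seq bool :=
  enc_nat (p_chans S) ++ enc_nat (p_states S) ++
  enc_seq (@enc_prule _ _ _) (p_rules S).

Definition enc_pconfig (d : nat) (S : pcs d) (C : pconfig S) : seq bool :=
  enc_nat C.1 ++
  flatten [seq enc_seq (fun a : 'I_d.+1 => enc_nat a) (C.2 i)
          | i <- enum 'I_(p_chans S)].

Definition enc_pinstance (d : nat) (I : pinstance d) : seq bool :=
  enc_pcs (pi_sys I) ++ enc_pconfig (pi_src I) ++ enc_pconfig (pi_tgt I).

(* Deterministic Turing machines with a two-way read-only input tape delimited
   by end markers, finitely many read-write work tapes that are infinite to the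
   right, and a one-way write-only output tape. The machine halts when its
   transition function returns [None]. *)
Inductive insym : Type := LeftEnd | RightEnd | Letter of bool.

Inductive move : Type := MoveL | MoveS | MoveR.

Record transducer : Type := Transducer {
  t_state : finType;
  t_sym : finType;
  t_tapes : nat;
  t_start : t_state;
  t_blank : t_sym;
  t_delta : t_state -> insym -> {ffun 'I_t_tapes -> t_sym} ->
    option (t_state * move * {ffun 'I_t_tapes -> t_sym * move} * option bool)
}.

Record tconf (M : transducer) : Type := TConf {
  c_state : t_state M;
  c_in : nat;
  c_head : 'I_(t_tapes M) -> nat;
  c_tape : 'I_(t_tapes M) -> nat -> t_sym M;
  c_out : seq bool
}.

(* Input position 0 is the left marker, positions [1 .. size w] hold [w]. *)
Definition read_input (w : seq bool) (p : nat) : insym :=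
  if p is p'.+1 then
    if p' < size w then Letter (nth false w p') else RightEnd
  else LeftEnd.

(* A move to the left of cell 0 leaves the head on cell 0. *)
Definition shift (mv : move) (p : nat) : nat :=
  match mv with MoveL => p.-1 | MoveS => p | MoveR => p.+1 end.

Definition tinit (M : transducer) : tconf M :=
  TConf (t_start M) 0 (fun=> 0) (fun _ _ => t_blank M) [::].

Definition tstep (M : transducer) (w : seq bool) (c : tconf M) :
    option (tconf M) :=
  if t_delta (c_state c) (read_input w (c_in c))
       [ffun i => c_tape c i (c_head c i)] is Some (q, mv, act, o)
  then Some (TConf q
    (minn (shift mv (c_in c)) (size w).+1)
    (fun i => shift (act i).2 (c_head c i))
    (fun i p => if p == c_head c i then (act i).1 else c_tape c i p)
    (if o is Some b then rcons (c_out c) b else c_out c))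
  else None.

Definition trun (M : transducer) (w : seq bool) (t : nat) : option (tconf M) :=
  iter t (obind (@tstep M w)) (Some (tinit M)).

Definition toutputs (M : transducer) (w v : seq bool) : Prop :=
  exists t c, [/\ trun M w t = Some c, tstep w c = None & c_out c = v].

(* Since the heads start on cell 0 and move by at most one cell, the bound on
   their positions is a bound on the number of visited cells of each tape. *)
Definition tspace (M : transducer) (w : seq bool) (b : nat) : Prop :=
  forall t c, trun M w t = Some c -> forall i, c_head c i < b.

Definition logspace_computable (A B : Type) (encA : A -> seq bool)
    (encB : B -> seq bool) (f : A -> B) : Prop :=
  exists (M : transducer) (K : nat), forall x : A,
    toutputs M (encA x) (encB (f x)) /\
    tspace M (encA x) (K * (trunc_log 2 (size (encA x))).+1).

(* Main.v *)
(* A letter is coded by a word of fixed length over the priorities 0 and 1, and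
   the separator [n + 2] ends the elements of order [n] of a word of order
   [n + 1]. A separator can only be superseded once the element after it has
   been emptied, so superseding erases whole elements or leaves a block of the
   wrong length, which decodes to nothing: decoding is monotone, and
   superseding is simulated by losing steps. Conversely a loss is a sequence of
   superseding steps, except that a leading element is reduced to its separator,
   which is then read. A push rotates the channel around a marker of the next
   priority while copying it, and a pop moves letters up to the next separator
   into a channel that has been emptied.

   For the complexity, the rules are printed by nested loops whose counters are
   bounded by the input length; such programs run on a one-tape machine whose
   tracks are binary counters. *)

Require Import Defs.
From HB Require Import structures.
From mathcomp Require Import all_boot zify.
From Stdlib Require Import FunctionalExtensionality Classical.

Set Implicit Arguments.
Unset Strict Implicit.
Unset Printing Implicit Defensive.

(** * Loop programs on logarithmically many cells *)

(** The obstacle in the backward direction is that superseding may strike between any two steps of a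
    gadget, also on words that are only half copied. The invariants of a gadget therefore compare
    the current contents with those on entry alone. The simulated step is credited when the gadget
    ends, and the losses suffered meanwhile are placed before or after it. The marker of a transfer
    needs no priority of its own, which keeps the level at [k.+1]: between the channels of indices
    [n] and [n.+1] the marker is [sep n.+1], the separator of the upper channel, and [n < k] gives
    [sep n <= k.+1]. A marked word thus has the shape of an element of the upper channel, up to a
    leading [sep n], so that monotonicity of decoding also bounds what has been copied. *)

Definition upd (T : Type) (x : nat -> T) (c : nat) (u : T) : nat -> T :=
  fun c' => if c' == c then u else x c'.

Inductive cmd : Type :=
  | Skip
  | Out of bool
  | Seq of cmd & cmd
  | For of nat & cmd
  | While of cmd
  | ReadNat of cmd
  | IfBit of cmd & cmd
  | IfEq of nat & nat & cmd & cmd.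

Inductive for_loop (n : nat)
    (body : nat -> seq bool -> seq bool -> seq bool -> Prop) :
    nat -> seq bool -> seq bool -> seq bool -> Prop :=
  | ForStop s : for_loop n body n s [::] s
  | ForNext i s o s1 o' s' : i < n -> body i s o s1 ->
      for_loop n body i.+1 s1 o' s' -> for_loop n body i s (o ++ o') s'.

Inductive while_loop
    (body : nat -> seq bool -> seq bool -> seq bool -> Prop) :
    nat -> seq bool -> seq bool -> seq bool -> Prop :=
  | WhileStop i s : while_loop body i (false :: s) [::] s
  | WhileNext i s o s1 o' s' : body i s o s1 ->
      while_loop body i.+1 s1 o' s' ->
      while_loop body i (true :: s) (o ++ o') s'.

(* [exec c env s o s']: with the values of the variables listed in [env], and
   [s] left to read on the input, [c] outputs [o] and leaves [s'] to read. A
   variable is named by its position in [env], and the variable bound by [For],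
   [While] (the number of the current iteration) or [ReadNat] is pushed at the
   end. *)
Fixpoint exec (c : cmd) (env : seq nat) (s o s' : seq bool) : Prop :=
  match c with
  | Skip => o = [::] /\ s' = s
  | Out b => o = [:: b] /\ s' = s
  | Seq c1 c2 => exists o1 s1 o2,
      [/\ exec c1 env s o1 s1, exec c2 env s1 o2 s' & o = o1 ++ o2]
  | For v c1 => v < size env /\
      for_loop (nth 0 env v) (fun i => exec c1 (rcons env i)) 0 s o s'
  | While c1 => while_loop (fun i => exec c1 (rcons env i)) 0 s o s'
  | ReadNat c1 => exists n s1,
      s = enc_nat n ++ s1 /\ exec c1 (rcons env n) s1 o s'
  | IfBit c1 c2 => exists b s1,
      s = b :: s1 /\ exec (if b then c1 else c2) env s1 o s'
  | IfEq u v c1 c2 => [/\ u < size env, v < size env &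
      exec (if nth 0 env u == nth 0 env v then c1 else c2) env s o s']
  end.

(** The number of registers needed beyond the free variables. It depends on the program only, so the
    work alphabet, with one track per register, is fixed. *)
Fixpoint height (c : cmd) : nat :=
  match c with
  | Skip | Out _ => 0
  | Seq c1 c2 | IfBit c1 c2 | IfEq _ _ c1 c2 => maxn (height c1) (height c2)
  | For _ c1 | While c1 | ReadNat c1 => (height c1).+1
  end.

Lemma exec_size c env s o s' : exec c env s o s' -> size s' <= size s.
Proof.
elim: c env s o s' => [|b|c1 IH1 c2 IH2|v c IH|c IH|c IH|c1 IH1 c2 IH2|u v c1 IH1 c2 IH2] env s o s' /=.
- by case=> _ ->.
- by case=> _ ->.
- by case=> o1 [s1 [o2 [/IH1 le1 /IH2 le2 _]]]; apply: leq_trans le1.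
- case=> _; elim=> {s o s'} // i s o s1 o' s' _ /IH le1 _ le2.
  exact: leq_trans le1.
- elim=> {s o s'} [i s|i s o s1 o' s' /IH le1 _ le2] //=.
  by rewrite (leq_trans le2) // leqW.
- case=> n [s1 [-> /IH le1]]; apply: leq_trans le1 _.
  by rewrite size_cat leq_addl.
- by case=> b [s1 [-> /=]]; case: b => [/IH1|/IH2] /leqW.
- by case=> _ _; case: eqP => _; [apply: IH1|apply: IH2].
Qed.

Arguments exec : simpl never.

(* Jump targets are absolute. [IEq] jumps if the registers are equal, [IBit] if
   the letter under the input head is not [true]. *)
Inductive instr : Type :=
  | IOut of bool
  | IRight
  | IRewind
  | IZero of nat
  | IInc of nat
  | IEq of nat & nat & nat
  | IBit of nat
  | IJmp of nat.

(** [d] is the number of variables in scope, hence also the register taken by the next binder; [a]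
    is the address of the first instruction. *)
Fixpoint comp (c : cmd) (d a : nat) : seq instr :=
  match c with
  | Skip => [::]
  | Out b => [:: IOut b]
  | Seq c1 c2 =>
      let k1 := comp c1 d a in k1 ++ comp c2 d (a + size k1)
  | For v c1 =>
      let k1 := comp c1 d.+1 a.+2 in
      [:: IZero d, IEq d v (a + size k1).+4 & k1] ++ [:: IInc d; IJmp a.+1]
  | While c1 =>
      let k1 := comp c1 d.+1 a.+3 in
      [:: IZero d, IBit (a + size k1).+1.+4, IRight & k1] ++
      [:: IInc d; IJmp a.+1; IRight]
  | ReadNat c1 =>
      [:: IZero d; IBit a.+1.+4; IRight; IInc d; IJmp a.+1; IRight] ++
      comp c1 d.+1 a.+2.+4
  | IfBit c1 c2 =>
      let k1 := comp c1 d a.+2 in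
      let k2 := comp c2 d (a + size k1).+4 in
      [:: IBit (a + size k1).+3, IRight & k1] ++
      [:: IJmp (a + size k1 + size k2).+4, IRight & k2]
  | IfEq u v c1 c2 =>
      let k2 := comp c2 d a.+1 in
      let k1 := comp c1 d (a + size k2).+2 in
      IEq u v (a + size k2).+2 :: k2 ++
      IJmp (a + size k2 + size k1).+2 :: k1
  end.

(** * Binary expansions and carries *)

Definition bit (n p : nat) : bool := odd (iter p half n).

Lemma bitS n p : bit n p.+1 = bit n./2 p.
Proof. by rewrite /bit iterSr. Qed.

(** The carry reaches position [p] exactly when all lower bits are ones. *)
Lemma bit_succ n p : bit n.+1 p = bit n p (+) all (bit n) (iota 0 p).
Proof.
elim: p n => [|p IH] n; first by rewrite /bit /= addbT.
rewrite !bitS /= -[1]/(1 + 0) iotaDl all_map.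
have -> : all (preim [eta addn 1] (bit n)) (iota 0 p) = all (bit n./2) (iota 0 p).
  by apply: eq_all => i /=; rewrite add1n bitS.
rewrite /bit -/(bit _ _) /= uphalf_half; case: (odd n) => /=.
  by rewrite add1n IH.
by rewrite add0n addbF.
Qed.

(** This detects the increment that overflows [U] bits, the only case in which the registers get one
    more cell. *)
Lemma bits_ones n U : n < 2 ^ U -> all (bit n) (iota 0 U) = (n.+1 == 2 ^ U).
Proof.
elim: U n => [|U IH] n ltn; first by move: ltn; rewrite ltnS leqn0 => /eqP ->.
rewrite /= -[1]/(1 + 0) iotaDl all_map.
have -> : all (preim [eta addn 1] (bit n)) (iota 0 U) = all (bit n./2) (iota 0 U).
  by apply: eq_all => i /=; rewrite add1n bitS.
rewrite -(odd_double_half n) expnS mul2n in ltn *.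
rewrite IH /bit /=; case: (odd n) ltn; rewrite ?add1n ?add0n; lia.
Qed.

Lemma bits_inj n n' U : n < 2 ^ U -> n' < 2 ^ U ->
  (forall p, p < U -> bit n p = bit n' p) -> n = n'.
Proof.
elim: U n n' => [|U IH] n n' ltn ltn' eqb.
  by move: ltn ltn'; rewrite expn0; lia.
have eqo : odd n = odd n' := eqb 0 isT.
have eqh : n./2 = n'./2.
  apply: IH => [||p ltp]; try by move: ltn ltn'; rewrite expnS; lia.
  by rewrite -!bitS eqb.
by rewrite -(odd_double_half n) eqo eqh odd_double_half.
Qed.

Lemma bit0n p : bit 0 p = false.
Proof. by elim: p => // p IH; rewrite bitS. Qed.

Section Machine.

Variables (code : seq instr) (R : nat).

Notation word := {ffun 'I_R.+1 -> bool}.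

(* The registers are the tracks of a single work tape, with the least
   significant bits on cell 1; [Some None] marks cell 0. *)
Definition sym : Type := option (option word).

(* [None]: between instructions; [Some None]: moving right over the registers;
   [Some (Some b)]: moving back with the result [b]. *)
Definition phase : Type := option (option bool).

Definition mstate : Type := option ('I_(size code).+1 * phase).

Definition setw (b : word) (r : nat) (x : bool) : word :=
  [ffun i : 'I_R.+1 => if i == r :> nat then x else b i].

(** Sweeps start at the least significant bit. [None] continues the sweep and [Some res] turns back
    with result [res]: an increment stops at the first zero bit, where the carry dies, and a
    comparison at the first difference. A sweep that reaches the end answers [true]. *)
Definition cell_op (ins : instr) (b : word) : word * option bool :=
  match ins with
  | IZero r => (setw b r false, None)
  | IInc r => if b (inord r) then (setw b r false, None)
              else (setw b r true, Some true)
  | IEq u v _ => (b, if b (inord u) == b (inord v) then None else Some false)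
  | _ => (b, None)
  end.

(** An increment reaches the blank only with a carry left over, which becomes the new top bit; the
    other registers get a leading zero. *)
Definition end_op (ins : instr) : sym :=
  if ins is IInc r then Some (Some (setw [ffun=> false] r true)) else None.

Definition next_pc (ins : instr) (res : bool) (a : nat) : nat :=
  if ins is IEq _ _ l then if res then l else a.+1 else a.+1.

Definition at_pc (a : nat) (ph : phase) : mstate := Some (inord a, ph).

Definition mdelta_at (a : nat) (ph : phase) (ins : instr) (inp : insym)
    (x : sym) : mstate * move * (sym * move) * option bool :=
  match ph with
  | None =>
    match ins with
    | IOut b => (at_pc a.+1 None, MoveS, (x, MoveS), Some b)
    | IRight => (at_pc a.+1 None, MoveR, (x, MoveS), None)
    | IRewind => if inp is LeftEnd then (at_pc a.+1 None, MoveR, (x, MoveS), None)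
                 else (at_pc a None, MoveL, (x, MoveS), None)
    | IBit l => (at_pc (if inp is Letter true then a.+1 else l) None,
                 MoveS, (x, MoveS), None)
    | IJmp l => (at_pc l None, MoveS, (x, MoveS), None)
    | _ => (at_pc a (Some None), MoveS, (x, MoveR), None)
    end
  | Some None =>
    if x is Some (Some b) then
      let: (b', stop) := cell_op ins b in
      if stop is Some res then
        (at_pc a (Some (Some res)), MoveS, (Some (Some b'), MoveL), None)
      else (at_pc a (Some None), MoveS, (Some (Some b'), MoveR), None)
    else (at_pc a (Some (Some true)), MoveS, (end_op ins, MoveL), None)
  | Some (Some res) =>
    if x is Some None then (at_pc (next_pc ins res a) None, MoveS, (x, MoveS), None)
    else (at_pc a (Some (Some res)), MoveS, (x, MoveL), None)
  end.

(** The state [None] serves for a single initial step, which marks cell 0 and moves the input head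
    off the left marker. The machine halts when the program counter leaves [code]. *)
Definition mdelta (st : mstate) (inp : insym) (x : {ffun 'I_1 -> sym}) :
    option (mstate * move * {ffun 'I_1 -> sym * move} * option bool) :=
  if st is Some (a, ph) then
    if onth code a is Some ins then
      let: (st', mv, act, o) := mdelta_at a ph ins inp (x ord0) in
      Some (st', mv, [ffun=> act], o)
    else None
  else Some (at_pc 0 None, MoveR, [ffun=> (Some None, MoveS)], None).

Definition mach : transducer :=
  Transducer (None : mstate) (None : sym) mdelta.

Variable w : seq bool.

Notation log_w := (trunc_log 2 (size w)).+1.

(** A sweep goes up to cell [U.+1] with [U <= log_w]. The strict bound [l.+1 < 3 * l] holds for all
    [l > 0], whereas a factor 2 would fail at [l = 1]. *)
Definition fits (c : tconf mach) : Prop := forall i, c_head c i < 3 * log_w.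

Inductive steps : tconf mach -> tconf mach -> Prop :=
  | StepsRefl c : fits c -> steps c c
  | StepsNext c c1 c2 : fits c -> tstep w c = Some c1 -> steps c1 c2 ->
      steps c c2.

Lemma steps_trans c1 c2 c3 : steps c1 c2 -> steps c2 c3 -> steps c1 c3.
Proof. by elim=> {c1 c2} // c c1 c2 fc st _ IH /IH; apply: StepsNext. Qed.

Definition mconf (a : nat) (ph : phase) (pos h : nat) (T : nat -> sym) out :
    tconf mach :=
  @TConf mach (at_pc a ph) pos (fun=> h) (fun=> T) out.

Lemma steps_mconf a ph pos h T out ins a' ph' mv x mv' o c :
  onth code a = Some ins -> h < 3 * log_w ->
  mdelta_at a ph ins (read_input w pos) (T h) = (at_pc a' ph', mv, (x, mv'), o) ->
  steps (mconf a' ph' (minn (shift mv pos) (size w).+1) (shift mv' h)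
           (upd T h x) (if o is Some b then rcons out b else out)) c ->
  steps (mconf a ph pos h T out) c.
Proof.
move=> ins_a lth dE; apply: StepsNext => [i //|].
rewrite /tstep /= inordK; last first.
  by rewrite ltnS ltnW // ltnNge; apply/negP => /onth_default; rewrite ins_a.
rewrite ins_a ffunE dE; congr (Some (TConf _ _ _ _ _)).
- by apply: functional_extensionality => i; rewrite ffunE.
- apply: functional_extensionality => i; apply: functional_extensionality => p.
  by rewrite ffunE.
Qed.

Definition cell (v : nat -> nat) (q : nat) : word := [ffun r : 'I_R.+1 => bit (v r) q].

Definition tape (v : nat -> nat) (U : nat) (p : nat) : sym :=
  if p is q.+1 then if q < U then Some (Some (cell v q)) else None
  else Some None.

Definition registers_fit (v : nat -> nat) (U : nat) : Prop :=
  U <= log_w /\ forall r, v r < 2 ^ U.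

(** The common length [U] of the registers is hidden, so that an increment may change it silently.
    The input head is at [pos.+1] because input cell 0 is the left marker. *)
Definition at_rest (a : nat) (s : seq bool) (v : nat -> nat) (out : seq bool)
    (c : tconf mach) : Prop :=
  exists pos U, [/\ c = mconf a None pos.+1 0 (tape v U) out,
    pos <= size w, drop pos w = s & registers_fit v U].

Definition runs a s v out a' s' v' out' : Prop :=
  forall c, at_rest a s v out c ->
  exists2 c', steps c c' & at_rest a' s' v' out' c'.

Lemma runs_refl a s v out : runs a s v out a s v out.
Proof.
move=> c rc; exists c => //; apply: StepsRefl => i.
by case: rc => pos [U [-> _ _ _]].
Qed.

Lemma runs_trans a s v out a1 s1 v1 out1 a2 s2 v2 out2 :
  runs a s v out a1 s1 v1 out1 -> runs a1 s1 v1 out1 a2 s2 v2 out2 ->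
  runs a s v out a2 s2 v2 out2.
Proof.
move=> r1 r2 c /r1[c1 st1 /r2[c2 st2 rc2]].
by exists c2 => //; apply: steps_trans st1 st2.
Qed.

Lemma upd_id (T : Type) (x : nat -> T) c : upd x c (x c) = x.
Proof. by apply: functional_extensionality => c'; rewrite /upd; case: eqP => [->|]. Qed.

Lemma pos_min pos : pos <= size w -> minn pos.+1 (size w).+1 = pos.+1.
Proof. by move=> le; apply/minn_idPl. Qed.

Lemma read_at pos b s : drop pos w = b :: s ->
  read_input w pos.+1 = Letter b /\ pos < size w.
Proof.
move=> E; have ltp : pos < size w.
  by rewrite ltnNge; apply/negP => /drop_oversize; rewrite E.
by rewrite /= ltp -[pos in nth _ _ pos]addn0 -nth_drop E.
Qed.

Lemma runs_out a b s v out : onth code a = Some (IOut b) ->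
  runs a s v out a.+1 s v (rcons out b).
Proof.
move=> ins_a c [pos [U [-> lep dr gd]]].
exists (mconf a.+1 None pos.+1 0 (tape v U) (rcons out b)); last by exists pos, U.
apply: (steps_mconf ins_a) => //=.
by rewrite upd_id pos_min //; apply: StepsRefl.
Qed.

Lemma runs_jmp a l s v out : onth code a = Some (IJmp l) ->
  runs a s v out l s v out.
Proof.
move=> ins_a c [pos [U [-> lep dr gd]]].
exists (mconf l None pos.+1 0 (tape v U) out); last by exists pos, U.
apply: (steps_mconf ins_a) => //=.
by rewrite upd_id pos_min //; apply: StepsRefl.
Qed.

Lemma runs_bit a l b s v out : onth code a = Some (IBit l) ->
  runs a (b :: s) v out (if b then a.+1 else l) (b :: s) v out.
Proof.
move=> ins_a c [pos [U [-> lep dr gd]]].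
have [rd _] := read_at dr.
exists (mconf (if b then a.+1 else l) None pos.+1 0 (tape v U) out); last by exists pos, U.
apply: (steps_mconf (a' := if b then a.+1 else l) (ph' := None) (mv := MoveS)
  (x := tape v U 0) (mv' := MoveS) (o := None) ins_a) => //; first by rewrite rd.
by rewrite upd_id pos_min //; apply: StepsRefl.
Qed.

Lemma runs_right a b s v out : onth code a = Some IRight ->
  runs a (b :: s) v out a.+1 s v out.
Proof.
move=> ins_a c [pos [U [-> lep dr gd]]].
have [_ ltp] := read_at dr.
exists (mconf a.+1 None pos.+2 0 (tape v U) out); last first.
  by exists pos.+1, U; split=> //; rewrite -add1n -drop_drop dr /= drop0.
apply: (steps_mconf ins_a) => //=.
by rewrite upd_id pos_min //; apply: StepsRefl.
Qed.


Lemma runs_rewind a s v out : onth code a = Some IRewind ->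
  runs a s v out a.+1 w v out.
Proof.
move=> ins_a c [pos [U [-> lep _ gd]]].
exists (mconf a.+1 None 1 0 (tape v U) out); last by exists 0, U; rewrite drop0.
have: pos.+1 <= (size w).+1 by [].
(* The induction is on the head position, which decreases to the left marker. *)
move: pos.+1 => p {pos lep}; elim: p => [_|p IH lep].
  apply: (steps_mconf ins_a) => //=.
  rewrite upd_id (_ : minn 1 _ = 1); last by apply/minn_idPl.
  exact: StepsRefl.
apply: (steps_mconf (a' := a) (ph' := None) (mv := MoveL)
          (x := Some None) (mv' := MoveS) (o := None) ins_a) => //.
  by rewrite /mdelta_at /read_input; case: ifP.
rewrite (upd_id (tape v U) 0) (minn_idPl _) /=; last exact: ltnW lep.
by apply: IH; apply: ltnW.
Qed.

Lemma steps_back a ins res pos h T out : onth code a = Some ins ->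
  pos <= size w -> h < 3 * log_w -> T 0 = Some None ->
  (forall p, T p.+1 <> Some None) ->
  steps (mconf a (Some (Some res)) pos.+1 h T out)
        (mconf (next_pc ins res a) None pos.+1 0 T out).
Proof.
move=> ins_a lep + T0 TS; elim: h => [|h IH] lth.
  apply: (steps_mconf (mv := MoveS) (x := T 0) (mv' := MoveS) (o := None) ins_a lth).
    by rewrite /= T0.
  by rewrite upd_id pos_min //; apply: StepsRefl.
apply: (steps_mconf (mv := MoveS) (x := T h.+1) (mv' := MoveL) (o := None) ins_a lth).
  by move: (TS h); rewrite /=; case: (T h.+1) => [[]|].
by rewrite upd_id pos_min //; apply/IH/ltnW.
Qed.

(** The tape in the middle of a sweep that changes the registers from [v] to [v'], when cells [1] to
    [q] have been rewritten. *)
Definition mix (v v' : nat -> nat) (U q p : nat) : sym :=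
  if p <= q then tape v' U p else tape v U p.

Lemma mix0 v v' U : mix v v' U 0 = tape v U.
Proof. by apply: functional_extensionality; case. Qed.

Lemma mix_end v v' U : mix v v' U U = tape v' U.
Proof.
apply: functional_extensionality => -[|p] //; rewrite /mix /=.
by case: ltnP.
Qed.

Lemma mixS v v' U q : q < U ->
  upd (mix v v' U q) q.+1 (Some (Some (cell v' q))) = mix v v' U q.+1.
Proof.
move=> ltq; apply: functional_extensionality => p; rewrite /upd /mix.
have [->|ne] := eqVneq p q.+1; first by rewrite leqnn /= ltq.
by rewrite [in RHS]leq_eqVlt (negPf ne).
Qed.

Lemma tape_mark v U p : tape v U p.+1 <> Some None.
Proof. by rewrite /=; case: ifP. Qed.

Lemma head_fits U p : U <= log_w -> p <= U.+1 -> p < 3 * log_w.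
Proof. move: log_w (ltn0Sn (trunc_log 2 (size w))) => l; lia. Qed.

Lemma steps_sweep a ins v v' U q pos out c : onth code a = Some ins ->
  pos <= size w -> U <= log_w -> q <= U ->
  (forall p, p < q -> cell_op ins (cell v p) = (cell v' p, None)) ->
  steps (mconf a (Some None) pos.+1 q.+1 (mix v v' U q) out) c ->
  steps (mconf a (Some None) pos.+1 1 (tape v U) out) c.
Proof.
move=> ins_a lep leU; elim: q => [|q IH] leq op st; first by rewrite -(mix0 v v').
apply: IH => [||]; [exact: ltnW | by move=> p ltp; apply/op/ltnW |].
apply: (steps_mconf (a' := a) (ph' := Some None) (mv := MoveS)
  (x := Some (Some (cell v' q))) (mv' := MoveR) (o := None) ins_a).
- by apply: (head_fits leU); apply: leqW.
- by rewrite /mix ltnn /= leq /= op.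
by rewrite mixS // pos_min.
Qed.

Lemma runs_start a ins s v out a' s' v' : onth code a = Some ins ->
  match ins with IZero _ | IInc _ | IEq _ _ _ => True | _ => False end ->
  (forall pos U, pos <= size w -> drop pos w = s -> registers_fit v U ->
    exists2 c', steps (mconf a (Some None) pos.+1 1 (tape v U) out) c' &
      at_rest a' s' v' out c') ->
  runs a s v out a' s' v' out.
Proof.
move=> ins_a sweep st c [pos [U [-> lep dr gd]]].
have [c' stc' rc'] := st _ _ lep dr gd; exists c' => //.
apply: (steps_mconf (a' := a) (ph' := Some None) (mv := MoveS)
  (x := Some None) (mv' := MoveR) (o := None) ins_a) => //.
  by case: (ins) sweep.
by rewrite (upd_id (tape v U) 0) pos_min.
Qed.

Lemma steps_end a ins v U pos out c : onth code a = Some ins ->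
  pos <= size w -> U <= log_w ->
  steps (mconf a (Some (Some true)) pos.+1 U (upd (tape v U) U.+1 (end_op ins)) out) c ->
  steps (mconf a (Some None) pos.+1 U.+1 (tape v U) out) c.
Proof.
move=> ins_a lep leU st.
apply: (steps_mconf (a' := a) (ph' := Some (Some true)) (mv := MoveS)
  (x := end_op ins) (mv' := MoveL) (o := None) ins_a).
- exact: (head_fits leU).
- by rewrite /= ltnn.
by rewrite pos_min.
Qed.

Lemma upd_end v U : upd (tape v U) U.+1 None = tape v U.
Proof.
rewrite -[RHS](upd_id _ U.+1); congr (upd _ _ _); by rewrite /= ltnn.
Qed.

Lemma setw_cell v r q x n : r <= R -> bit n q = x ->
  setw (cell v q) r x = cell (upd v r n) q.
Proof.
move=> ler bx; apply/ffunP => i; rewrite !ffunE /upd.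
by case: eqP => //.
Qed.

Lemma registers_fit_upd v U r n : registers_fit v U -> n < 2 ^ U -> registers_fit (upd v r n) U.
Proof. by case=> leU ltv ltn; split=> // r'; rewrite /upd; case: eqP. Qed.

Lemma runs_zero a r s v out : onth code a = Some (IZero r) -> r <= R ->
  runs a s v out a.+1 s (upd v r 0) out.
Proof.
move=> ins_a ler; apply: (runs_start ins_a) => // pos U lep dr gd.
have leU := gd.1.
exists (mconf a.+1 None pos.+1 0 (tape (upd v r 0) U) out); last first.
  by exists pos, U; split=> //; apply: registers_fit_upd gd _; rewrite expn_gt0.
apply: (steps_sweep (v' := upd v r 0) ins_a lep leU (leqnn U)) => [p ltp|].
  by rewrite /= (@setw_cell _ _ _ _ 0) ?bit0n.
rewrite mix_end; apply: (steps_end ins_a lep leU).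
rewrite upd_end; apply: (steps_back true _ ins_a) => //; last exact: tape_mark.
exact: (head_fits leU).
Qed.

Lemma cell_inord v r q : r <= R -> cell v q (inord r) = bit (v r) q.
Proof. by move=> ler; rewrite ffunE inordK. Qed.

Lemma runs_eq a u1 u2 l s v out : onth code a = Some (IEq u1 u2 l) ->
  u1 <= R -> u2 <= R ->
  runs a s v out (if v u1 == v u2 then l else a.+1) s v out.
Proof.
move=> ins_a le1 le2; apply: (runs_start ins_a) => // pos U lep dr gd.
have [leU ltv] := gd.
exists (mconf (if v u1 == v u2 then l else a.+1) None pos.+1 0 (tape v U) out);
  last by exists pos, U.
have mixE q : mix v v U q = tape v U.
  by apply: functional_extensionality => p; rewrite /mix; case: ifP.
case: eqP => [eqv|nev].
  apply: (steps_sweep (v' := v) ins_a lep leU (leqnn U)) => [p ltp|].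
    by rewrite /= !cell_inord // eqv eqxx.
  rewrite mixE; apply: (steps_end ins_a lep leU); rewrite upd_end.
  apply: (steps_back true _ ins_a) => //; last exact: tape_mark.
  exact: (head_fits leU).
have exq : exists q, (q < U) && (bit (v u1) q != bit (v u2) q).
  case: (boolP (has (fun q => bit (v u1) q != bit (v u2) q) (iota 0 U))).
    by case/hasP=> q; rewrite mem_iota => ltq neq; exists q; apply/andP.
  move/hasPn => eqb; case: nev; apply: (bits_inj (ltv u1) (ltv u2)) => q ltq.
  by apply/eqP/negPn/eqb; rewrite mem_iota.
case: (ex_minnP exq) => q /andP[ltq neq] minq.
apply: (steps_sweep (v' := v) ins_a lep leU (ltnW ltq)) => [p ltp|].
  rewrite /= !cell_inord //; case: eqP => // /eqP nep.
  by have := minq p; rewrite nep (ltn_trans ltp ltq) leqNgt ltp => /(_ isT).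
rewrite mixE.
apply: (steps_mconf (a' := a) (ph' := Some (Some false)) (mv := MoveS)
  (x := tape v U q.+1) (mv' := MoveL) (o := None) ins_a).
- by apply: (head_fits leU); apply: ltnW.
- by rewrite /= ltq !cell_inord // (negPf neq).
rewrite upd_id pos_min //.
apply: (steps_back false _ ins_a) => //; last exact: tape_mark.
by apply: (head_fits leU); rewrite leqW // ltnW.
Qed.

Lemma runs_inc a r s v out : onth code a = Some (IInc r) -> r <= R ->
  v r < size w -> runs a s v out a.+1 s (upd v r (v r).+1) out.
Proof.
move=> ins_a ler ltw; apply: (runs_start ins_a) => // pos U lep dr gd.
have [leU ltv] := gd.
set v' := upd v r (v r).+1.
have low q : (forall p, p < q -> bit (v r) p) ->
    forall p, p < q -> cell_op (IInc r) (cell v p) = (cell v' p, None).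
  move=> ones p ltp; rewrite /= cell_inord // ones // (@setw_cell _ _ _ _ (v r).+1) //.
  rewrite bit_succ ones // (_ : all _ _) //; apply/allP => i.
  by rewrite mem_iota => lti; apply: ones; apply: ltn_trans ltp.
(* With ones everywhere the carry runs off the tape and one cell is added. There is room for it:
   [2 ^ U = (v r).+1 <= size w] gives [U < log_w]. *)
case: (boolP (all (bit (v r)) (iota 0 U))) => [ones|].
  have ones' p : p < U -> bit (v r) p.
    by move=> ltp; apply: (allP ones); rewrite mem_iota.
  have vS : (v r).+1 = 2 ^ U by apply/eqP; rewrite -bits_ones.
  have ltU : U < log_w.
    by rewrite ltnS; apply: trunc_log_max; rewrite // -vS.
  exists (mconf a.+1 None pos.+1 0 (tape v' U.+1) out); last first.
    exists pos, U.+1; split=> //; split=> // r'.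
    rewrite /v' /upd; case: eqP => _; first by rewrite vS ltn_exp2l.
    by apply: ltn_trans (ltv r') _; rewrite ltn_exp2l.
  apply: (steps_sweep (v' := v') ins_a lep leU (leqnn U) (low _ ones')).
  rewrite mix_end; apply: (steps_end ins_a lep leU).
  have -> : upd (tape v' U) U.+1 (end_op (IInc r)) = tape v' U.+1.
    apply: functional_extensionality => -[|p] //.
    rewrite /upd /= eqSS; have [->|ne] := eqVneq p U; last first.
      by rewrite ltnS [in RHS]leq_eqVlt (negPf ne).
    rewrite ltnSn; congr (Some (Some _)); apply/ffunP => i; rewrite !ffunE.
    have bit_big n : n < 2 ^ U -> bit n U = false.
      elim: (U) n => [|V IH] n; first by rewrite ltnS leqn0 => /eqP ->.
      by rewrite expnS => ltn; rewrite bitS IH //; lia.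
    rewrite /v' /upd; case: eqP => _; last by rewrite bit_big.
    by rewrite bit_succ bit_big // ones.
  apply: (steps_back true _ ins_a) => //; last exact: tape_mark.
  exact: (head_fits leU).
move=> nones.
have vlt : (v r).+1 < 2 ^ U.
  by rewrite ltn_neqAle ltv andbT -bits_ones.
exists (mconf a.+1 None pos.+1 0 (tape v' U) out); last first.
  by exists pos, U; split=> //; apply: registers_fit_upd.
have exq : exists q, (q < U) && ~~ bit (v r) q.
  move: nones; rewrite -has_predC => /hasP[q]; rewrite mem_iota => ltq nb.
  by exists q; apply/andP.
case: (ex_minnP exq) => q /andP[ltq nbq] minq.
have ones p : p < q -> bit (v r) p.
  move=> ltp; apply/negPn/negP => nb; have := minq p.
  by rewrite nb (ltn_trans ltp ltq) leqNgt ltp => /(_ isT).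
have allq : all (bit (v r)) (iota 0 q).
  by apply/allP => p; rewrite mem_iota => /ones.
apply: (steps_sweep (v' := v') ins_a lep leU (ltnW ltq) (low _ ones)).
apply: (steps_mconf (a' := a) (ph' := Some (Some true)) (mv := MoveS)
  (x := Some (Some (cell v' q))) (mv' := MoveL) (o := None) ins_a).
- by apply: (head_fits leU); apply: ltnW.
- rewrite /mix ltnn /= ltq cell_inord // (negPf nbq).
  by rewrite (@setw_cell _ _ _ _ (v r).+1) // bit_succ allq addbT nbq.
rewrite mixS // pos_min //.
have -> : mix v v' U q.+1 = tape v' U.
  apply: functional_extensionality => p; rewrite /mix; case: leqP => // ltp.
  case: p ltp => // p ltp; rewrite /=; case: ifP => // _.
  congr (Some (Some _)); apply/ffunP => i; rewrite !ffunE /v' /upd.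
  case: eqP => // ->; rewrite bit_succ (_ : all _ _ = false) ?addbF //.
  apply/negP => /allP /(_ q); rewrite mem_iota /= => /(_ ltp).
  by rewrite (negPf nbq).
apply: (steps_back true _ ins_a) => //; last exact: tape_mark.
by apply: (head_fits leU); rewrite leqW // ltnW.
Qed.

(** * Correctness of the compiled code *)

Definition at_code (a : nat) (k : seq instr) : Prop :=
  forall i x, onth k i = Some x -> onth code (a + i) = Some x.

Lemma at_code_cat a k1 k2 : at_code a (k1 ++ k2) ->
  at_code a k1 /\ at_code (a + size k1) k2.
Proof.
move=> ak; split=> i x ki.
  by apply: ak; rewrite onth_cat; case: ltnP => // /onth_default; rewrite ki.
by rewrite -addnA; apply: ak; rewrite onth_cat ltnNge leq_addr addKn.
Qed.

Lemma at_code_cons a x k : at_code a (x :: k) ->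
  onth code a = Some x /\ at_code a.+1 k.
Proof.
move=> ak; split; first by rewrite -(ak 0 x) ?addn0.
by move=> i y ki; rewrite addSnnS; apply: ak.
Qed.

(** Registers from [d] on are scratch space: code compiled with [d] variables in scope may leave
    anything in them. *)
Definition goes (d a : nat) s v out a' s' out' : Prop :=
  exists2 v', runs a s v out a' s' v' out' & forall i, i < d -> v' i = v i.

Lemma goes_trans d a s v out a1 s1 v1 out1 a2 s2 out2 :
  runs a s v out a1 s1 v1 out1 -> (forall i, i < d -> v1 i = v i) ->
  goes d a1 s1 v1 out1 a2 s2 out2 -> goes d a s v out a2 s2 out2.
Proof.
move=> r1 e1 [v2 r2 e2]; exists v2; first exact: runs_trans r1 r2.
by move=> i lti; rewrite e2 ?e1.
Qed.

Lemma goes_runs d a s v out a' s' v' out' : runs a s v out a' s' v' out' ->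
  (forall i, i < d -> v' i = v i) -> goes d a s v out a' s' out'.
Proof. by exists v'. Qed.

Lemma upd_neq (T : Type) (x : nat -> T) c u c' : c' != c -> upd x c u c' = x c'.
Proof. by rewrite /upd => /negPf ->. Qed.

Lemma upd_lt (T : Type) (x : nat -> T) d u i : i < d -> upd x d u i = x i.
Proof. by move=> lti; rewrite upd_neq // ltn_eqF. Qed.

Lemma upd_eq (T : Type) (x : nat -> T) c u : upd x c u c = u.
Proof. by rewrite /upd eqxx. Qed.

(** The bound on the values is what lets counters grow: [runs_inc] asks for a value below
    [size w]. *)
Definition holds (env : seq nat) (v : nat -> nat) : Prop :=
  (forall i, i < size env -> v i = nth 0 env i) /\
  all (fun x => x <= size w) env.

Lemma holds_rcons env v x : holds env v -> v (size env) = x -> x <= size w ->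
  holds (rcons env x) v.
Proof.
move=> [ve bd] vx lex; split; last by rewrite all_rcons lex.
move=> i; rewrite size_rcons nth_rcons ltnS leq_eqVlt => /orP[/eqP ->|lti].
  by rewrite ltnn eqxx.
by rewrite lti ve.
Qed.

Lemma holds_agree env v v' : holds env v ->
  (forall i, i < size env -> v' i = v i) -> holds env v'.
Proof. by case=> ve bd e; split=> // i lti; rewrite e ?ve. Qed.

Lemma holds_nth env v i : holds env v -> nth 0 env i <= size w.
Proof.
case=> _ bd; have [lt|ge] := ltnP i (size env); last by rewrite nth_default.
by apply: (allP bd); apply: mem_nth.
Qed.

Definition correct (c : cmd) : Prop := forall env s o s' a v out,
  exec c env s o s' -> size env + height c <= R.+1 ->
  at_code a (comp c (size env) a) -> holds env v -> size s <= size w ->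
  goes (size env) a s v out (a + size (comp c (size env) a)) s' (out ++ o).

Lemma correct_for u c : correct c -> correct (For u c).
Proof.
move=> IH env s o s' a v out [ltu fl] hR ac hv les; rewrite /= in hR ac *.
set d := size env in hR ac *.
set k1 := comp c d.+1 a.+2 in ac *.
have ledR : d <= R by move: hR; lia.
have [[iz [ie ak]] [ii [ij _]]] : (onth code a = Some (IZero d) /\
    onth code a.+1 = Some (IEq d u (a + size k1).+4) /\ at_code a.+2 k1) /\
    (onth code (a + size k1).+2 = Some (IInc d) /\
     onth code (a + size k1).+3 = Some (IJmp a.+1) /\ True).
  have [/at_code_cons[iz /at_code_cons[ie ak]]] := @at_code_cat a [:: IZero d, IEq d u (a + size k1).+4 & k1] _ ac.
  rewrite /= !addnS => /at_code_cons[ii /at_code_cons[ij _]].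
  by do !split.
have -> : a + (size (k1 ++ [:: IInc d; IJmp a.+1])).+2 = (a + size k1).+4.
  by rewrite size_cat /=; lia.
have agz : forall i, i < d -> upd v d 0 i = v i by move=> i; apply: upd_lt.
apply: (goes_trans (runs_zero iz ledR) agz).
have: upd v d 0 d = 0 by rewrite upd_eq.
have: holds env (upd v d 0) by apply: holds_agree hv agz.
have := holds_nth u hv.
move: {v hv agz}(upd v d 0) => v len hv vd; move: fl v out les vd hv.
elim=> {s o s'} [s|i s o s1 o' s' ltn ex _ IHl] v out les vd hv.
  have := runs_eq (s := s) (v := v) (out := out) ie ledR _; rewrite vd (hv.1 u ltu) eqxx => /(_ _).
  rewrite cats0 => r; apply: goes_runs (r _) _ => //.
  by move: hR ltu; rewrite -/d; lia.
have ltiw : i < size w by apply: leq_trans ltn len.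
apply: (goes_trans (v1 := v)) => //.
  have := runs_eq (s := s) (v := v) (out := out) ie ledR _; rewrite vd (hv.1 u ltu) (ltn_eqF ltn); apply.
  by move: hR ltu; rewrite -/d; lia.
have hvi : holds (rcons env i) v by apply: holds_rcons => //; apply: ltnW.
have sz : size (rcons env i) = d.+1 by rewrite size_rcons.
have [||v1 r1 e1] := IH _ _ _ _ a.+2 v out ex _ _ hvi les.
- by rewrite sz addSnnS.
- by rewrite sz.
rewrite !sz -/k1 in r1 e1.
apply: (goes_trans r1) => [j ltj|]; first by rewrite e1 // leqW.
have v1d : v1 d = i by rewrite e1.
apply: goes_trans (runs_inc ii ledR _) _ _; rewrite ?v1d //.
  by move=> j; apply: upd_lt.
apply: (goes_trans (runs_jmp ij)) => //.
rewrite catA; apply: IHl.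
- exact: leq_trans (exec_size ex) les.
- exact: upd_eq.
apply: holds_agree hv _ => j ltj; rewrite upd_lt // e1 //.
exact: leqW.
Qed.

Lemma correct_while c : correct c -> correct (While c).
Proof.
move=> IH env s o s' a v out wl hR ac hv les; rewrite /= in hR ac *.
set d := size env in hR ac *.
set k1 := comp c d.+1 a.+3 in ac *.
have ledR : d <= R by move: hR; lia.
have [[iz [ib [ir ak]]] [ii [ij il]]] : (onth code a = Some (IZero d) /\
    onth code a.+1 = Some (IBit (a + size k1).+1.+4) /\
    onth code a.+2 = Some IRight /\ at_code a.+3 k1) /\
    (onth code (a + size k1).+3 = Some (IInc d) /\
     onth code (a + size k1).+4 = Some (IJmp a.+1) /\
     onth code (a + size k1).+1.+4 = Some IRight).
  have [/at_code_cons[iz /at_code_cons[ib /at_code_cons[ir ak]]]] :=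
    @at_code_cat a [:: IZero d, IBit (a + size k1).+1.+4, IRight & k1] _ ac.
  rewrite /= !addnS => /at_code_cons[ii /at_code_cons[ij /at_code_cons[il _]]].
  by do !split.
have -> : a + (size (k1 ++ [:: IInc d; IJmp a.+1; IRight])).+3 = (a + size k1).+2.+4.
  by rewrite size_cat /=; lia.
have agz : forall i, i < d -> upd v d 0 i = v i by move=> i; apply: upd_lt.
apply: (goes_trans (runs_zero iz ledR) agz).
have: upd v d 0 d = 0 by rewrite upd_eq.
have: holds env (upd v d 0) by apply: holds_agree hv agz.
move: {v hv agz}(upd v d 0) => v hv vd.
(* Here [0] is to become the iteration number [i]. Each iteration consumes at least its letter
   [true], so [i + size s <= size w] persists and bounds the counter. *)
have {}les : 0 + size s <= size w by [].
move: wl v out les vd hv.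
elim=> {s o s'} [i s|i s o s1 o' s' ex _ IHl] v out les vd hv.
  apply: (goes_trans (runs_bit ib)) => //.
  by rewrite cats0; apply: goes_runs (runs_right il) _.
rewrite /= in les.
have ltiw : i < size w by move: les; lia.
apply: (goes_trans (runs_bit ib)) => //.
apply: (goes_trans (runs_right ir)) => //.
have hvi : holds (rcons env i) v by apply: holds_rcons => //; apply: ltnW.
have sz : size (rcons env i) = d.+1 by rewrite size_rcons.
have les' : size s <= size w by move: les; lia.
have [||v1 r1 e1] := IH _ _ _ _ a.+3 v out ex _ _ hvi les'.
- by rewrite sz addSnnS.
- by rewrite sz.
rewrite !sz -/k1 in r1 e1.
apply: (goes_trans r1) => [j ltj|]; first by rewrite e1 // leqW.
have v1d : v1 d = i by rewrite e1.
apply: goes_trans (runs_inc ii ledR _) _ _; rewrite ?v1d //.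
  by move=> j; apply: upd_lt.
apply: (goes_trans (runs_jmp ij)) => //.
rewrite catA; apply: IHl.
- by have := exec_size ex; move: les; lia.
- exact: upd_eq.
apply: holds_agree hv _ => j ltj; rewrite upd_lt // e1 //.
exact: leqW.
Qed.

Lemma correct_read c : correct c -> correct (ReadNat c).
Proof.
move=> IH env s o s' a v out [n [s1 [sE ex]]] hR ac hv les; rewrite /= in hR ac *.
set d := size env in hR ac *.
set k1 := comp c d.+1 a.+2.+4 in ac *.
have ledR : d <= R by move: hR; lia.
have [iz /at_code_cons[ib /at_code_cons[ir /at_code_cons[ii /at_code_cons[ij /at_code_cons[il ak]]]]]] :=
  at_code_cons ac.
have -> : a + (size k1).+2.+4 = a.+2.+4 + size k1 by lia.
have agz : forall i, i < d -> upd v d 0 i = v i by move=> i; apply: upd_lt.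
apply: (goes_trans (runs_zero iz ledR) agz).
have: upd v d 0 d = 0 by rewrite upd_eq.
have: holds env (upd v d 0) by apply: holds_agree hv agz.
move: {v hv agz}(upd v d 0) => v hv.
move: les; rewrite {s}sE size_cat size_cat size_nseq /= => les vd.
have lew : 0 + n <= size w by move: les; lia.
have les1 : size s1 <= size w by move: les; lia.
rewrite /enc_nat -catA.
(* Here [0] is to become the number of ones already counted, and [n] the number of those still to be
   read. *)
have {ex} : exec c (rcons env (0 + n)) s1 o s' by [].
move: {les}0 vd lew => i; elim: n i v hv => [|n IHn] i v hv vd lew ex.
  rewrite addn0 in lew ex; apply: (goes_trans (runs_bit ib)) => //.
  apply: (goes_trans (runs_right il)) => //.
  have hvi : holds (rcons env i) v by apply: holds_rcons.
  have sz : size (rcons env i) = d.+1 by rewrite size_rcons.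
  have [||v1 r1 e1] := IH _ _ _ _ a.+2.+4 v out ex _ _ hvi les1.
  - by rewrite sz addSnnS.
  - by rewrite sz.
  rewrite !sz -/k1 in r1 e1.
  by apply: goes_runs r1 _ => j ltj; rewrite e1 // leqW.
apply: (goes_trans (runs_bit ib)) => //.
apply: (goes_trans (runs_right ir)) => //.
have agi : forall j, j < d -> upd v d (v d).+1 j = v j by move=> j; apply: upd_lt.
have ltiw : v d < size w by rewrite vd; move: lew; lia.
apply: (goes_trans (runs_inc ii ledR ltiw) agi).
apply: (goes_trans (runs_jmp ij)) => //.
apply: (IHn i.+1); rewrite ?addSnnS //.
  exact: holds_agree hv agi.
by rewrite upd_eq vd.
Qed.

Lemma comp_correct c : correct c.
Proof.
elim: c => [|b|c1 IH1 c2 IH2|u c IH|c IH|c IH|c1 IH1 c2 IH2|u1 u2 c1 IH1 c2 IH2].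
- move=> env s o s' a v out [-> ->] _ _ _ _ /=; rewrite addn0 cats0.
  exists v => //; exact: runs_refl.
- move=> env s o s' a v out [-> ->] _ /at_code_cons[io _] _ _ /=.
  by rewrite addn1 cats1; apply: goes_runs (runs_out io) _.
- move=> env s o s' a v out [o1 [s1 [o2 [ex1 ex2 ->]]]] /=.
  rewrite addn_maxr geq_max => /andP[hR1 hR2] /at_code_cat[ac1 ac2] hv les.
  have [v1 r1 e1] := IH1 _ _ _ _ _ _ out ex1 hR1 ac1 hv les.
  apply: (goes_trans r1 e1); rewrite catA size_cat addnA.
  apply: IH2 => //; first exact: holds_agree hv e1.
  exact: leq_trans (exec_size ex1) les.
- exact: correct_for.
- exact: correct_while.
- exact: correct_read.
- move=> env s o s' a v out [b [s1 [-> ex]]] /=.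
  rewrite addn_maxr geq_max => /andP[hR1 hR2].
  set d := size env; set k1 := comp c1 _ _; set k2 := comp c2 _ _ => ac hv les.
  have [/at_code_cons[ib /at_code_cons[ir ac1]]] :=
    @at_code_cat a [:: IBit (a + size k1).+3, IRight & k1] _ ac.
  rewrite /= !addnS => /at_code_cons[ij /at_code_cons[il ac2]].
  have -> : (a + size (k1 ++ [:: IJmp (a + size k1 + size k2).+4, IRight & k2])).+2 =
      (a + size k1 + size k2).+4 by rewrite size_cat /=; lia.
  apply: (goes_trans (runs_bit ib)) => //.
  have les1 : size s1 <= size w by apply: ltnW.
  case: b ex {les} => ex.
    apply: (goes_trans (runs_right ir)) => //.
    have [v1 r1 e1] := IH1 _ _ _ _ a.+2 v out ex hR1 ac1 hv les1.
    apply: (goes_trans r1 e1); apply: goes_runs => //; exact: runs_jmp.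
  apply: (goes_trans (runs_right il)) => //.
  exact: (IH2 _ _ _ _ _ v out ex hR2 ac2 hv les1).
- move=> env s o s' a v out [lt1 lt2 ex] /=.
  rewrite addn_maxr geq_max => /andP[hR1 hR2].
  set d := size env; set k2 := comp c2 _ _; set k1 := comp c1 _ _ => ac hv les.
  have [ie ac'] := at_code_cons ac.
  have [ac2] := at_code_cat ac'.
  rewrite /= addSn => /at_code_cons[ij ac1].
  have -> : a + (size (k2 ++ IJmp (a + size k2 + size k1).+2 :: k1)).+1 =
      (a + size k2 + size k1).+2 by rewrite size_cat /=; lia.
  have le1 : u1 <= R by move: lt1 hR1; lia.
  have le2 : u2 <= R by move: lt2 hR1; lia.
  apply: (goes_trans (runs_eq ie le1 le2)) => //.
  rewrite !hv.1 //; case: eqP ex => _ ex.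
    exact: (IH1 _ _ _ _ _ v out ex hR1 ac1 hv les).
  have [v1 r1 e1] := IH2 _ _ _ _ a.+1 v out ex hR2 ac2 hv les.
  apply: (goes_trans r1 e1); apply: goes_runs => //; exact: runs_jmp.
Qed.

End Machine.

(** The machine is deterministic, so a single halting computation that fits accounts for all times:
    those before [t] are covered by hypothesis, and [trun] yields [None] after the halt. *)
Lemma steps_toutputs code R w (c c' : tconf (mach code R)) t :
  trun (mach code R) w t = Some c -> steps w c c' -> tstep w c' = None ->
  (forall t' c1, t' < t -> trun (mach code R) w t' = Some c1 -> fits w c1) ->
  toutputs (mach code R) w (c_out c') /\
  tspace (mach code R) w (3 * (trunc_log 2 (size w)).+1).
Proof.
move=> + st; elim: st t => {c c'} [c fc|c c1 c2 fc st _ IH] t rt halt low.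
  split; first by exists t, c.
  move=> t' c1 rt'; have [lt|le] := ltnP t' t; first exact: low lt rt'.
  move: rt'; rewrite -(subnK le) /trun iterD -/(trun _ w t) rt.
  case: (t' - t) => [[<-] //|n]; rewrite iterSr /= halt => stuck.
  suff none : iter n (obind (@tstep (mach code R) w)) None = None by rewrite none in stuck.
  by elim: n {stuck} => //= n ->.
apply: (IH t.+1) => //; first by rewrite /trun /= -/(trun _ w t) rt.
move=> t' c3; rewrite ltnS leq_eqVlt => /orP[/eqP ->|]; last exact: low.
by rewrite rt => -[<-].
Qed.

(** Two passes over the input are needed because the code of a system announces its number of states
    before its rules, and for the system produced this number depends on how many rules the input
    has. *)
Lemma logspace_two_passes (A B : Type) (encA : A -> seq bool)
    (encB : B -> seq bool) (f : A -> B) (c1 c2 : cmd) :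
  (forall x, exists o1 s1 o2 s2, [/\ exec c1 [::] (encA x) o1 s1,
     exec c2 [::] (encA x) o2 s2 & encB (f x) = o1 ++ o2]) ->
  logspace_computable encA encB f.
Proof.
move=> correct12.
pose k1 := comp c1 0 0; pose k2 := comp c2 0 (size k1).+1.
pose code := k1 ++ IRewind :: k2.
pose R := maxn (height c1) (height c2).
exists (mach code R), 3 => x; set w := encA x.
have [o1 [s1 [o2 [s2 [ex1 ex2 ->]]]]] := correct12 x.
have [ac1 /at_code_cons[ir ac2]] : at_code code 0 k1 /\ at_code code (0 + size k1) (IRewind :: k2).
  exact: at_code_cat.
pose v0 : nat -> nat := fun=> 0.
have hv0 v : holds w [::] v by [].
have [v1 r1 _] : goes code R w 0 0 w v0 [::] (0 + size k1) s1 ([::] ++ o1).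
  by apply: (@comp_correct code R w c1 [::]) => //; rewrite leqW // leq_maxl.
have r2 := runs_rewind (w := w) (s := s1) (v := v1) (out := o1) ir.
have [v2 r3 _] : goes code R w 0 (size k1).+1 w v1 o1 ((size k1).+1 + size k2) s2 (o1 ++ o2).
  by apply: (@comp_correct code R w c2 [::]) => //; rewrite leqW // leq_maxr.
have rest0 : at_rest w 0 w v0 [::] (@mconf code R 0 None 1 0 (tape R v0 0) [::]).
  by exists 0, 0; split=> //; rewrite drop0.
have [c' st [pos [U [c'E _ _ _]]]] := runs_trans (runs_trans r1 (r2 R)) r3 rest0.
have -> : o1 ++ o2 = c_out c' by rewrite c'E.
apply: (@steps_toutputs _ _ _ (tinit (mach code R)) _ 0) => //; last first.
  rewrite c'E /tstep /= (_ : _ + _ = size code); last by rewrite size_cat /=; lia.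
  by rewrite inordK // onth_default.
apply: StepsNext st => //.
rewrite /tstep /=; congr (Some (TConf _ _ _ _ _)).
- exact: (@pos_min w 0).
- by apply: functional_extensionality => i; rewrite ffunE.
- apply: functional_extensionality => i; apply: functional_extensionality => p.
  by rewrite ffunE; case: p.
Qed.

(** * Superseding and encoding of nested words *)

Section Embeddings.

Variables (T : Type) (le : T -> T -> Prop).

Inductive emb : seq T -> seq T -> Prop :=
  | EmbNil y : emb [::] y
  | EmbSkip x b y : emb x y -> emb x (b :: y)
  | EmbCons a b x y : le a b -> emb x y -> emb (a :: x) (b :: y).

(** An intermediate between [embeds] and [emb]: positions are plain numbers, so that [g] can be
    shifted during an induction on the words. *)
Definition emb_by (g : nat -> nat) (x y : seq T) : Prop :=
  (forall i j, i < j -> j < size x -> g i < g j) /\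
  forall i a, onth x i = Some a -> exists2 b, onth y (g i) = Some b & le a b.

(** By induction on [y], whose head is matched if [g 0 = 0] and skipped otherwise. Monotonicity
    makes all the remaining positions positive, so they can be decreased by one. *)
Lemma emb_by_emb g x y : emb_by g x y -> emb x y.
Proof.
elim: y x g => [|b y IH] [|a x] g [mono val]; try by constructor.
  by have [b] := val 0 a erefl; case: (g 0).
have [b' yb' leab'] := val 0 a erefl; case g0: (g 0) yb' => [|n] yb'.
  case: yb' leab' => <- leab.
  have pos i : i < size x -> 0 < g i.+1.
    by move=> lti; have := mono 0 i.+1 isT lti; rewrite g0.
  apply: EmbCons leab _; apply: (IH x (fun i => (g i.+1).-1)); split.
    move=> i j ltij ltj; have := mono i.+1 j.+1 ltij ltj.
    have := pos i (ltn_trans ltij ltj); lia.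
  move=> i c xc; have [d yd led] := val i.+1 c xc; exists d => //.
  have lti : i < size x by rewrite ltnNge; apply/negP => /onth_default; rewrite xc.
  by move: yd (pos i lti); case: (g i.+1).
have pos i : i <= size x -> 0 < g i.
  by case: i => [_|i lti]; [rewrite g0 | apply: leq_ltn_trans (mono 0 _ _ _)].
apply: EmbSkip; apply: (IH (a :: x) (fun i => (g i).-1)); split.
  move=> i j ltij ltj; have := mono i j ltij ltj.
  have := pos i; move: ltij ltj => /=; lia.
move=> i c xc; have [d yd led] := val i c xc; exists d => //.
have lti : i < size (a :: x) by rewrite ltnNge; apply/negP => /onth_default; rewrite xc.
by move: yd (pos i lti); case: (g i).
Qed.

Lemma emb_emb_by x y : emb x y -> exists g, emb_by g x y.
Proof.
elim=> {x y} [y|x b y _ [g [mono val]]|a b x y leab _ [g [mono val]]].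
- by exists id; split=> // -[].
- exists (fun i => (g i).+1); split=> [i j ltij ltj|i a /val//].
  by rewrite ltnS mono.
exists (fun i => if i is i'.+1 then (g i').+1 else 0); split.
  by move=> [|i] [|j] // ltij ltj; rewrite ltnS mono.
by move=> [|i] c /= => [[<-]|/val//]; exists b.
Qed.

Lemma onth_tnth (x : seq T) (j : 'I_(size x)) : onth x j = Some (tnth (in_tuple x) j).
Proof.
case: x j => [[]//|a x] j; rewrite (tnth_nth a) onthE (nth_map a) //.
Qed.

Lemma embedsP x y : embeds le x y <-> emb x y.
Proof.
split=> [[f [mono val]]|/emb_emb_by[g [mono val]]].
  apply: (@emb_by_emb (fun i => if insub i is Some j then f j : nat else 0)); split.
    move=> i j ltij ltj; rewrite !insubT ?(ltn_trans ltij) // => lti.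
    by apply: mono; rewrite /= ltij.
  move=> i a xa.
  have lti : i < size x by rewrite ltnNge; apply/negP => /onth_default; rewrite xa.
  rewrite insubT; exists (tnth (in_tuple y) (f (Ordinal lti))); first exact: onth_tnth.
  suff -> : a = tnth (in_tuple x) (Ordinal lti) by [].
  by move: xa; rewrite (@onth_tnth x (Ordinal lti)) => -[].
have bd (j : 'I_(size x)) : g j < size y.
  have [b yb _] := val j _ (onth_tnth j).
  by rewrite ltnNge; apply/negP => /onth_default; rewrite yb.
exists (fun j => Ordinal (bd j)); split=> [i j ltij|j]; first exact: mono.
have [b yb lejb] := val j _ (onth_tnth j).
suff <- : b = tnth (in_tuple y) (Ordinal (bd j)) by [].
by move: yb; rewrite (@onth_tnth y (Ordinal (bd j))) => -[].
Qed.

Lemma emb_refl x : (forall a, le a a) -> emb x x.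
Proof. by move=> refl; elim: x => [|a x IH]; constructor. Qed.

Lemma emb_trans x y z : (forall a b c, le a b -> le b c -> le a c) ->
  emb x y -> emb y z -> emb x z.
Proof.
move=> tr exy eyz; elim: eyz x exy => {y z} [z|y b z _ IH|b c y z lebc _ IH] x exy.
- by inversion exy; constructor.
- by apply/EmbSkip/IH.
inversion exy as [|? ? ? exy'|a ? x' ? leab exy']; subst.
- by constructor.
- by apply/EmbSkip/IH.
- by apply: EmbCons (tr _ _ _ leab lebc) (IH _ exy').
Qed.

Lemma emb_cat x1 y1 x2 y2 : emb x1 y1 -> emb x2 y2 -> emb (x1 ++ x2) (y1 ++ y2).
Proof.
move=> e1 e2; elim: e1 => {x1 y1} [y1|x1 b y1 _ IH|a b x1 y1 leab _ IH].
- by elim: y1 => // b y1 IH; apply: EmbSkip.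
- exact: EmbSkip.
- exact: EmbCons.
Qed.

End Embeddings.

Lemma hle_refl (A : Type) n (x : hseq A n) : hle x x.
Proof. by elim: n x => //= n IH x; apply/embedsP/emb_refl. Qed.

Lemma hle_trans (A : Type) n (x y z : hseq A n) : hle x y -> hle y z -> hle x z.
Proof.
elim: n x y z => [|n IH] x y z /=; first by move=> ->.
move=> /embedsP xy /embedsP yz; apply/embedsP; apply: emb_trans xy yz.
exact: IH.
Qed.

(* One internal superseding step on the content of a channel. *)
Definition sup1 (v u : seq nat) : Prop :=
  exists p a b q, [/\ a <= b, v = p ++ [:: a, b & q] & u = p ++ b :: q].

Definition sups : seq nat -> seq nat -> Prop := clos_refl_trans _ sup1.

Lemma sups_refl v : sups v v. Proof. exact: rt_refl. Qed.

Lemma sups_trans v u t : sups v u -> sups u t -> sups v t.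
Proof. exact: rt_trans. Qed.

Lemma sups_cat p q v u : sups v u -> sups (p ++ v ++ q) (p ++ u ++ q).
Proof.
elim=> {v u} [v u [p' [a [b [q' [leab -> ->]]]]]|v|v u t _ IH1 _ IH2].
- apply: rt_step; exists (p ++ p'), a, b, (q' ++ q).
  by rewrite leab -!catA.
- exact: sups_refl.
- exact: sups_trans IH1 IH2.
Qed.

Lemma sups_catl p v u : sups v u -> sups (p ++ v) (p ++ u).
Proof. by move/(sups_cat p [::]); rewrite !cats0. Qed.

Lemma sups_catr q v u : sups v u -> sups (v ++ q) (u ++ q).
Proof. exact: (sups_cat [::] q). Qed.

(** The word [z] is erased from the right: once the neighbour of [b] has been superseded, [b] faces
    the letter before it. *)
Lemma sups_drop z b q : all (leq^~ b) z -> sups (z ++ b :: q) (b :: q).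
Proof.
elim/last_ind: z => [|z a IH] /=; first by move=> _; apply: sups_refl.
rewrite all_rcons => /andP[leab /IH]; apply: sups_trans.
by apply: rt_step; exists z, a, b, q; rewrite cat_rcons.
Qed.

Lemma sup1_all P v u : sup1 v u -> all P v -> all P u.
Proof.
by case=> p [a [b [q [_ -> ->]]]]; rewrite !all_cat /= => /and4P[-> _ -> ->].
Qed.

Lemma sups_all P v u : sups v u -> all P v -> all P u.
Proof.
by elim=> {v u} [v u /sup1_all|//|v u t _ IH1 _ IH2 /IH1/IH2]; first exact.
Qed.

(* Superseding never removes the last letter. *)
Definition complete (t : nat) (w : seq nat) : bool := last t w == t.

Lemma sups_complete t v u : sups v u -> complete t v = complete t u.
Proof.
elim=> {v u} [v u|//|v u t' _ -> _ ->] //.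
by case=> p [a [b [q [_ -> ->]]]]; rewrite /complete !last_cat.
Qed.

Lemma complete_cat t u v : complete t u -> complete t v -> complete t (u ++ v).
Proof. by rewrite /complete last_cat => /eqP ->. Qed.

Lemma complete_sep t u : complete t (u ++ [:: t]).
Proof. by rewrite /complete last_cat. Qed.

(* Letters of the encoded alphabet are written with the priorities 0 and 1. *)
Definition short (l : nat) (w : seq nat) : Prop :=
  forall r, infix r w -> all (ltn^~ 2) r -> size r <= l.

Lemma short_infix l v w : infix v w -> short l w -> short l v.
Proof. by move=> vw sw r rv; apply: sw; apply: infix_trans vw. Qed.

Lemma cat_eq_cat (T : Type) (x1 x2 y1 y2 : seq T) : x1 ++ x2 = y1 ++ y2 ->
  (exists z, x1 = y1 ++ z /\ y2 = z ++ x2) \/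
  (exists z, y1 = x1 ++ z /\ x2 = z ++ y2).
Proof.
elim: x1 y1 => [|a x1 IH] [|b y1] /=.
- by move=> <-; left; exists [::].
- by move=> ->; right; exists (b :: y1).
- by move=> <-; left; exists (a :: x1).
case=> -> /IH[[z [-> ->]]|[z [-> ->]]]; [left|right]; by exists z.
Qed.

(** A run [r] of low letters of [u] is already in [v], unless the erased letter [a] lay strictly
    inside it. In that case [a <= b] is low as well, so [v] has a run longer by one. *)
Lemma sups_short l v u : sups v u -> short l v -> short l u.
Proof.
elim=> {v u} [v u|//|v u t _ IH1 _ IH2 /IH1/IH2 //].
case=> p [a [b [q [leab -> ->]]]] sv r /infixP[x [y /cat_eq_cat E]] lt2.
case: E => [[z [pE /cat_eq_cat]]|[z [_ E]]]; last first.
  by apply: sv => //; apply/infixP; exists (p ++ a :: z), y; rewrite E -!catA.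
case=> [[z' [rE qE]]|[z' [zE yE]]]; rewrite {p}pE in sv; last first.
  apply: sv => //; apply/infixP; exists x, (z' ++ [:: a, b & q]).
  by rewrite zE -!catA.
case: z' rE qE => [|b' z'] rE /=.
  move=> _; apply: sv => //; apply/infixP; exists x, (a :: b :: q).
  by rewrite rE cats0 -!catA.
case=> bb' qE; subst b' q.
have := lt2; rewrite rE all_cat /= => /and3P[z2 b2 z'2].
have -> : size (z ++ b :: z') = (size (z ++ [:: a, b & z'])).-1.
  by rewrite !size_cat /= !addnS.
apply: leq_trans (leq_pred _) _; apply: sv.
  by apply/infixP; exists x, y; rewrite -!catA.
by rewrite all_cat z2 /= b2 (leq_ltn_trans leab).
Qed.

(* What follows the last separator is dropped. *)
Fixpoint blocks (t : nat) (w : seq nat) : seq (seq nat) :=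
  if w is a :: w' then
    if a == t then [::] :: blocks t w'
    else if blocks t w' is b :: bs then (a :: b) :: bs else [::]
  else [::].

Lemma blocks_block t u v : t \notin u -> blocks t (u ++ t :: v) = u :: blocks t v.
Proof.
elim: u => [|a u IH] /=; first by rewrite eqxx.
by rewrite inE negb_or eq_sym => /andP[/negPf -> /IH ->].
Qed.

Lemma blocks_nosep t u : t \notin u -> blocks t u = [::].
Proof.
by elim: u => //= a u IH; rewrite inE negb_or eq_sym => /andP[/negPf -> /IH ->].
Qed.

Definition segs (t : nat) (bs : seq (seq nat)) : seq nat :=
  flatten [seq b ++ [:: t] | b <- bs].

Lemma blocks_segs t bs v : all (fun b => t \notin b) bs ->
  blocks t (segs t bs ++ v) = bs ++ blocks t v.
Proof.
elim: bs => //= b bs IH /andP[tb /IH <-].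
by rewrite /segs /= -!catA blocks_block.
Qed.

Lemma segs_ex t w : exists bs r,
  [/\ w = segs t bs ++ r, all (fun b => t \notin b) bs & t \notin r].
Proof.
elim: w => [|a w [bs [r [-> tbs tr]]]]; first by exists [::], [::].
have [->|ne] := eqVneq a t; first by exists ([::] :: bs), r.
case: bs tbs => [|b bs] /= tbs.
  by exists [::], (a :: r); split; rewrite // inE negb_or eq_sym ne.
by exists ((a :: b) :: bs), r; split; rewrite //= inE negb_or eq_sym ne.
Qed.

Lemma blocks_cat t u v : complete t u -> blocks t (u ++ v) = blocks t u ++ blocks t v.
Proof.
have [bs [r [-> tbs tr]]] := segs_ex t u.
case/lastP: r tr => [|r a] tr.
  by move=> _; rewrite cats0 blocks_segs // -[segs t bs in RHS]cats0 blocks_segs ?cats0.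
rewrite /complete last_cat last_rcons => /eqP at_.
by rewrite mem_rcons at_ mem_head in tr.
Qed.

Lemma blocks_infix t w b : b \in blocks t w -> infix b w && (t \notin b).
Proof.
have [bs [r [-> tbs tr]]] := segs_ex t w.
rewrite blocks_segs // (blocks_nosep tr) cats0 => bbs; rewrite (allP tbs) // andbT.
case/splitPr: bbs => bs1 bs2; apply/infixP.
exists (segs t bs1), (t :: segs t bs2 ++ r).
by rewrite /segs map_cat flatten_cat /= -!catA.
Qed.

(** The effect of one superseding step when no letter exceeds the separator. A separator can be
    superseded only by an equal one, which deletes an empty block other than the first. A block
    changes either by a step inside it or by losing its last letter to the separator. *)
Inductive block_step : seq (seq nat) -> seq (seq nat) -> Prop :=
  | BlockSame bs : block_step bs bs
  | BlockDel bs1 b bs2 : block_step (bs1 ++ [:: b, [::] & bs2]) (bs1 ++ b :: bs2)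
  | BlockSup bs1 b b' bs2 : sup1 b b' \/ (exists a, b = rcons b' a) ->
      block_step (bs1 ++ b :: bs2) (bs1 ++ b' :: bs2).

Lemma sup1_cons c v u : sup1 v u -> sup1 (c :: v) (c :: u).
Proof. by case=> p [a [b [q [leab -> ->]]]]; exists (c :: p), a, b, q. Qed.

Lemma sup1_blocks t v u : all (leq^~ t) v -> sup1 v u ->
  block_step (blocks t v) (blocks t u).
Proof.
move=> vt [p [a [b [q [leab vE uE]]]]]; rewrite {v}vE {u}uE in vt *.
elim: p vt => [|c p IH] /= /andP[lect].
  have [at_|ne] := eqVneq a t.
    rewrite at_ in leab.
    case/andP=> lebt _; have -> : b = t by lia.
    by rewrite eqxx; apply: (BlockDel [::]).
  move=> _; have [_|neb] := eqVneq b t.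
    by apply: (BlockSup [::]); right; exists a.
  case: (blocks t q) => [|B bs]; first exact: BlockSame.
  by apply: (BlockSup [::]); left; exists [::], a, b, B.
move/IH; have [_|ne] := eqVneq c t.
  case=> [bs|bs1 B bs2|bs1 B B' bs2 BB']; first exact: BlockSame.
    exact: (BlockDel ([::] :: bs1)).
  exact: (BlockSup ([::] :: bs1)).
case=> [bs|[|B1 bs1] B bs2|[|B1 bs1] B B' bs2 BB'] /=; first exact: BlockSame.
- exact: (BlockDel [::]).
- exact: (BlockDel ((c :: B1) :: bs1)).
- apply: (BlockSup [::]); case: BB' => [/sup1_cons BB'|[x ->]]; first by left; apply: BB'.
  by right; exists x.
- exact: (BlockSup ((c :: B1) :: bs1)).
Qed.

(** * Codes of letters, elements and channel contents *)

Section Letters.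

Variable s : nat.

Definition code (a : nat) : seq nat := 0 :: [seq (t == a : nat) | t <- iota 0 s].

Definition sep (n : nat) : nat := n.+2.

(* [ecode n x] codes an element of order [n] inside a longer word. The word of
   order [n.+1] it belongs to ends each element with [sep n]; when that word is
   itself an element it is preceded by one more [sep n], so that any of its
   elements can be erased, [sep n] being superseded by the next one. *)
Fixpoint ecode (n : nat) : hseq 'I_s n -> seq nat :=
  if n is n'.+1 then
    fun xs => sep n' :: flatten [seq ecode x ++ [:: sep n'] | x <- xs]
  else fun a => code a.

Definition wcode (n : nat) (xs : hseq 'I_s n.+1) : seq nat :=
  flatten [seq ecode x ++ [:: sep n] | x <- xs].

Lemma ecodeS n (xs : hseq 'I_s n.+1) : ecode xs = sep n :: wcode xs.
Proof. by []. Qed.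

(** Damaged blocks are skipped instead of spoiling the whole word, so that damage amounts to a loss
    of elements. The block ignored is the one in front of the extra separator that [ecode] writes
    first. *)
Fixpoint edecode (n : nat) : seq nat -> option (hseq 'I_s n) :=
  if n is n'.+1 then
    fun w => if blocks (sep n') w is _ :: bs
             then Some (pmap (@edecode n') bs) else None
  else fun w => [pick a : 'I_s | w == code a].

Definition wdecode (n : nat) (w : seq nat) : hseq 'I_s n.+1 :=
  pmap (@edecode n) (blocks (sep n) w).

Lemma edecodeS n w : @edecode n.+1 w =
  if blocks (sep n) w is _ :: bs then Some (pmap (@edecode n) bs) else None.
Proof. by []. Qed.

Lemma edecode_nil n : @edecode n [::] = None.
Proof. by case: n => //=; case: pickP => // a. Qed.

Lemma code_inj (a b : 'I_s) : code a = code b -> a = b.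
Proof.
case=> E; have := congr1 (fun l => nth 0 l a) E.
rewrite !(nth_map 0) ?size_iota // nth_iota // add0n eqxx.
by case: eqP => // ab _; apply: val_inj.
Qed.

Lemma edecode_code a : @edecode 0 (code (a : 'I_s)) = Some a.
Proof.
rewrite /=; case: pickP => [b /eqP /code_inj ->//|/(_ a)].
by rewrite eqxx.
Qed.

Lemma code_lt2 a : all (ltn^~ 2) (code a).
Proof. by apply/allP => x; rewrite inE => /orP[/eqP->//|/mapP[t _ ->]]; case: eqP. Qed.

Lemma ecode_le n (x : hseq 'I_s n) : all (leq^~ n.+1) (ecode x).
Proof.
elim: n x => [|n IH] x; first exact: code_lt2.
rewrite ecodeS /= ltnSn /=; elim: x => //= y x IHx.
rewrite !all_cat /= ltnSn IHx !andbT.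
by apply: sub_all (IH y) => z; apply: leqW.
Qed.

Lemma sep_ecode n (x : hseq 'I_s n) : sep n \notin ecode x.
Proof. by apply/negP => /(allP (ecode_le x)); rewrite /sep ltnn. Qed.

Lemma wcode_le n (x : hseq 'I_s n.+1) : all (leq^~ n.+2) (wcode x).
Proof. by have /= /andP[_] := ecode_le x. Qed.

Lemma wcode_complete n (x : hseq 'I_s n.+1) : complete (sep n) (wcode x).
Proof.
elim: x => [|y x IH]; first exact: eqxx.
by rewrite /wcode /= complete_cat ?complete_sep.
Qed.

Lemma blocks_wcode n (x : hseq 'I_s n.+1) :
  blocks (sep n) (wcode x) = [seq ecode y | y <- x].
Proof.
by elim: x => //= y x IH; rewrite /wcode /= -catA blocks_block ?sep_ecode // -IH.
Qed.

Lemma ecodeK n : pcancel (@ecode n) (@edecode n).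
Proof.
elim: n => [|n IH] x; first exact: edecode_code.
rewrite edecodeS ecodeS; have := blocks_wcode x; rewrite /= eqxx => ->.
by rewrite map_pK.
Qed.

Lemma wcodeK n : cancel (@wcode n) (@wdecode n).
Proof. by move=> x; rewrite /wdecode blocks_wcode map_pK //; apply: ecodeK. Qed.

Definition option_le (n : nat) (o1 o2 : option (hseq 'I_s n)) : Prop :=
  match o1, o2 with
  | None, _ => True
  | Some x, Some y => hle x y
  | _, _ => False
  end.

(** The conclusion on [behead] serves [edecode], which ignores the first block: no step deletes that
    block, so the other blocks keep their role. *)
Lemma pmap_step n bs bs' : block_step bs bs' ->
  (forall b b', b \in bs -> (sup1 b b' \/ exists a, b = rcons b' a) ->
    option_le (@edecode n b') (@edecode n b)) ->
  emb (@hle _ n) (pmap (@edecode n) bs') (pmap (@edecode n) bs) /\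
  emb (@hle _ n) (pmap (@edecode n) (behead bs')) (pmap (@edecode n) (behead bs)).
Proof.
have refl z : emb (@hle 'I_s n) z z by apply/emb_refl/hle_refl.
case=> {bs bs'} [bs|bs1 b bs2|bs1 b b' bs2 bb'] mono.
- by split; apply: refl.
(* The deleted block is empty, and the empty word decodes to nothing at every order. *)
- case: bs1 {mono} => [|b1 bs1] /=; rewrite ?pmap_cat /= ?edecode_nil /=; split=> //; apply: refl.
have bb : option_le (@edecode n b') (@edecode n b) by apply: mono; rewrite // mem_cat mem_head orbT.
have hd : emb (@hle _ n) (pmap (@edecode n) (b' :: bs2)) (pmap (@edecode n) (b :: bs2)).
  rewrite /=; case: (@edecode n b') (@edecode n b) bb => [x|] [y|] //= bb.
  - exact: EmbCons.
  - exact: EmbSkip.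
split; first by rewrite !pmap_cat; apply: emb_cat.
case: bs1 {mono} => [|b1 bs1] /=; first exact: refl.
by rewrite !pmap_cat; apply: emb_cat.
Qed.

Lemma blocks_rcons t u a : exists bs, blocks t (rcons u a) = blocks t u ++ bs.
Proof.
have [bs [r [-> tbs tr]]] := segs_ex t u.
by rewrite -cats1 -catA !blocks_segs // (blocks_nosep tr) cats0; eexists.
Qed.

(** At order 0 the letter is lost: [v] consists of low letters, hence has length at most [s.+1], and
    [u] is shorter than any code. At higher orders the change affects the blocks, to which the
    induction hypothesis applies; removing the last letter of [v] removes at most its last block. *)
Lemma edecode_mono n v u : all (leq^~ n.+1) v -> short s.+1 v ->
  sup1 v u \/ (exists a, v = rcons u a) -> option_le (@edecode n u) (@edecode n v).
Proof.
elim: n v u => [|n IH] v u vn sv vu.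
  suff -> : @edecode 0 u = None by [].
  rewrite /=; case: pickP => // a /eqP uE.
  suff : size u < size v.
    have := sv v (infix_refl v) vn; rewrite uE /= size_map size_iota; lia.
  case: vu => [[p [x [y [q [_ -> ->]]]]]|[x ->]]; last by rewrite size_rcons.
  by rewrite !size_cat /= ltn_add2l.
have mono b b' : b \in blocks (sep n) v ->
    (sup1 b b' \/ exists a, b = rcons b' a) -> option_le (@edecode n b') (@edecode n b).
  case/blocks_infix/andP=> bv tb; apply: IH; last exact: short_infix sv.
  apply/allP => x xb; rewrite -ltnS ltn_neqAle; apply/andP; split.
    by apply: contraNneq tb => xE; rewrite /sep -xE.
  by apply: (allP vn); apply: (mem_infix bv xb).
rewrite !edecodeS; case: vu => [vu|[a vE]]; last first.
  have [bs] := blocks_rcons (sep n) u a; rewrite -vE => ->.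
  case: (blocks _ u) => [|b bs'] //=; apply/embedsP; rewrite pmap_cat.
  by rewrite -[X in emb _ X]cats0; apply: emb_cat; [apply/emb_refl/hle_refl | constructor].
have [] := pmap_step (sup1_blocks vn vu) mono.
have := sup1_blocks vn vu.
case: (blocks _ u) (blocks _ v) => [|b' bs'] [|b bs] // st _ /= e2; last exact/embedsP.
(* No step leads from an empty list of blocks to a nonempty one. *)
by inversion st as [|[]|[]].
Qed.

Lemma wdecode_mono n v u : all (leq^~ (sep n)) v -> short s.+1 v -> sups v u ->
  hle (wdecode n u) (wdecode n v).
Proof.
move=> + + vu; elim: vu => {v u} [v u vu|v|v u t vu IH1 ut IH2] vn sv.
- apply/embedsP; apply: (pmap_step (sup1_blocks vn vu) _).1 => b b'.
  case/blocks_infix/andP=> bv tb; apply: edecode_mono; last exact: short_infix sv.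
  apply/allP => x xb; rewrite -ltnS ltn_neqAle; apply/andP; split.
    by apply: contraNneq tb => xE; rewrite /sep -xE.
  by apply: (allP vn); apply: (mem_infix bv).
- exact: hle_refl.
apply: (hle_trans (IH2 _ _)) (IH1 vn sv).
  exact: sups_all vu vn.
exact: sups_short vu sv.
Qed.

End Letters.

(** * Gadgets and their invariants *)

Arguments code s a : simpl never.

(** The word [u] is empty or ends with [t > 1], so no run of low letters crosses the boundary. *)
Lemma short_cat l t u v : complete t u -> 1 < t -> short l u -> short l v ->
  short l (u ++ v).
Proof.
move=> cu gt1 su sv r /infixP[x [y /cat_eq_cat E]] lt2.
case: E => [[z [uE /cat_eq_cat E]]|[z [_ vE]]]; last first.
  by apply: sv => //; apply/infixP; exists z, y.
case: E => [[z' [rE vE]]|[z' [zE _]]]; last first.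
  by apply: su => //; apply/infixP; exists x, z'; rewrite uE zE.
case/lastP: z => [|z e] in uE rE.
  by apply: sv => //; apply/infixP; exists [::], y; rewrite rE.
move: cu lt2; rewrite uE rE /complete last_cat last_rcons => /eqP ->.
by rewrite all_cat all_rcons /= ltnNge gt1.
Qed.

Lemma short_count l w : count (ltn^~ 2) w <= l -> short l w.
Proof.
move=> le r /infixW/leq_count_subseq rw; rewrite all_count => /eqP <-.
exact: leq_trans (rw _) le.
Qed.

(** The conditions under which decoding is monotone, together with the completeness that prevents
    appended letters from merging with an unfinished last element. *)
Definition good_word (s n : nat) (w : seq nat) : Prop :=
  [/\ all (leq^~ (sep n)) w, complete (sep n) w & short s.+1 w].

Lemma good_sups s n v u : good_word s n v -> sups v u -> good_word s n u.
Proof.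
case=> vn cv sv vu; split; first exact: sups_all vu vn.
  by rewrite -(sups_complete _ vu).
exact: sups_short vu sv.
Qed.

Lemma good_suffix s n v u : good_word s n (v ++ sep n :: u) -> good_word s n u.
Proof.
case; rewrite all_cat /complete last_cat /= => /and3P[_ _ un] cu sv; split=> //.
apply: short_infix sv; apply/infixP; exists (v ++ [:: sep n]), [::].
by rewrite cats0 -catA.
Qed.

Lemma short_code s a : short s.+1 (code s a ++ [:: 2]).
Proof.
apply: short_count; rewrite count_cat (_ : count _ [:: 2] = 0) // addn0.
by apply: leq_trans (count_size _ _) _; rewrite /= size_map size_iota.
Qed.

Lemma short_sep l n : short l [:: sep n].
Proof. exact: short_count. Qed.

Lemma good_cat s n u v : good_word s n u -> good_word s n v ->
  good_word s n (u ++ v).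
Proof.
case=> un cu su [vn cv sv]; split; first by rewrite all_cat un.
  exact: complete_cat.
exact: (short_cat cu).
Qed.

Lemma good_nil s n : good_word s n [::].
Proof. by split; [ | exact: eqxx | apply: short_count]. Qed.

Lemma good_code s (a : nat) : good_word s 0 (code s a ++ [:: 2]).
Proof.
split; [ | exact: complete_sep | exact: short_code].
by rewrite all_cat; apply/andP; split=> //; apply: (sub_all _ (code_lt2 s a)) => x; apply: ltnW.
Qed.

(** This is what a push appends: the content [w] of a channel closed into one element of the next
    order. *)
Lemma good_block s n w : good_word s n w ->
  good_word s n.+1 (sep n :: w ++ [:: sep n.+1]).
Proof.
case=> wn cw sw; split.
- rewrite /= leqnSn all_cat /= leqnn !andbT.
  by apply: sub_all wn => x; apply: leqW.
- exact: (@complete_sep _ (sep n :: w)).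
- apply: (@short_cat _ (sep n) [:: sep n]) => //.
  + exact: eqxx.
  + exact: short_sep.
  by apply: (short_cat cw) => //; apply: short_sep.
Qed.

Lemma good_ecode s n (x : hseq 'I_s n) : good_word s n (ecode x ++ [:: sep n]).
Proof.
elim: n x => [|n IH] x; first exact: good_code.
rewrite ecodeS /=; apply: good_block.
elim: x => [|y x IHx]; first exact: good_nil.
by rewrite /wcode /=; apply: good_cat.
Qed.

Lemma good_wcode s n (x : hseq 'I_s n.+1) : good_word s n (wcode x).
Proof.
elim: x => [|y x IHx]; first exact: good_nil.
by rewrite /wcode /=; apply: good_cat => //; apply: good_ecode.
Qed.

Lemma sepS_neq n : (sep n.+1 == sep n) = false.
Proof. by rewrite eqn_leq ltnn. Qed.

Lemma pmap_some (A B : Type) (f : A -> option B) x y l :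
  f x = Some y -> pmap f (x :: l) = y :: pmap f l.
Proof. by move=> /= ->. Qed.

Lemma edecode_sep s n w : edecode s n.+1 (sep n :: w) = Some (wdecode s n w).
Proof. by rewrite edecodeS /= eqxx. Qed.

Lemma wdecode_block s n w u : complete (sep n.+1) u -> sep n.+1 \notin w ->
  wdecode s n.+1 (u ++ sep n :: w ++ [:: sep n.+1]) =
  rcons (wdecode s n.+1 u) (wdecode s n w).
Proof.
move=> cu nw; rewrite /wdecode blocks_cat // pmap_cat -cats1.
congr (_ ++ _); rewrite (@blocks_block _ (sep n :: w)); last first.
  by rewrite inE negb_or nw andbT sepS_neq.
by rewrite (pmap_some _ (edecode_sep _ _ _)).
Qed.

Lemma wdecode_consl s n w u : sep n.+1 \notin w ->
  wdecode s n.+1 (sep n :: w ++ sep n.+1 :: u) =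
  wdecode s n w :: wdecode s n.+1 u.
Proof.
move=> nw; rewrite /wdecode (@blocks_block _ (sep n :: w)); last first.
  by rewrite inE negb_or nw andbT sepS_neq.
by rewrite (pmap_some _ (edecode_sep _ _ _)).
Qed.

Lemma code_nosep s a : 2 \notin code s a.
Proof. by apply/negP => /(allP (code_lt2 s a)). Qed.

Lemma wdecode_letter s (a : 'I_s) w : wdecode s 0 (code s a ++ 2 :: w) = a :: wdecode s 0 w.
Proof.
rewrite /wdecode blocks_block ?code_nosep //.
by rewrite (pmap_some _ (edecode_code a)).
Qed.

(** In [Loc f t], [f] is the phase of the gadget and [t] its parameter: a position in the code of a
    letter, or the priority being transferred. *)
Inductive lab : Type := Start | End | Loc of nat & nat.

Definition lab_code (l : lab) : option (option (nat * nat)) :=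
  match l with Start => None | End => Some None | Loc f t => Some (Some (f, t)) end.

Definition lab_decode (o : option (option (nat * nat))) : lab :=
  match o with None => Start | Some None => End | Some (Some (f, t)) => Loc f t end.

Lemma lab_codeK : cancel lab_code lab_decode.
Proof. by case. Qed.

HB.instance Definition _ := Equality.copy lab (can_type lab_codeK).

Definition edge : Type := (lab * nat * bool * nat * lab)%type.

Section Gadgets.

Variables k m s : nat.

Definition chain (i : nat) (w : bool) (a : nat) : seq edge :=
  (Start, i, w, 0, Loc 0 0) ::
  [seq (Loc 0 t, i, w, (t == a : nat), Loc 0 t.+1) | t <- iota 0 s] ++
  [:: (Loc 0 s, i, w, 2, End)].

(* A marker [sep n.+1] is written at the end of [lo], which is then rotated
   until the marker is back in front. [Loc 2 0] is reached by guessing that the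
   last element has just been copied, so that neither channel is left with an
   element without its separator. *)
Definition push (n lo hi : nat) : seq edge :=
  [:: (Start, lo, true, sep n.+1, Loc 0 0);
      (Loc 0 0, hi, true, sep n, Loc 1 0); (Loc 0 0, hi, true, sep n, Loc 2 0)] ++
  flatten [seq [:: (Loc 1 0, lo, false, a, Loc 3 a); (Loc 3 a, lo, true, a, Loc 4 a);
                   (Loc 4 a, hi, true, a, Loc 1 0)] | a <- iota 0 n.+3] ++
  [:: (Loc 4 (sep n), hi, true, sep n, Loc 2 0);
      (Loc 2 0, lo, false, sep n.+1, Loc 5 0); (Loc 5 0, hi, true, sep n.+1, End)].

(* A marker is written on [lo], which is emptied by reading up to the marker,
   and the first element of [hi] is then moved to [lo]. *)
Definition pop (n lo hi : nat) : seq edge :=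
  (Start, lo, true, sep n.+1, Loc 0 0) ::
  [seq (Loc 0 0, lo, false, a, Loc 0 0) | a <- iota 0 n.+3] ++
  [:: (Loc 0 0, lo, false, sep n.+1, Loc 5 0);
      (Loc 5 0, hi, false, sep n, Loc 1 0); (Loc 5 0, hi, false, sep n, Loc 2 0)] ++
  flatten [seq [:: (Loc 1 0, hi, false, a, Loc 3 a); (Loc 3 a, lo, true, a, Loc 1 0)]
          | a <- iota 0 n.+3] ++
  [:: (Loc 3 (sep n), lo, true, sep n, Loc 2 0); (Loc 2 0, hi, false, sep n.+1, End)].

Definition gadget (op : hop k m s) : seq edge :=
  match op with
  | HWrite _ i a => chain i true a
  | HRead _ i a => chain i false a
  | HPush n _ j i => push n (n * m + j) (n.+1 * m + i)
  | HPop n _ j i => pop n (n * m + i) (n.+1 * m + j)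
  end.

Definition act (c : nat) (w : bool) (a : nat) (x x' : nat -> seq nat) : Prop :=
  if w then x' = upd x c (rcons (x c) a)
  else exists u, x c = a :: u /\ x' = upd x c u.

Definition others (cs : seq nat) (X x : nat -> seq nat) : Prop :=
  forall c, c \notin cs -> sups (X c) (x c).

(* The marked channel is [r ++ marker :: p], where [cn ++ r] is the original
   content up to losses, with [cn] already read, and [p] is the part [P] written
   back, up to losses. *)
Definition rotating (n : nat) (Xlo lo cn P : seq nat) : Prop :=
  exists r p, [/\ lo = r ++ sep n.+1 :: p, all (leq^~ (sep n)) r,
    sups (Xlo ++ [:: sep n.+1]) (cn ++ r ++ [:: sep n.+1]) & sups P p].

Definition part (n : nat) (P : seq nat) : Prop := all (leq^~ (sep n)) P.

(** [P] is the part copied so far. In phase 3 the letter [a] has only been read from [lo]; in phase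
    4 it has been written back but not yet copied to [hi]. From phase 2 on [P] is complete, since
    that phase is entered with nothing copied or just after copying [sep n]. *)
Definition push_inv (n : nat) (Xlo Xhi lo hi : seq nat) (l : lab) : Prop :=
  match l with
  | Start => False
  | Loc 0 _ => rotating n Xlo lo [::] [::] /\ sups Xhi hi
  | Loc 1 _ => exists P, [/\ part n P, rotating n Xlo lo P P &
      sups (Xhi ++ sep n :: P) hi]
  | Loc 2 _ => exists P, [/\ part n P, complete (sep n) P, rotating n Xlo lo P P &
      sups (Xhi ++ sep n :: P) hi]
  | Loc 3 a => exists P, [/\ part n (rcons P a), rotating n Xlo lo (rcons P a) P &
      sups (Xhi ++ sep n :: P) hi]
  | Loc 4 a => exists P, [/\ part n (rcons P a),
      rotating n Xlo lo (rcons P a) (rcons P a) & sups (Xhi ++ sep n :: P) hi]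
  | Loc _ _ => exists P, [/\ part n P /\ complete (sep n) P,
      sups (Xlo ++ [:: sep n.+1]) (P ++ [:: sep n.+1]), sups P lo &
      sups (Xhi ++ sep n :: P) hi]
  | End => exists P, [/\ part n P /\ complete (sep n) P,
      sups (Xlo ++ [:: sep n.+1]) (P ++ [:: sep n.+1]), sups P lo &
      sups (Xhi ++ sep n :: P ++ [:: sep n.+1]) hi]
  end.

(** In phase 0 only the position of the marker matters, as the old content of [lo] is to be erased.
    Afterwards [P] is what has been taken from [hi] and written to [lo]. *)
Definition pop_inv (n : nat) (Xhi lo hi : seq nat) (l : lab) : Prop :=
  match l with
  | Start => False
  | Loc 0 _ => (exists r, lo = r ++ [:: sep n.+1] /\ all (leq^~ (sep n)) r) /\
      sups Xhi hi
  | Loc 1 _ => exists P, [/\ part n P, sups P lo & sups Xhi (sep n :: P ++ hi)]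
  | Loc 2 _ => exists P, [/\ part n P, complete (sep n) P, sups P lo &
      sups Xhi (sep n :: P ++ hi)]
  | Loc 3 a => exists P, [/\ part n (rcons P a), sups P lo &
      sups Xhi (sep n :: rcons P a ++ hi)]
  | Loc _ _ => lo = [::] /\ sups Xhi hi
  | End => exists P, [/\ part n P, complete (sep n) P, sups P lo &
      sups Xhi (sep n :: P ++ sep n.+1 :: hi)]
  end.

Definition chain_inv (w : bool) (a : nat) (X x : seq nat) (l : lab) : Prop :=
  let part p := if w then sups (X ++ p) x else sups X (p ++ x) in
  match l with
  | Start => False
  | Loc _ t => part (take t.+1 (code s a))
  | End => part (code s a ++ [:: 2])
  end.

(* [X] is the content of the channels when the gadget is entered. *)
Definition gadget_inv (op : hop k m s) (X x : nat -> seq nat) (l : lab) : Prop :=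
  match op with
  | HWrite _ i a => chain_inv true a (X i) (x i) l /\ others [:: i : nat] X x
  | HRead _ i a => chain_inv false a (X i) (x i) l /\ others [:: i : nat] X x
  | HPush n _ j i =>
      let lo := n * m + j in let hi := n.+1 * m + i in
      push_inv n (X lo) (X hi) (x lo) (x hi) l /\ others [:: lo; hi] X x
  | HPop n _ j i =>
      let lo := n * m + i in let hi := n.+1 * m + j in
      pop_inv n (X hi) (x lo) (x hi) l /\ others [:: lo; hi] X x
  end.

Definition good (X : nat -> seq nat) : Prop := forall c, good_word s (c %/ m) (X c).

(** The marker outranks every letter behind it, so it is never superseded. The step happens inside
    [p] or inside [r], or the marker erases the last letter of [r]; the last case is why the marker
    is kept in the comparison with [Xlo]. *)
Lemma rotating_sup n Xlo lo lo' cn P : part n P -> sup1 lo lo' ->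
  rotating n Xlo lo cn P -> rotating n Xlo lo' cn P.
Proof.
move=> Pn [p0 [a [b [q [leab -> ->]]]]] [r [p [/esym/cat_eq_cat E rn Xr Pp]]].
have pn := sups_all Pp Pn.
have absurd : sep n.+1 :: p <> [:: a, b & q].
  case=> aE pE; move: pn leab; rewrite pE -aE /= => /andP[leb _].
  by rewrite leqNgt (leq_ltn_trans leb).
case: E => [[z [rE]]|[z [pE]]]; last first.
  case: z pE => [|c z] pE; first by move/absurd.
  case=> cE pE'; exists r, (z ++ b :: q); split; rewrite ?pE -?cE -?catA //.
  apply: (sups_trans Pp); apply: rt_step; exists z, a, b, q.
  by rewrite pE'.
move=> zE.
case: z zE rE => [|c [|d z]] /=; first by move/esym/absurd.
  case=> aE bE qE rE.
  exists p0, p; rewrite bE qE; split=> //.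
    by move: rn; rewrite rE all_cat => /andP[].
  apply: (sups_trans Xr); apply: rt_step; exists (cn ++ p0), a, b, [::].
  by rewrite rE -bE -aE -!catA.
case=> aE bE qE rE; exists (p0 ++ b :: z), p; split=> //; first by rewrite qE -catA.
  by move: rn; rewrite rE -bE !all_cat /= => /and4P[-> _ -> ->].
apply: (sups_trans Xr); apply: rt_step; exists (cn ++ p0), a, b, (z ++ [:: sep n.+1]).
by rewrite rE -bE -aE -!catA.
Qed.

Lemma push_inv_sup n Xlo Xhi lo hi lo' hi' l :
  (sup1 lo lo' /\ hi' = hi) \/ (sup1 hi hi' /\ lo' = lo) ->
  push_inv n Xlo Xhi lo hi l -> push_inv n Xlo Xhi lo' hi' l.
Proof.
have add u v v' : sups u v -> sup1 v v' -> sups u v'.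
  by move=> uv vv'; apply: sups_trans uv (rt_step _ _ _ _ vv').
case=> -[st ->]; case: l => [//||f t].
- case=> P [PP XP Plo Phi]; exists P; split=> //; exact: add st.
- case: f => [|[|[|[|[|f]]]]] /=.
  + by case=> rot Xh; split=> //; apply: rotating_sup rot.
  + by case=> P [Pn rot Ph]; exists P; split=> //; apply: rotating_sup rot.
  + by case=> P [Pn cP rot Ph]; exists P; split=> //; apply: rotating_sup rot.
  + case=> P [Pn rot Ph]; exists P; split=> //; apply: rotating_sup rot => //.
    by move: Pn; rewrite /part all_rcons => /andP[].
  + by case=> P [Pn rot Ph]; exists P; split=> //; apply: rotating_sup rot.
  + by case=> P [PP XP Plo Phi]; exists P; split=> //; exact: add st.
- by case=> P [PP XP Plo Phi]; exists P; split=> //; exact: add st.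
case: f => [|[|[|[|[|f]]]]] /=; first by case=> rot Xh; split=> //; apply: add st.
+ by case=> P [Pn rot Ph]; exists P; split=> //; apply: add st.
+ by case=> P [Pn cP rot Ph]; exists P; split=> //; apply: add st.
+ by case=> P [Pn rot Ph]; exists P; split=> //; apply: add st.
+ by case=> P [Pn rot Ph]; exists P; split=> //; apply: add st.
+ by case=> P [PP XP Plo Phi]; exists P; split=> //; exact: add st.
Qed.

Lemma pop_inv_sup n Xhi lo hi lo' hi' l :
  (sup1 lo lo' /\ hi' = hi) \/ (sup1 hi hi' /\ lo' = lo) ->
  pop_inv n Xhi lo hi l -> pop_inv n Xhi lo' hi' l.
Proof.
have add u v v' : sups u v -> sup1 v v' -> sups u v'.
  by move=> uv vv'; apply: sups_trans uv (rt_step _ _ _ _ vv').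
have addc p u v v' : sups u (p ++ v) -> sup1 v v' -> sups u (p ++ v').
  by move=> uv vv'; apply: sups_trans uv _; apply/sups_catl/rt_step.
case=> -[st ->]; case: l => [//||f t].
- by case=> P [Pn cP Plo Xh]; exists P; split=> //; exact: add st.
- case: f => [|[|[|[|f]]]] /=.
  + case=> -[r [loE rn]] Xh; split=> //.
    have lor : sups (r ++ [:: sep n.+1]) lo' by rewrite -loE; apply: rt_step.
    have := sups_complete (sep n.+1) lor; rewrite complete_sep => /esym.
    have lon : all (leq^~ (sep n.+1)) (r ++ [:: sep n.+1]).
      rewrite all_cat /= leqnn !andbT; apply: sub_all rn => x; exact: leqW.
    move: st; rewrite loE => -[p [a [b [q [leab E ->]]]]] _.
    (* If [q] is empty, the marker has superseded the last letter of [r]; otherwise the step took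
       place inside [r]. *)
    case/lastP: q => [|q e] in E *.
      exists p; have := E; rewrite -[p ++ _]cat_rcons !cats1.
      move=> /rcons_inj[rE <-].
      by split=> //; move: rn; rewrite rE all_rcons => /andP[].
    exists (p ++ b :: q); have := E; rewrite -!rcons_cons -rcons_cat cats1.
    move=> /rcons_inj[rE <-]; rewrite -rcons_cat cats1; split=> //.
    by move: rn; rewrite rE !all_cat /= => /and4P[-> _ -> ->].
  + by case=> P [Pn Plo Xh]; exists P; split=> //; apply: add st.
  + by case=> P [Pn cP Plo Xh]; exists P; split=> //; apply: add st.
  + by case=> P [Pn Plo Xh]; exists P; split=> //; apply: add st.
  + case=> loE _; move: st; rewrite loE => -[p [a [b [q [_ E _]]]]].
    by case: p E.
- case=> P [Pn cP Plo Xh]; exists P; split=> //.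
  have Xh' : sups Xhi ((sep n :: rcons P (sep n.+1)) ++ hi) by rewrite /= cat_rcons.
  by have := addc _ _ _ _ Xh' st; rewrite /= cat_rcons.
case: f => [|[|[|[|f]]]] /=; first by case=> loE Xh; split=> //; apply: add st.
+ by case=> P [Pn Plo Xh]; exists P; split=> //; apply: (addc (_ :: _)) st.
+ by case=> P [Pn cP Plo Xh]; exists P; split=> //; apply: (addc (_ :: _)) st.
+ by case=> P [Pn Plo Xh]; exists P; split=> //; apply: (addc (_ :: _)) st.
+ by case=> loE Xh; split=> //; apply: add st.
Qed.

Lemma chain_inv_sup w a X x x' l : sup1 x x' ->
  chain_inv w a X x l -> chain_inv w a X x' l.
Proof.
move=> st; rewrite /chain_inv; case: l => [//||_ t]; case: w => H;
  apply: (sups_trans H); try exact: rt_step; exact/sups_catl/rt_step.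
Qed.

Lemma others_upd cs X x c u : others cs X x -> sups (x c) u ->
  others cs X (upd x c u).
Proof.
move=> oth xu c' /oth; rewrite /upd; case: eqP => [->|//] Xx.
exact: sups_trans Xx xu.
Qed.

Lemma lohi_neq n i j : j < m -> n * m + j != n.+1 * m + i.
Proof. by move=> ltj; rewrite mulSn; lia. Qed.

Lemma gadget_inv_sup op X x c u l : sup1 (x c) u -> gadget_inv op X x l ->
  gadget_inv op X (upd x c u) l.
Proof.
move=> st.
have st' := rt_step _ sup1 _ _ st.
case: op => [k0 i a|k0 i a|n ltn j i|n ltn j i] /= [inv oth];
  (split; last exact: others_upd).
- by rewrite /upd; case: eqP => // ic; apply: chain_inv_sup inv; rewrite ic.
- by rewrite /upd; case: eqP => // ic; apply: chain_inv_sup inv; rewrite ic.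
- have ne := lohi_neq n i (ltn_ord j); set lo := n * m + j in inv ne *.
  set hi := n.+1 * m + i in inv ne *; rewrite /upd.
  have [loc|_] := eqVneq lo c.
    rewrite -loc eq_sym (negPf ne); apply: push_inv_sup inv.
    by left; rewrite loc.
  case: eqP => // hic; apply: push_inv_sup inv.
  by right; rewrite hic.
- have ne := lohi_neq n j (ltn_ord i); set lo := n * m + i in inv ne *.
  set hi := n.+1 * m + j in inv ne *; rewrite /upd.
  have [loc|_] := eqVneq lo c.
    rewrite -loc eq_sym (negPf ne); apply: pop_inv_sup inv.
    by left; rewrite loc.
  case: eqP => // hic; apply: pop_inv_sup inv.
  by right; rewrite hic.
Qed.

(** A gadget starts from an exact snapshot: losses suffered at a control state are put into [X]
    beforehand. *)
Definition inv_at (op : hop k m s) (X x : nat -> seq nat) (l : lab) : Prop :=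
  if l is Start then X = x else gadget_inv op X x l.

Lemma others_act cs c w a X x x' : c \in cs -> act c w a x x' ->
  others cs X x -> others cs X x'.
Proof.
move=> ccs; have H u : others cs X x -> others cs X (upd x c u).
  move=> oth c' nc'; rewrite upd_neq; first exact: oth.
  by apply: contraNneq nc' => ->.
by rewrite /act; case: w => [->|[u [_ ->]]]; apply: H.
Qed.

Lemma others_refl cs X : others cs X X.
Proof. by move=> c _; apply: sups_refl. Qed.

Definition chain_part (w : bool) (X p x : seq nat) : Prop :=
  if w then sups (X ++ p) x else sups X (p ++ x).

Lemma chain_part_act w X p x c a x' : chain_part w X p (x c) -> act c w a x x' ->
  chain_part w X (rcons p a) (x' c).
Proof.
rewrite /chain_part /act; case: w => [Xx ->|Xx [u [xE ->]]]; rewrite upd_eq.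
  by rewrite -!cats1 catA; apply: sups_catr.
by rewrite cat_rcons -xE.
Qed.

Lemma take_code a t : t < s -> take t.+2 (code s a) = rcons (take t.+1 (code s a)) (t == a).
Proof.
move=> lts; rewrite /code !take_cons; congr (_ :: _).
rewrite (take_nth 0) ?size_map ?size_iota //; congr rcons.
by rewrite (nth_map 0) ?size_iota // nth_iota.
Qed.

Lemma chain_edge i w a X x x' l c w' b l' :
  (l, c, w', b, l') \in chain i w a -> (if l is Start then X = x i else chain_inv w a X (x i) l) ->
  act c w' b x x' -> chain_inv w a X (x' i) l' /\ c = i.
Proof.
rewrite /chain inE mem_cat => /orP[/eqP[-> -> -> -> ->]|/orP[/mapP[t]|]].
- move=> -> st; split=> //.
  have /chain_part_act/(_ st) : chain_part w (x i) [::] (x i).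
    by rewrite /chain_part cats0; case: (w); apply: sups_refl.
  by rewrite /chain_inv /code /= take0.
- rewrite mem_iota => /= lts [-> -> -> -> ->] inv st; split=> //.
  by have := chain_part_act inv st; rewrite -take_code.
rewrite inE => /eqP[-> -> -> -> ->] inv st; split=> //.
have := chain_part_act inv st.
by rewrite take_oversize ?size_map /= ?size_map ?size_iota // -cats1.
Qed.

Lemma rotating_read n Xlo a u cn P : a <= sep n ->
  rotating n Xlo (a :: u) cn P -> rotating n Xlo u (rcons cn a) P.
Proof.
move=> lea [r [p [E rn Xr Pp]]]; case: r E rn Xr => [|b r] /=.
  by case=> aE _; move: lea; rewrite aE ltnn.
case=> -> -> /andP[_ rn] Xr; exists r, p; split=> //.
by rewrite cat_rcons.
Qed.

Lemma rotating_write n Xlo lo a cn P :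
  rotating n Xlo lo cn P -> rotating n Xlo (rcons lo a) cn (rcons P a).
Proof.
move=> [r [p [-> rn Xr Pp]]]; exists r, (rcons p a).
by rewrite rcons_cat; split=> //; rewrite -!cats1; apply: sups_catr.
Qed.

(** No letter of [r] is as high as the marker, so a marker in front means that [r] is empty and that
    everything has been read. *)
Lemma rotating_end n Xlo u cn P : rotating n Xlo (sep n.+1 :: u) cn P ->
  sups (Xlo ++ [:: sep n.+1]) (cn ++ [:: sep n.+1]) /\ sups P u.
Proof.
move=> [r [p [E rn Xr Pp]]]; case: r E rn Xr => [|b r] /=; first by case=> ->.
by case=> <- _; rewrite ltnn.
Qed.

Lemma sups_rcons v u a : sups v u -> sups (rcons v a) (rcons u a).
Proof. by rewrite -!cats1; apply: sups_catr. Qed.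

Lemma push_edge n lo hi X x x' l c w a l' : lo != hi ->
  (l, c, w, a, l') \in push n lo hi -> part n (X lo) ->
  (if l is Start then X = x else push_inv n (X lo) (X hi) (x lo) (x hi) l) ->
  act c w a x x' ->
  push_inv n (X lo) (X hi) (x' lo) (x' hi) l' /\ c \in [:: lo; hi].
Proof.
move=> ne; have ne' : hi != lo by rewrite eq_sym.
rewrite /push mem_cat.
case/orP; [rewrite !inE => /or3P[]/eqP|rewrite mem_cat => /orP[/flatten_mapP[b ltb]|]].
- case=> -> -> -> -> -> Xn <- ->; rewrite ?inE eqxx; split=> //.
  rewrite upd_eq upd_neq //; split; last exact: sups_refl.
  exists (X lo), [::]; rewrite -cats1; split=> //; exact: sups_refl.
- case=> -> -> -> -> -> Xn [rot Xh] ->; rewrite ?inE eqxx orbT; split=> //.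
  exists [::]; rewrite upd_eq upd_neq //; split=> //.
  by rewrite -cats1; apply: sups_catr.
- case=> -> -> -> -> -> Xn [rot Xh] ->; rewrite ?inE eqxx orbT; split=> //.
  exists [::]; rewrite upd_eq upd_neq //; split=> //; first exact: eqxx.
  by rewrite -cats1; apply: sups_catr.
- have {ltb} leb : b <= sep n by move: ltb; rewrite mem_iota.
  rewrite !inE; case/or3P=> /eqP.
  + case=> -> -> -> -> -> Xn [P [Pn rot Ph]] [u [xE ->]]; rewrite ?inE eqxx; split=> //.
    exists P; rewrite upd_eq upd_neq //; split=> //.
      by rewrite /part all_rcons leb.
    by apply: rotating_read leb _; rewrite -xE.
  + case=> -> -> -> -> -> Xn [P [Pn rot Ph]] ->; rewrite ?inE eqxx; split=> //.
    exists P; rewrite upd_eq upd_neq //; split=> //; exact: rotating_write.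
  + case=> -> -> -> -> -> Xn [P [Pn rot Ph]] ->; rewrite ?inE eqxx orbT; split=> //.
    exists (rcons P b); rewrite upd_eq upd_neq //; split=> //.
    by rewrite -rcons_cons -rcons_cat; apply: sups_rcons.
rewrite !inE; case/or3P=> /eqP.
- case=> -> -> -> -> -> Xn [P [Pn rot Ph]] ->; rewrite ?inE eqxx orbT; split=> //.
  exists (rcons P (sep n)); rewrite upd_eq upd_neq //; split=> //.
    by rewrite /complete last_rcons.
  by rewrite -rcons_cons -rcons_cat; apply: sups_rcons.
- case=> -> -> -> -> -> Xn [P [Pn cP rot Ph]] [u [xE ->]]; rewrite ?inE eqxx; split=> //.
  rewrite xE in rot; have [XP Pu] := rotating_end rot.
  by exists P; rewrite upd_eq upd_neq.
- case=> -> -> -> -> -> Xn [P [Pn XP Plo Ph]] ->; rewrite ?inE eqxx orbT; split=> //.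
  exists P; rewrite upd_eq upd_neq //; split=> //.
  by rewrite -cat_cons catA cats1; apply: sups_rcons.
Qed.

Lemma pop_edge n lo hi X x x' l c w a l' : lo != hi ->
  (l, c, w, a, l') \in pop n lo hi -> part n (X lo) ->
  (if l is Start then X = x else pop_inv n (X hi) (x lo) (x hi) l) ->
  act c w a x x' ->
  pop_inv n (X hi) (x' lo) (x' hi) l' /\ c \in [:: lo; hi].
Proof.
move=> ne; have ne' : hi != lo by rewrite eq_sym.
rewrite /pop -[_ :: _]cat1s 4!mem_cat mem_seq1.
case/orP=> [/eqP|/orP[/mapP[b ltb]|/orP[|/orP[/flatten_mapP[b ltb]|]]]].
- case=> -> -> -> -> -> Xn <- ->; rewrite ?inE eqxx; split=> //.
  rewrite upd_eq upd_neq //; split; last exact: sups_refl.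
  by exists (X lo); rewrite cats1.
- have {ltb} leb : b <= sep n by move: ltb; rewrite mem_iota.
  case=> -> -> -> -> -> Xn [[r [loE rn]] Xh] [u [xE ->]]; rewrite ?inE eqxx; split=> //.
  rewrite upd_eq upd_neq //; split=> //.
  move: loE rn; rewrite xE; case: r => [|d r] /=.
    by case=> bE _; move: leb; rewrite bE ltnn.
  by case=> _ -> /andP[_ rn]; exists r.
- rewrite !inE; case/or3P=> /eqP.
  + case=> -> -> -> -> -> Xn [[r [loE rn]] Xh] [u [xE ->]]; rewrite ?inE eqxx; split=> //.
    rewrite upd_eq upd_neq //; split=> //.
    move: loE rn; rewrite xE; case: r => [|d r] /=; first by case.
    by case=> <- _; rewrite ltnn.
  + case=> -> -> -> -> -> Xn [loE Xh] [u [xE ->]]; rewrite ?inE eqxx orbT; split=> //.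
    exists [::]; rewrite upd_eq upd_neq //; split=> //; last by rewrite -xE.
    by rewrite loE; apply: sups_refl.
  + case=> -> -> -> -> -> Xn [loE Xh] [u [xE ->]]; rewrite ?inE eqxx orbT; split=> //.
    exists [::]; rewrite upd_eq upd_neq //; split=> //; last by rewrite -xE.
      exact: eqxx.
    by rewrite loE; apply: sups_refl.
- have {ltb} leb : b <= sep n by move: ltb; rewrite mem_iota.
  rewrite !inE; case/orP=> /eqP.
  + case=> -> -> -> -> -> Xn [P [Pn Pl Xh]] [u [xE ->]]; rewrite ?inE eqxx orbT; split=> //.
    exists P; rewrite upd_eq upd_neq //; split=> //.
      by rewrite /part all_rcons leb.
    by rewrite cat_rcons -xE.
  + case=> -> -> -> -> -> Xn [P [Pn Pl Xh]] ->; rewrite ?inE eqxx; split=> //.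
    exists (rcons P b); rewrite upd_eq upd_neq //; split=> //; exact: sups_rcons.
rewrite !inE; case/orP=> /eqP.
- case=> -> -> -> -> -> Xn [P [Pn Pl Xh]] ->; rewrite ?inE eqxx; split=> //.
  exists (rcons P (sep n)); rewrite upd_eq upd_neq //; split=> //.
    by rewrite /complete last_rcons.
  exact: sups_rcons.
- case=> -> -> -> -> -> Xn [P [Pn cP Pl Xh]] [u [xE ->]]; rewrite ?inE eqxx orbT; split=> //.
  by exists P; rewrite upd_eq upd_neq //; split=> //; rewrite -xE.
Qed.

Lemma chan_div n j : j < m -> (n * m + j) %/ m = n.
Proof. by move=> ltj; rewrite divnMDl ?divn_small ?addn0 //; apply: leq_ltn_trans ltj. Qed.

Lemma good_part X n j : good X -> j < m -> part n (X (n * m + j)).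
Proof. by move=> gX ltj; have [] := gX (n * m + j); rewrite chan_div. Qed.

Lemma gadget_edge op X x x' l c w a l' : (l, c, w, a, l') \in gadget op -> good X ->
  inv_at op X x l -> act c w a x x' -> gadget_inv op X x' l'.
Proof.
case: op => [k0 i b|k0 i b|n ltn j i|n ltn j i] /= e gX inv st.
- have oth : others [:: i : nat] X x by case: (l) inv => [->|[]|f t []] //; apply: others_refl.
  have [|inv' ci] := chain_edge (X := X i) e _ st; first by case: (l) inv => [->|[]|f t []].
  by split=> //; apply: others_act st oth; rewrite ci mem_head.
- have oth : others [:: i : nat] X x by case: (l) inv => [->|[]|f t []] //; apply: others_refl.
  have [|inv' ci] := chain_edge (X := X i) e _ st; first by case: (l) inv => [->|[]|f t []].
  by split=> //; apply: others_act st oth; rewrite ci mem_head.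
- have oth : others [:: n * m + j; n.+1 * m + i] X x.
    by case: (l) inv => [->|[]|f t []] //; apply: others_refl.
  have [||inv' ci] := push_edge (X := X) (lohi_neq _ _ (ltn_ord j)) e _ _ st.
  + exact: good_part.
  + by case: (l) inv => [//|[]|f t []].
  by split=> //; apply: others_act st oth.
- have oth : others [:: n * m + i; n.+1 * m + j] X x.
    by case: (l) inv => [->|[]|f t []] //; apply: others_refl.
  have [||inv' ci] := pop_edge (X := X) (lohi_neq _ _ (ltn_ord i)) e _ _ st.
  + exact: good_part.
  + by case: (l) inv => [//|[]|f t []].
  by split=> //; apply: others_act st oth.
Qed.

End Gadgets.

(** * A completed gadget performs its operation up to losses *)

Section Decode.

Variables k m s : nat.

Notation contents := (hcontents k m s).

Definition decode_contents (X : nat -> seq nat) : contents :=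
  [ffun n : 'I_k => [ffun i : 'I_m => wdecode s n (X (n * m + i))]].

Lemma decode_contentsE X n i : decode_contents X n i = wdecode s n (X (n * m + i)).
Proof. by rewrite !ffunE. Qed.

Definition contents_le (x y : contents) : Prop := forall n i, hle (x n i) (y n i).

Lemma decode_mono X x (n : 'I_k) (i : 'I_m) : good m s X -> sups (X (n * m + i)) (x (n * m + i)) ->
  hle (decode_contents x n i) (decode_contents X n i).
Proof.
move=> gX Xx; rewrite !decode_contentsE; have := gX (n * m + i); rewrite chan_div // => -[Xn _ sX].
exact: wdecode_mono.
Qed.

Lemma chan_inj n n' i i' : i < m -> i' < m -> n * m + i = n' * m + i' -> n = n' /\ i = i'.
Proof.
move=> lti lti' E; have := congr1 (divn^~ m) E; have := congr1 (modn^~ m) E.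
by rewrite !modnMDl !modn_small // !chan_div.
Qed.

Lemma decode_upd (n : 'I_k) (i : 'I_m) X u : decode_contents (upd X (n * m + i) u) n i = wdecode s n u.
Proof. by rewrite decode_contentsE upd_eq. Qed.

Lemma decode_upd_neq (n n' : 'I_k) (i i' : 'I_m) X u : (n, i) != (n', i') ->
  decode_contents (upd X (n' * m + i') u) n i = decode_contents X n i.
Proof.
move=> ne; rewrite !decode_contentsE upd_neq //; apply: contraNneq ne => /chan_inj[] //.
by move=> /val_inj -> /val_inj ->.
Qed.

Lemma good_upd1 X (n : 'I_k) (i : 'I_m) u : good m s X -> good_word s n u ->
  good m s (upd X (n * m + i) u).
Proof.
by move=> gX gu c; rewrite /upd; case: eqP => // ->; rewrite chan_div.
Qed.

Lemma others_good cs X x : good m s X -> others cs X x ->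
  (forall c, c \in cs -> good_word s (c %/ m) (x c)) -> good m s x.
Proof.
move=> gX oth gcs c; case: (boolP (c \in cs)) => [/gcs//|nc].
exact: good_sups (gX c) (oth c nc).
Qed.

Lemma chan_neq (n n' : 'I_k) (i i' : 'I_m) : (n, i) != (n', i') ->
  n * m + i != n' * m + i'.
Proof.
by move=> ne; apply: contraNneq ne => /chan_inj[] // /val_inj -> /val_inj ->.
Qed.

(** With [sep n] in front, the marked words are single elements of the next order, so monotonicity
    of [wdecode] at order [n.+1] applies to them. It embeds a one-element list into another, and
    hence compares the two elements. *)
Lemma marked_good n X P : part n X -> good_word s n X ->
  sups (X ++ [:: sep n.+1]) (P ++ [:: sep n.+1]) -> part n P -> complete (sep n) P ->
  good_word s n P /\ hle (wdecode s n P) (wdecode s n X).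
Proof.
move=> Xn gX XP Pn cP.
have gb := good_block gX.
have XP' : sups (sep n :: X ++ [:: sep n.+1]) (sep n :: P ++ [:: sep n.+1]).
  exact: (sups_catl [:: sep n] XP).
have nosep w : part n w -> sep n.+1 \notin w.
  by move=> wn; apply/negP => /(allP wn); rewrite /= ltnn.
split; first (split=> //).
  have [_ _ sh] := good_sups gb XP'; apply: short_infix sh.
  by apply/infixP; exists [:: sep n], [:: sep n.+1].
have [bn _ bs] := gb; have := wdecode_mono bn bs XP'.
rewrite !wdecode_consl ?nosep // => /embedsP e.
by inversion e as [|? ? ? e'|]; [inversion e' | ].
Qed.

(** For a write or a push all losses can be postponed, and [y0] is the decoding of [X]. A read or a
    pop needs losses first, to bring the consumed element exactly to the front of its channel; the
    other losses follow. *)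
Lemma gadget_end (op : hop k m s) X x : good m s X -> gadget_inv op X x End ->
  good m s x /\ exists y0 y,
    [/\ contents_le y0 (decode_contents X), hop_step op y0 y & contents_le (decode_contents x) y].
Proof.
case: op => [k0 i a|k0 i a|n ltn j i|n ltn j i] gX [inv oth].
- set c := Ordinal k0; have cE : c * m + i = i by [].
  have gXi := gX i; rewrite -cE chan_div // in gXi.
  have gn : good_word s 0 (X i ++ code s a ++ [:: 2]) by apply: good_cat gXi (good_code s a).
  split.
    apply: others_good gX oth _ => c'; rewrite inE => /eqP ->.
    by rewrite -cE chan_div //; apply: good_sups gn inv.
  pose X' := upd X (c * m + i) (X i ++ code s a ++ [:: 2]).
  exists (decode_contents X), (decode_contents X'); split; first by move=> n j; apply: hle_refl.
    split; last by move=> n j; rewrite inE => ne; rewrite /X' decode_upd_neq.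
    rewrite -/c /X' decode_upd decode_contentsE /wdecode; case: gXi => _ cX _.
    by rewrite blocks_cat // pmap_cat -cats1 -/(wdecode s 0 (code s a ++ [:: 2])) wdecode_letter.
  move=> n j; apply: decode_mono; first exact: good_upd1.
  rewrite /X' /upd; case: eqP => [->|ne]; first exact: inv.
  by apply: oth; rewrite inE -cE; apply/eqP.
- set c := Ordinal k0; have cE : c * m + i = i by [].
  have gXi := gX i; rewrite -cE chan_div // in gXi.
  have inv' : sups (X i) (code s a ++ 2 :: x i).
    have : sups (X i) ((code s a ++ [:: 2]) ++ x i) := inv; by rewrite -catA.
  have gn : good_word s 0 (code s a ++ 2 :: x i).
    exact: good_sups gXi inv'.
  have gx := good_suffix gn.
  split.
    apply: others_good gX oth _ => c'; rewrite inE => /eqP ->.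
    by rewrite -[i in x i]cE -cE chan_div.
  pose X0 := upd X (c * m + i) (code s a ++ 2 :: x i).
  pose X' := upd X (c * m + i) (x i).
  exists (decode_contents X0), (decode_contents X'); split.
  + move=> n j; apply: decode_mono => //; rewrite /X0 /upd; case: eqP => [->|_] //.
    exact: sups_refl.
  + split; first by rewrite -/c /X0 /X' !decode_upd wdecode_letter.
    by move=> n j; rewrite inE => ne; rewrite /X0 /X' !decode_upd_neq.
  move=> n j; apply: decode_mono; first exact: good_upd1.
  rewrite /X' /upd; case: eqP => [->|ne]; first exact: sups_refl.
  by apply: oth; rewrite inE -cE; apply/eqP.
- case: inv => P [[Pn cP] XP Plo Phi].
  set lo := Ordinal (ltnW ltn); set hi := Ordinal ltn.
  have gXlo := gX (n * m + j); rewrite chan_div // in gXlo.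
  have gXhi := gX (n.+1 * m + i); rewrite chan_div // in gXhi.
  have [gP leP] := marked_good (good_part n gX (ltn_ord j)) gXlo XP Pn cP.
  have glo := good_sups gP Plo.
  have gnew : good_word s n.+1 (X (n.+1 * m + i) ++ sep n :: X (n * m + j) ++ [:: sep n.+1]).
    by apply: good_cat => //; apply: good_block.
  have newhi : sups (X (n.+1 * m + i) ++ sep n :: X (n * m + j) ++ [:: sep n.+1]) (x (n.+1 * m + i)).
    apply: sups_trans Phi; apply: sups_catl; exact: (sups_catl [:: sep n] XP).
  split.
    apply: others_good gX oth _ => c; rewrite !inE => /orP[]/eqP ->; rewrite chan_div //.
    exact: good_sups gnew newhi.
  (* The element appended is the whole content of [lo] on entry, not the part [P] that was really
     copied; the losses after the step make up the difference. *)
  pose X' := upd X (hi * m + i) (X (n.+1 * m + i) ++ sep n :: X (n * m + j) ++ [:: sep n.+1]).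
  exists (decode_contents X), (decode_contents X'); split; first by move=> n' j'; apply: hle_refl.
    split; last by move=> n' j'; rewrite inE => ne; rewrite /X' decode_upd_neq.
    rewrite -/lo -/hi /X' decode_upd !decode_contentsE; case: gXhi => _ cX _; rewrite wdecode_block //.
    by apply/negP => /(allP (good_part n gX (ltn_ord j))); rewrite /= ltnn.
  move=> n' j'; have [[-> ->]|ne] := eqVneq (n', j') (lo, j).
    rewrite /X' [X in hle _ X]decode_upd_neq; last first.
      by apply/eqP => -[E]; move/eqP: E; rewrite eqn_leq ltnn andbF.
    rewrite !decode_contentsE; apply: hle_trans leP.
    by case: gP => Pn' _ sP; apply: wdecode_mono Plo.
  apply: decode_mono; first exact: good_upd1.
  rewrite /X' /upd; case: eqP => [->|/eqP ne']; first exact: newhi.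
  by apply: oth; rewrite !inE negb_or ne' (chan_neq ne).
- case: inv => P [Pn cP Plo Xhi].
  set lo := Ordinal (ltnW ltn); set hi := Ordinal ltn.
  have gXhi := gX (n.+1 * m + j); rewrite chan_div // in gXhi.
  have gn := good_sups gXhi Xhi.
  have ghi : good_word s n.+1 (x (n.+1 * m + j)) by apply: (good_suffix (v := sep n :: P)).
  have gP : good_word s n P.
    split=> //; case: gn => _ _; apply: short_infix.
    by apply/infixP; exists [:: sep n], (sep n.+1 :: x (n.+1 * m + j)).
  have nP : sep n.+1 \notin P by apply/negP => /(allP Pn); rewrite /= ltnn.
  have lohi : (hi, j) != (lo, i).
    by apply/eqP => -[E]; move/eqP: E; rewrite eqn_leq ltnn.
  split.
    apply: others_good gX oth _ => c; rewrite !inE => /orP[]/eqP ->; rewrite chan_div //.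
    exact: good_sups gP Plo.
  pose X0 := upd X (hi * m + j) (sep n :: P ++ sep n.+1 :: x (n.+1 * m + j)).
  pose X' := upd (upd X (hi * m + j) (x (n.+1 * m + j))) (lo * m + i) P.
  exists (decode_contents X0), (decode_contents X'); split.
  + move=> n' j'; apply: decode_mono => //; rewrite /X0 /upd; case: eqP => [->|_] //.
    exact: sups_refl.
  + split.
      by rewrite -/lo -/hi /X0 /X' decode_upd wdecode_consl // decode_upd decode_upd_neq // decode_upd.
    move=> n' j'; rewrite !inE negb_or => /andP[ne1 ne2].
    by rewrite /X0 /X' !decode_upd_neq.
  move=> n' j'; apply: decode_mono; first by apply: good_upd1 => //; apply: good_upd1.
  rewrite /X' /upd; case: eqP => [->|/eqP ne1]; first exact: Plo.
  case: eqP => [->|/eqP ne2]; first exact: sups_refl.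
  by apply: oth; rewrite !inE negb_or ne1 ne2.
Qed.

End Decode.

(** * The priority channel system *)

Definition rawrule : Type := (nat * nat * bool * nat * nat)%type.

Section Reduction.

Variables (k : nat) (S : holcs k).

Notation m := (h_chans S).
Notation s := (h_letters S).
Notation q := (h_states S).
Notation hrule := ('I_q * hop k m s * 'I_q)%type.

(** A bound on the parameters of [Loc], which are positions up to [s] or priorities up to [k.+1].
    The factor 6 beside it is the number of phases. *)
Definition slots : nat := s + k + 3.

Definition state_num (r p p' : nat) (l : lab) : nat :=
  match l with
  | Start => p
  | End => p'
  | Loc f t => q + r * (6 * slots) + (f + 6 * t)
  end.

Definition relabel (r : nat) (ru : hrule) (e : edge) : rawrule :=
  let: (l, c, w, a, l') := e in
  (state_num r ru.1.1 ru.2 l, c, w, a, state_num r ru.1.1 ru.2 l').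

Definition gadget_rules (r : nat) (ru : hrule) : seq rawrule :=
  [seq relabel r ru e | e <- gadget ru.1.2].

(** A leading separator ends an empty block, which decodes to nothing, so these loops at the control
    states change no decoded content. *)
Definition discards : seq rawrule :=
  flatten [seq flatten [seq [seq (p, n * m + i, false, sep n, p) | i <- iota 0 m]
                       | n <- iota 0 k] | p <- iota 0 q].

Definition raw_rules : seq rawrule :=
  discards ++
  flatten [seq gadget_rules r.1 r.2 | r <- zip (iota 0 (size (h_rules S))) (h_rules S)].

Definition nstates : nat := q + size (h_rules S) * (6 * slots).

Definition cast_rule (r : rawrule) :
    'I_nstates.+1 * 'I_(k * m).+1 * bool * 'I_k.+2 * 'I_nstates.+1 :=
  let: (p, c, w, a, p') := r in (inord p, inord c, w, inord a, inord p').

(* One more state and one more channel than needed, so that [inord] applies. *)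
Definition the_pcs : pcs k.+1 :=
  @PCS k.+1 (k * m).+1 nstates.+1 [seq cast_rule r | r <- raw_rules].

Definition to_config (p : nat) (x : nat -> seq nat) : pconfig the_pcs :=
  (inord p, [ffun c : 'I_(k * m).+1 => [seq inord a | a <- x c]]).

Definition view (D : pconfig the_pcs) (c : nat) : seq nat :=
  if c < (k * m).+1 then [seq nat_of_ord a | a <- D.2 (inord c)] else [::].

Definition lab_ok (l : lab) : bool :=
  if l is Loc f t then (f < 6) && (t < slots) else true.

Lemma zip_iotaP (T : Type) (l : seq T) r x i :
  onth (zip (iota i (size l)) l) r = Some x -> onth l r = Some x.2 /\ x.1 = i + r.
Proof.
elim: l i r => [|y l IH] i [|r] //=; first by case=> <-; rewrite addn0.
by move=> /IH[-> ->]; rewrite addSnnS.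
Qed.

Lemma onth_mem (T : eqType) (l : seq T) x : reflect (exists r, onth l r = Some x) (x \in l).
Proof.
apply: (iffP idP) => [/(nthP x)[r ltr <-]|[r]].
  by exists r; rewrite onthE (nth_map x).
elim: l r => [|y l IH] [|r] //=; first by case=> ->; rewrite mem_head.
by move=> /IH xl; rewrite inE xl orbT.
Qed.

Lemma raw_rulesP e : reflect
  ((exists p n i, [/\ p < q, n < k, i < m & e = (p, n * m + i, false, sep n, p)]) \/
   exists r ru g, [/\ onth (h_rules S) r = Some ru, g \in gadget ru.1.2 & e = relabel r ru g])
  (e \in raw_rules).
Proof.
rewrite mem_cat; apply: (iffP orP) => -[].
- case/flatten_mapP=> p + /flatten_mapP[n + /mapP[i]]; rewrite !mem_iota => /= ltp ltn lti ->.
  by left; exists p, n, i.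
- case/flatten_mapP=> -[r ru] /onth_mem[j /zip_iotaP[/= ruE ->]] /mapP[g gE ->].
  by right; exists j, ru, g.
- case=> p [n [i [ltp ltn lti ->]]]; left.
  apply/flatten_mapP; exists p; rewrite ?mem_iota //.
  apply/flatten_mapP; exists n; rewrite ?mem_iota //.
  by apply/mapP; exists i; rewrite ?mem_iota.
case=> r [ru [g [ruE gE ->]]]; right.
apply/flatten_mapP; exists (r, ru); last exact: map_f.
apply/onth_mem; exists r.
suff H i (l : seq hrule) : onth l r = Some ru ->
  onth (zip (iota i (size l)) l) r = Some (i + r, ru) by exact: H.
elim: l i r {ruE} => [|y l IH] i [|r] //=; first by case=> ->; rewrite addn0.
by move/IH ->; rewrite addSnnS.
Qed.

Lemma gadget_bounds (op : hop k m s) l c w a l' : (l, c, w, a, l') \in gadget op ->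
  [/\ lab_ok l, lab_ok l', l != End, l' != Start & (c < k * m) && (a <= k.+1)].
Proof.
have chan n (i : 'I_m) : n < k -> n * m + i < k * m.
  by move=> ltn; rewrite -ltn_divLR ?chan_div //; apply: leq_ltn_trans (ltn_ord i).
have chainP (k0 : 0 < k) (i : 'I_m) w' (b : 'I_s) : (l, c, w, a, l') \in chain s i w' b ->
  [/\ lab_ok l, lab_ok l', l != End, l' != Start & (c < k * m) && (a <= k.+1)].
  have lti : i < k * m := chan 0 i k0.
  rewrite /chain in_cons mem_cat => /orP[/eqP[-> -> _ -> ->]|/orP[/mapP[t]|]].
  - by rewrite lti /= /slots; split=> //; lia.
  - rewrite mem_iota => /= lts [-> -> _ -> ->]; rewrite lti /= /slots.
    by split=> //; try lia; case: eqP.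
  rewrite inE => /eqP[-> -> _ -> ->]; rewrite lti /= /slots.
  by split=> //; lia.
case: op => [k0 i b|k0 i b|n ltn j i|n ltn j i] /=; try exact: chainP.
- have lo := chan n j (ltnW ltn); have hi := chan n.+1 i ltn; rewrite /push mem_cat.
  case/orP; [rewrite !inE => /or3P[]/eqP|rewrite mem_cat => /orP[/flatten_mapP[b ltb]|]].
  1-3: by case=> -> -> _ -> ->; rewrite ?lo ?hi /= /slots /sep; split=> //; lia.
  - have {ltb} leb : b < n.+3 by move: ltb; rewrite mem_iota.
    rewrite !inE; case/or3P=> /eqP;
    by case=> -> -> _ -> ->; rewrite ?lo ?hi /= /slots; split=> //; lia.
  rewrite !inE; case/or3P=> /eqP;
  by case=> -> -> _ -> ->; rewrite ?lo ?hi /= /slots /sep; split=> //; lia.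
have lo := chan n i (ltnW ltn); have hi := chan n.+1 j ltn.
rewrite /pop -[_ :: _]cat1s 4!mem_cat mem_seq1.
case/orP=> [/eqP|/orP[/mapP[b ltb]|/orP[|/orP[/flatten_mapP[b ltb]|]]]].
- by case=> -> -> _ -> ->; rewrite ?lo ?hi /= /slots /sep; split=> //; lia.
- have {ltb} leb : b < n.+3 by move: ltb; rewrite mem_iota.
  by case=> -> -> _ -> ->; rewrite ?lo ?hi /= /slots /sep; split=> //; lia.
- rewrite !inE; case/or3P=> /eqP;
  by case=> -> -> _ -> ->; rewrite ?lo ?hi /= /slots /sep; split=> //; lia.
- have {ltb} leb : b < n.+3 by move: ltb; rewrite mem_iota.
  rewrite !inE; case/orP=> /eqP;
  by case=> -> -> _ -> ->; rewrite ?lo ?hi /= /slots; split=> //; lia.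
rewrite !inE; case/orP=> /eqP;
by case=> -> -> _ -> ->; rewrite ?lo ?hi /= /slots /sep; split=> //; lia.
Qed.

Lemma state_num_lt r (ru : hrule) l : onth (h_rules S) r = Some ru -> lab_ok l ->
  state_num r ru.1.1 ru.2 l < nstates.+1.
Proof.
move=> ruE; have ltr : r < size (h_rules S).
  by rewrite ltnNge; apply/negP => /onth_default; rewrite ruE.
case: l => [||f t] /=.
- by move=> _; rewrite ltnS /nstates (leq_trans (ltnW (ltn_ord _))) ?leq_addr.
- by move=> _; rewrite ltnS /nstates (leq_trans (ltnW (ltn_ord _))) ?leq_addr.
case/andP=> ltf ltt; rewrite ltnS /nstates -addnA leq_add2l.
have : r.+1 * (6 * slots) <= size (h_rules S) * (6 * slots) by rewrite leq_mul2r ltr orbT.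
by rewrite mulSn; lia.
Qed.

Lemma raw_bounds p c w a p' : (p, c, w, a, p') \in raw_rules ->
  [/\ p < nstates.+1, p' < nstates.+1, c < k * m & a < k.+2].
Proof.
case/raw_rulesP=> [[p0 [n [i [ltp ltn lti [-> -> _ -> ->]]]]]|].
  have ltp' : p0 < nstates.+1 by rewrite ltnS /nstates (leq_trans (ltnW ltp)) ?leq_addr.
  split=> //; rewrite -ltn_divLR ?chan_div //; exact: leq_ltn_trans lti.
case=> r [ru [[[[[l c0] w0] a0] l'] [ruE gE [-> -> _ -> ->]]]].
have [okl okl' _ _ /andP[ltc lea]] := gadget_bounds gE.
by split; rewrite // state_num_lt.
Qed.

Lemma view_to_config p x c : c < (k * m).+1 -> all (leq^~ k.+1) (x c) -> view (to_config p x) c = x c.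
Proof.
move=> ltc xc; rewrite /view ltc ffunE inordK // -map_comp.
by rewrite -[RHS]map_id; apply/eq_in_map => a /(allP xc) lea /=; rewrite inordK.
Qed.

Lemma view_other (D D' : pconfig the_pcs) (c : 'I_(k * m).+1) u :
  (forall j, j != c -> D'.2 j = D.2 j) -> [seq nat_of_ord a | a <- D'.2 c] = u ->
  view D' = upd (view D) c u.
Proof.
move=> oth Dc; apply: functional_extensionality => c'; rewrite /upd /view.
have [->|ne] := eqVneq c' (c : nat); first by rewrite ltn_ord inord_val.
case: ltnP => // ltc; rewrite oth //; apply: contraNneq ne => <-.
by rewrite inordK.
Qed.

Lemma view_val (D : pconfig the_pcs) (c : 'I_(k * m).+1) :
  view D c = [seq nat_of_ord a | a <- D.2 c].
Proof. by rewrite /view ltn_ord inord_val. Qed.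

Lemma pstep_view (D D' : pconfig the_pcs) : pstep D D' ->
  (D'.1 = D.1 /\ exists c u, sup1 (view D c) u /\ view D' = upd (view D) c u) \/
  exists c w a, (D.1 : nat, c, w, a, D'.1 : nat) \in raw_rules /\ act c w a (view D) (view D').
Proof.
have uncast p c w a p' : (p, c, w, a, p') \in p_rules the_pcs ->
    (p : nat, c : nat, w, a : nat, p' : nat) \in raw_rules.
  case/mapP=> -[[[[p0 c0] w0] a0] p0'] rE [-> -> -> -> ->].
  have [ltp ltp' ltc lta] := raw_bounds rE.
  by rewrite !inordK // ltnS ltnW.
case=> [[i [a [rE xE oth]]]|[i [a [rE xE oth]]]|[stE [i [u [a [b [v [leab xE yE oth]]]]]]]].
- right; exists (nat_of_ord i), false, (nat_of_ord a); split; first exact: uncast rE.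
  exists (view D' i); rewrite !view_val xE /=; split=> //.
  exact: view_other.
- right; exists (nat_of_ord i), true, (nat_of_ord a); split; first exact: uncast rE.
  by apply: view_other => //; rewrite view_val xE map_rcons.
left; split=> //; exists (nat_of_ord i), [seq nat_of_ord a | a <- D'.2 i]; split.
  rewrite view_val xE yE !map_cat /=; exists (map val u), a, b, (map val v).
  by split.
exact: view_other.
Qed.

Definition reach : hconfig S -> hconfig S -> Prop := clos_refl_trans _ (@hstep k S).

Lemma reach_le C (p : 'I_q) (x y : hcontents k m s) : reach C (p, x) -> contents_le y x ->
  reach C (p, y).
Proof.
move=> Cx yx; have [->//|ne] := classic ((p, y) = (p, x) :> hconfig S).
by apply: rt_trans Cx _; apply: rt_step; right; split=> //; split.
Qed.

(** Inside a gadget [X] stays frozen at the contents on entry, and the operation is credited only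
    when [End] is reached: an unfinished gadget never has to be undone. *)
Definition simulated (C0 : hconfig S) (D : pconfig the_pcs) : Prop :=
  exists X (p : 'I_q), [/\ reach C0 (p, decode_contents k m s X), good m s X &
    (D.1 = p :> nat /\ view D = X) \/
    exists r ru f t, [/\ onth (h_rules S) r = Some ru, ru.1.1 = p,
      D.1 = state_num r ru.1.1 ru.2 (Loc f t) :> nat, lab_ok (Loc f t) &
      gadget_inv ru.1.2 X (view D) (Loc f t)]].

Lemma state_num_inj r r' p p' p0 p0' f t f' t' : lab_ok (Loc f t) -> lab_ok (Loc f' t') ->
  state_num r p p' (Loc f t) = state_num r' p0 p0' (Loc f' t') -> [/\ r = r', f = f' & t = t'].
Proof.
move=> /andP[ltf ltt] /andP[ltf' ltt'] /= E.
have lt1 : f + 6 * t < 6 * slots by lia.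
have lt2 : f' + 6 * t' < 6 * slots by lia.
move: E; rewrite -!addnA => /addnI E.
have := congr1 (divn^~ (6 * slots)) E; have := congr1 (modn^~ (6 * slots)) E.
have pos : 0 < 6 * slots by rewrite /slots; lia.
rewrite !modnMDl !modn_small // !divnMDl // !divn_small // !addn0 => E' ->.
by split=> //; lia.
Qed.

Lemma good_upd X c u : good m s X -> good_word s (c %/ m) u -> good m s (upd X c u).
Proof. by move=> gX gu c'; rewrite /upd; case: eqP => [->|_]. Qed.

Lemma simulated_step C0 D D' : simulated C0 D -> pstep D D' -> simulated C0 D'.
Proof.
move=> [X [p [CX gX ph]]] /pstep_view[[stE [c [u [st vE]]]]|[c [w [a [rE st]]]]].
  have st' := rt_step _ sup1 _ _ st.
  (* At a control state superseding becomes a loss at once and [X] is updated; inside a gadget the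
     invariant absorbs it. *)
  case: ph => [[DE vX]|[r [ru [f [t [ruE pE DE ok inv]]]]]].
    exists (view D'), p.
    have X'E : forall c', sups (X c') (view D' c').
      move=> c'; rewrite vE vX /upd; case: eqP => [->|_]; last exact: sups_refl.
      by rewrite -vX.
    split; last by left; rewrite stE.
    - by apply: reach_le CX _ => n i; apply: decode_mono.
    - by move=> c'; apply: good_sups (gX c') _.
  exists X, p; split=> //; right; exists r, ru, f, t; rewrite stE vE.
  by split=> //; apply: gadget_inv_sup.
case/raw_rulesP: rE => [[p0 [n [i [ltp ltn lti [DE cE wE aE D'E]]]]]|].
  rewrite {c}cE {w}wE {a}aE in st.
  case: ph => [[DE' vX]|[r [ru [f [t [ruE pE DE' ok inv]]]]]]; last first.
    by move: ltp; rewrite -DE DE' /= -addnA ltnNge leq_addr.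
  have [u [xE vE]] := st.
  have chX : (n * m + i) %/ m = n by apply: chan_div.
  have gu : good_word s n u.
    by apply: (@good_suffix _ _ [::]); have := gX (n * m + i); rewrite chX -vX xE.
  exists (view D'), p; split; last by left; rewrite D'E -DE.
    have -> : decode_contents k m s (view D') = decode_contents k m s X; last by [].
    apply/ffunP => n'; apply/ffunP => i'; rewrite !decode_contentsE vE vX /upd.
    case: eqP => [E|//]; have [n'E i'E] := chan_inj (ltn_ord i') lti E.
    have -> : X (n' * m + i') = sep n :: u by rewrite E -vX.
    by rewrite n'E /wdecode /= eqxx /= edecode_nil.
  by rewrite vE vX; apply: good_upd; rewrite ?chX.
case=> r [ru [[[[[l c0] w0] a0] l'] [ruE gE /= [DE cE wE aE D'E]]]].
rewrite {c}cE {w}wE {a}aE in st.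
have [okl okl' lnE l'nS _] := gadget_bounds gE.
(* State numbers from [q] on determine the rule and the location, so the edge either enters a gadget
   from a control state or continues the current one. *)
have [pE inv] : ru.1.1 = p /\ inv_at ru.1.2 X (view D) l.
  case: ph => [[DE' vX]|[r' [ru' [f [t [ruE' pE DE' ok inv]]]]]].
    case: (l) DE lnE => [DE _|//|f t] /=; first by split=> //; apply: val_inj; apply: etrans (esym DE) DE'.
    by rewrite DE' => E; have := ltn_ord p; rewrite E -addnA ltnNge leq_addr.
  case: (l) DE lnE okl => [DE _ _|//|f' t' DE _ ok'].
    by have := ltn_ord ru.1.1; rewrite -[X in X < _]DE DE' /= -addnA ltnNge leq_addr.
  have [rr ff tt] : [/\ r' = r, f = f' & t = t'].
    exact: (state_num_inj ok ok' (etrans (esym DE') DE)).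
  move: ruE'; rewrite rr ruE => -[ruE']; rewrite -{}ruE' in pE inv.
  by split=> //; rewrite /= -ff -tt.
have inv' := gadget_edge gE gX inv st.
case: (l') D'E okl' l'nS inv' => [//|D'E _ _ inv'|f t D'E ok' _ inv']; last first.
  by exists X, p; split=> //; right; exists r, ru, f, t.
have [gx [y0 [y [y0X op_y xy]]]] := gadget_end gX inv'.
exists (view D'), ru.2; split=> //; last by left.
apply: reach_le xy; apply: rt_trans (reach_le CX y0X) _; apply: rt_step; left.
exists ru.1.2; split=> //=; apply/onth_mem; exists r.
by rewrite ruE -pE; case: (ru) => [[]].
Qed.

Definition strings (C : hconfig S) (c : nat) : seq nat :=
  if insub (c %/ m) is Some n then
    if insub (c %% m) is Some i then wcode (C.2 n i) else [::]
  else [::].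

Lemma stringsE C (n : 'I_k) (i : 'I_m) : strings C (n * m + i) = wcode (C.2 n i).
Proof.
rewrite /strings chan_div // modnMDl modn_small // !insubT //= => ltn lti.
by congr (wcode (C.2 _ _)); apply: val_inj.
Qed.

Lemma strings_good C : good m s (strings C).
Proof.
move=> c; rewrite /strings; case: insubP => [n _ <-|_]; last exact: good_nil.
case: insubP => [i _ _|_]; [exact: good_wcode | exact: good_nil].
Qed.

Lemma decode_strings C : decode_contents k m s (strings C) = C.2.
Proof. by apply/ffunP => n; apply/ffunP => i; rewrite decode_contentsE stringsE wcodeK. Qed.

Lemma strings_le C c : all (leq^~ k.+1) (strings C c).
Proof.
rewrite /strings; case: insubP => // n ltn _; case: insubP => // i _ _.
by apply: sub_all (wcode_le (C.2 n i)) => a /leq_trans; apply; rewrite ltnS.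
Qed.

Lemma strings_out C c : k * m <= c -> strings C c = [::].
Proof.
rewrite /strings; move=> le; case: insubP => // n ltck _; case: insubP => // i ltcm _.
have : k <= c %/ m by rewrite leq_divRL //; apply: leq_ltn_trans ltcm.
by rewrite leqNgt ltck.
Qed.

Lemma view_strings p C : view (to_config p (strings C)) = strings C.
Proof.
apply: functional_extensionality => c; have [lt|ge] := ltnP c (k * m).+1.
  by apply: view_to_config => //; apply: strings_le.
by rewrite strings_out 1?ltnW // /view ltnNge ge.
Qed.

Definition config_of (C : hconfig S) : pconfig the_pcs := to_config C.1 (strings C).

Lemma config_of_state C : (config_of C).1 = C.1 :> nat.
Proof.
by rewrite /= inordK // ltnS /nstates (leq_trans (ltnW (ltn_ord _))) ?leq_addr.
Qed.

Lemma simulation_back C C' :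
  clos_refl_trans _ (@pstep k.+1 the_pcs) (config_of C) (config_of C') -> reach C C'.
Proof.
move=> run; have sim0 : simulated C (config_of C).
  exists (strings C), C.1; split; [|exact: strings_good|].
    by rewrite decode_strings; case: (C) => p x; apply: rt_refl.
  by left; rewrite config_of_state /config_of view_strings.
have : simulated C (config_of C').
  elim: run sim0 => [D D' st sim|//|D D' D'' _ IH1 _ IH2 /IH1/IH2//].
  exact: simulated_step sim st.
(* The target is at a control state, hence no gadget is left unfinished. *)
case=> X [p [CX gX [[pE vX]|[r [ru [f [t [_ _ E _ _]]]]]]]]; last first.
  by have := ltn_ord C'.1; rewrite -config_of_state E /= -addnA ltnNge leq_addr.
suff <- : (p, decode_contents k m s X) = C' by [].
rewrite -vX /config_of view_strings decode_strings [RHS]surjective_pairing; congr pair.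
by apply: val_inj; rewrite /= -pE config_of_state.
Qed.

End Reduction.

(** * Simulation of the lossy channel system *)

Section Losing.

Variable s : nat.

(** A skipped element is erased by its own separator, which then supersedes the separator in front.
    When [x] is exhausted, what remains of [y] is erased by the closing [sep n.+1]. *)
Lemma ecode_lose n (x y : hseq 'I_s n) : hle x y ->
  sups (ecode y ++ [:: sep n]) (ecode x ++ [:: sep n]).
Proof.
elim: n x y => [|n IH] x y; first by move=> /= ->; apply: sups_refl.
rewrite !ecodeS => /embedsP; elim=> {x y} [y|x b y _ IHe|a b x y ab _ IHe].
- apply: (sups_catl [:: sep n]); apply: sups_drop.
  by apply: sub_all (wcode_le y) => z; apply: leqW.
- apply: sups_trans IHe; rewrite /wcode /= -!catA /=.
  apply: (@sups_trans _ ([:: sep n, sep n & wcode y ++ [:: sep n.+1]])).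
    apply: (sups_catl [:: sep n]); apply: sups_drop.
    by apply: sub_all (ecode_le b) => z; apply: leqW.
  by apply: (@sups_drop [:: sep n] (sep n) _); rewrite /= leqnn.
rewrite /wcode /= -!catA /=.
apply: (@sups_trans _ (sep n :: ecode a ++ sep n :: wcode y ++ [:: sep n.+1])).
  have := sups_cat [:: sep n] (wcode y ++ [:: sep n.+1]) (IH _ _ ab).
  by rewrite /= -!catA.
exact: (sups_catl (sep n :: ecode a) IHe).
Qed.

(** As for [ecode_lose], but without a closing separator: when [x] is exhausted, the last [sep n] of
    [wcode y] erases all that precedes it, the leading [sep n] included. *)
Lemma sep_wcode_lose n (x y : hseq 'I_s n.+1) : emb (@hle _ n) x y ->
  sups (sep n :: wcode y) (sep n :: wcode x).
Proof.
elim=> {x y} [y|x b y _ IHe|a b x y ab _ IHe].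
- have := wcode_le y; have := wcode_complete y; rewrite /complete.
  case/lastP: (wcode y) => [|w t] //=; first by move=> _ _; apply: sups_refl.
  rewrite last_rcons => /eqP -> wn; rewrite -cats1 -cat_cons; apply: sups_drop.
  by move: wn; rewrite all_rcons /= leqnn => /andP[].
- apply: sups_trans IHe; rewrite /wcode /= -!catA /=.
  apply: (@sups_trans _ ([:: sep n, sep n & wcode y])).
    apply: (sups_catl [:: sep n]); apply: sups_drop.
    by apply: sub_all (ecode_le b) => z; apply: leqW.
  by apply: (@sups_drop [:: sep n] (sep n) _); rewrite /= leqnn.
rewrite /wcode /= -!catA /=.
apply: (@sups_trans _ (sep n :: ecode a ++ sep n :: wcode y)).
  by have := sups_cat [:: sep n] (wcode y) (ecode_lose ab); rewrite /= -!catA.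
exact: (sups_catl (sep n :: ecode a) IHe).
Qed.

(* The first element can only be reduced to its separator, which is then read
   by a rule of [discards]. *)
Lemma wcode_lose n (x y : hseq 'I_s n.+1) : hle x y ->
  sups (wcode y) (wcode x) \/ sups (wcode y) (sep n :: wcode x).
Proof.
move=> /embedsP; case=> {x y} [[|b y]|x b y xy|a b x y ab xy].
- by left; apply: sups_refl.
- right; rewrite /wcode /= -catA /=.
  apply: (@sups_trans _ (sep n :: wcode y)); last by apply: (@sep_wcode_lose n [::]); constructor.
  apply: sups_drop; by apply: sub_all (ecode_le b) => z; apply: leqW.
- right; apply: sups_trans (sep_wcode_lose xy); rewrite /wcode /= -catA /=.
  apply: sups_drop; by apply: sub_all (ecode_le b) => z; apply: leqW.
left; rewrite /wcode /= -!catA /=.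
apply: (@sups_trans _ (ecode a ++ sep n :: wcode y)).
  by have := sups_catr (wcode y) (ecode_lose ab); rewrite -!catA.
exact: (sups_catl (ecode a) (sep_wcode_lose xy)).
Qed.

End Losing.

Section Forward.

Variables (k : nat) (S : holcs k).

Notation m := (h_chans S).
Notation s := (h_letters S).
Notation q := (h_states S).
Notation raw := (raw_rules S).

Definition psteps (p : nat) (x : nat -> seq nat) (p' : nat) (x' : nat -> seq nat) : Prop :=
  clos_refl_trans _ (@pstep k.+1 (the_pcs S)) (to_config S p x) (to_config S p' x').

Lemma psteps_trans p x p1 x1 p2 x2 : psteps p x p1 x1 -> psteps p1 x1 p2 x2 ->
  psteps p x p2 x2.
Proof. exact: rt_trans. Qed.

Lemma psteps_rule p c w a p' x x' : (p, c, w, a, p') \in raw -> act c w a x x' ->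
  psteps p x p' x'.
Proof.
move=> rE st; apply: rt_step; have [_ _ ltc _] := raw_bounds rE.
have rE' := map_f (@cast_rule k S) rE.
have cE : (inord c : 'I_(k * m).+1) = c :> nat by rewrite inordK // ltnS ltnW.
have oth (u : seq nat) (j : 'I_(k * m).+1) : j != inord c -> upd x c u j = x j.
  by move=> nj; rewrite upd_neq //; apply: contraNneq nj => <-; rewrite inord_val.
case: w rE st rE' => rE + rE'; [move=> x'E; apply: Or32|case=> u [xE x'E]; apply: Or31];
  exists (inord c), (inord a); (split; first exact: rE').
- by rewrite !ffunE cE x'E upd_eq map_rcons.
- by move=> j nj; rewrite !ffunE x'E oth.
- by rewrite !ffunE cE x'E upd_eq xE.
- by move=> j nj; rewrite !ffunE x'E oth.
Qed.

Lemma psteps_sups p x c u : c < k * m -> all (leq^~ k.+1) (x c) -> sups (x c) u ->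
  psteps p x p (upd x c u).
Proof.
move=> ltc + st; move E: (x c) st => v st.
elim: st x E => {v u} [v u st|v|v u t vu IH1 _ IH2] x xE vk.
- apply: rt_step; apply: Or33; split=> //.
  have cE : (inord c : 'I_(k * m).+1) = c :> nat by rewrite inordK // ltnS ltnW.
  case: st xE vk => [p0 [a [b [r [leab -> ->]]]]] xE.
  rewrite all_cat /= => /and4P[_ lea leb _].
  exists (inord c), [seq inord e | e <- p0], (inord a), (inord b), [seq inord e | e <- r].
  split; first by rewrite !inordK.
  + by rewrite ffunE cE xE map_cat.
  + by rewrite ffunE cE upd_eq map_cat.
  by move=> j nj; rewrite !ffunE upd_neq //; apply: contraNneq nj => <-; rewrite inord_val.
- by rewrite -xE upd_id; apply: rt_refl.
apply: psteps_trans (IH1 x xE vk) _.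
have -> : upd x c t = upd (upd x c u) c t.
  by apply: functional_extensionality => c'; rewrite /upd; case: eqP.
by apply: IH2; rewrite ?upd_eq //; apply: sups_all vu vk.
Qed.

Definition gstep (op : hop k m s) (a b : lab * (nat -> seq nat)) : Prop :=
  exists c w t, (a.1, c, w, t, b.1) \in gadget op /\ act c w t a.2 b.2.

Definition gpath op l x l' x' := clos_refl_trans _ (gstep op) (l, x) (l', x').

Lemma gpath_psteps r ru l x l' x' : onth (h_rules S) r = Some ru ->
  gpath ru.1.2 l x l' x' ->
  psteps (state_num S r ru.1.1 ru.2 l) x (state_num S r ru.1.1 ru.2 l') x'.
Proof.
move=> ruE; rewrite /gpath; move Ea: (l, x) => a; move Eb: (l', x') => b st.
elim: st l x l' x' Ea Eb => {a b} [a b [c [w [t [gE st]]]]|a|a b c _ IH1 _ IH2] l x l' x'.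
- move=> Ea Eb; rewrite -Ea -Eb /= in gE st; apply: psteps_rule st.
  apply/raw_rulesP; right; exists r, ru, (l, c, w, t, l'); split=> //.
- by move=> <- [-> ->]; apply: rt_refl.
case: b IH1 IH2 => l1 x1 IH1 IH2 Ea Eb.
exact: psteps_trans (IH1 _ _ _ _ Ea erefl) (IH2 _ _ _ _ erefl Eb).
Qed.

Lemma gpath_trans op l x l1 x1 l2 x2 : gpath op l x l1 x1 -> gpath op l1 x1 l2 x2 ->
  gpath op l x l2 x2.
Proof. exact: rt_trans. Qed.

Lemma gpath_step op c w a l x l' x' : (l, c, w, a, l') \in gadget op ->
  act c w a x x' -> gpath op l x l' x'.
Proof. by move=> gE st; apply: rt_step; exists c, w, a. Qed.

Lemma upd_upd (T : Type) (x : nat -> T) c u v : upd (upd x c u) c v = upd x c v.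
Proof. by apply: functional_extensionality => c'; rewrite /upd; case: eqP. Qed.

Definition chain_lab (j : nat) : lab :=
  if j is j'.+1 then if j' <= s then Loc 0 j' else End else Start.

Lemma chain_labP i w a j : j < s.+2 ->
  (chain_lab j, i, w, nth 0 (code s a ++ [:: 2]) j, chain_lab j.+1) \in chain s i w a.
Proof.
rewrite /chain in_cons mem_cat; case: j => [|j]; first by rewrite eqxx.
rewrite !ltnS leq_eqVlt => /orP[/eqP ->|ltj].
  rewrite /chain_lab leqnn ltnn nth_cat /= size_map size_iota ltnn subnn.
  by rewrite inE eqxx !orbT.
rewrite /chain_lab ltnW // ltj nth_cat /= size_map size_iota ltnS ltj.
rewrite (nth_map 0) ?size_iota // nth_iota // add0n.
by apply/orP; left; apply/mapP; exists j; rewrite ?mem_iota.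
Qed.

Lemma chain_path op i w a x x' : gadget op = chain s i w a ->
  (if w then x' = upd x i (x i ++ code s a ++ [:: 2])
   else exists u, x i = code s a ++ 2 :: u /\ x' = upd x i u) ->
  gpath op Start x End x'.
Proof.
move=> gE; set word := code s a ++ [:: 2] => x'E.
have szw : size word = s.+2 by rewrite /word size_cat /= size_map size_iota addn1.
have run j : j <= s.+2 -> forall y,
    (if w then y = upd x i (x i ++ take j word)
     else exists u, x i = take j word ++ u /\ y = upd x i u) ->
    gpath op Start x (chain_lab j) y.
  elim: j => [|j IH] lej y.
    rewrite take0; case: w {gE x'E} => [->|[u [xE ->]]].
      by rewrite cats0 upd_id; apply: rt_refl.
    by rewrite -[u]xE upd_id; apply: rt_refl.
  rewrite (take_nth 0) ?szw // => yE.
  (* For a read, the content before the last step is recovered by putting back the letter that is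
     about to be read. *)
  pose y1 := if w then upd x i (x i ++ take j word)
             else upd x i (nth 0 word j :: y i).
  apply: (gpath_trans (IH (ltnW lej) y1 _)).
    rewrite /y1; case: w {gE x'E IH y1} yE => // -[u [xE ->]].
    by exists (nth 0 word j :: u); rewrite upd_eq xE cat_rcons.
  apply: (@gpath_step _ i w (nth 0 word j)); first by rewrite gE chain_labP.
  rewrite /act /y1; case: w {gE x'E IH y1} yE => [->|[u [xE ->]]].
    by rewrite upd_eq upd_upd rcons_cat.
  by exists u; rewrite !upd_eq upd_upd.
have -> : End = chain_lab s.+2 by rewrite /= ltnn.
apply: run => //; rewrite take_oversize ?szw //.
by move: x'E; rewrite /word; case: w {gE} => // -[u [xE ->]]; exists u; rewrite -catA.
Qed.

(** Every configuration along a push or a pop has this form, so each edge changes one of the two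
    words [u] and [v]. *)
Definition set2 (lo hi : nat) (x : nat -> seq nat) (u v : seq nat) : nat -> seq nat :=
  upd (upd x lo u) hi v.

Section TwoChannels.

Variables (lo hi : nat) (x : nat -> seq nat).
Hypothesis lohi : lo != hi.

Lemma set2_id : set2 lo hi x (x lo) (x hi) = x.
Proof. by rewrite /set2 upd_id upd_id. Qed.

Lemma set2_lo u v : set2 lo hi x u v lo = u.
Proof. by rewrite /set2 upd_neq // upd_eq. Qed.

Lemma set2_hi u v : set2 lo hi x u v hi = v.
Proof. by rewrite /set2 upd_eq. Qed.

Lemma upd_set2_lo u v u' : upd (set2 lo hi x u v) lo u' = set2 lo hi x u' v.
Proof.
apply: functional_extensionality => c; rewrite /set2 /upd.
by have [->|//] := eqVneq c lo; rewrite (negPf lohi).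
Qed.

Lemma upd_set2_hi u v v' : upd (set2 lo hi x u v) hi v' = set2 lo hi x u v'.
Proof. exact: upd_upd. Qed.

Lemma write_lo a u v : act lo true a (set2 lo hi x u v) (set2 lo hi x (rcons u a) v).
Proof. by rewrite /act set2_lo upd_set2_lo. Qed.

Lemma write_hi a u v : act hi true a (set2 lo hi x u v) (set2 lo hi x u (rcons v a)).
Proof. by rewrite /act set2_hi upd_set2_hi. Qed.

Lemma read_lo a u v : act lo false a (set2 lo hi x (a :: u) v) (set2 lo hi x u v).
Proof. by exists u; rewrite set2_lo upd_set2_lo. Qed.

Lemma read_hi a u v : act hi false a (set2 lo hi x u (a :: v)) (set2 lo hi x u v).
Proof. by exists v; rewrite set2_hi upd_set2_hi. Qed.

Lemma push_path op n : gadget op = push n lo hi -> part n (x lo) ->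
  complete (sep n) (x lo) ->
  gpath op Start x End (upd x hi (x hi ++ sep n :: x lo ++ [:: sep n.+1])).
Proof.
move=> gE xn cx.
have mid b e : b < n.+3 -> e \in [:: (Loc 1 0, lo, false, b, Loc 3 b);
    (Loc 3 b, lo, true, b, Loc 4 b); (Loc 4 b, hi, true, b, Loc 1 0)] -> e \in push n lo hi.
  move=> ltb eE; rewrite /push mem_cat mem_cat; apply/or3P/Or32.
  by apply/flatten_mapP; exists b; rewrite ?mem_iota.
have copy b u v : b <= sep n ->
    gpath op (Loc 1 0) (set2 lo hi x (b :: u) v) (Loc 4 b) (set2 lo hi x (rcons u b) v).
  move=> leb; apply: (gpath_trans (l1 := Loc 3 b) (gpath_step _ (read_lo b u v)) _).
    by rewrite gE; apply: (mid b) => //; rewrite ?mem_head.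
  apply: gpath_step (write_lo b u v).
  by rewrite gE; apply: (mid b) => //; rewrite ?inE ?eqxx ?orTb ?orbT.
have rotate w u v : part n w ->
    gpath op (Loc 1 0) (set2 lo hi x (w ++ u) v) (Loc 1 0) (set2 lo hi x (u ++ w) (v ++ w)).
  elim: w u v => [|b w IH] u v; first by move=> _; rewrite !cats0; apply: rt_refl.
  case/andP=> leb wn; apply: gpath_trans (copy b _ v leb) _.
  apply: (gpath_trans (l1 := Loc 1 0) (gpath_step _ (write_hi b _ v)) _).
    by rewrite gE; apply: (mid b) => //; rewrite ?inE ?eqxx ?orTb ?orbT.
  by have := IH (rcons u b) (rcons v b) wn; rewrite -!cat_rcons rcons_cat.
have first3 e : e \in [:: (Start, lo, true, sep n.+1, Loc 0 0);
      (Loc 0 0, hi, true, sep n, Loc 1 0); (Loc 0 0, hi, true, sep n, Loc 2 0)] ->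
    e \in gadget op by rewrite gE /push mem_cat => ->.
have last3 e : e \in [:: (Loc 4 (sep n), hi, true, sep n, Loc 2 0);
      (Loc 2 0, lo, false, sep n.+1, Loc 5 0); (Loc 5 0, hi, true, sep n.+1, End)] ->
    e \in gadget op by rewrite gE /push mem_cat mem_cat => ->; rewrite !orbT.
rewrite -{1}set2_id.
apply: gpath_trans (gpath_step (first3 _ (mem_head _ _)) (write_lo _ _ _)) _.
apply: (@gpath_trans _ _ _ (Loc 2 0) (set2 lo hi x (sep n.+1 :: x lo) (x hi ++ sep n :: x lo))).
  (* An empty [lo] leads straight to phase 2. Otherwise the last letter is [sep n]: the letters
     before it are rotated in phase 1, and its copy takes the edge into phase 2. *)
  move: xn cx; rewrite /complete; case/lastP: (x lo) => [|w b].
    move=> _ _; rewrite cats1; apply: gpath_step (write_hi _ _ _).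
    by apply: first3; rewrite !inE eqxx ?orTb ?orbT.
  rewrite last_rcons /part all_rcons => /andP[_ wn] /eqP ->.
  apply: (@gpath_trans _ _ _ (Loc 1 0) _ _ _ (gpath_step _ (write_hi (sep n) _ _))).
    by apply: first3; rewrite !inE eqxx ?orTb ?orbT.
  have -> : rcons (rcons w (sep n)) (sep n.+1) = w ++ [:: sep n; sep n.+1].
    by rewrite -!cats1 -catA.
  apply: gpath_trans (rotate w [:: sep n; sep n.+1] _ wn) _.
  apply: gpath_trans (copy _ _ _ (leqnn _)) _.
  have -> : x hi ++ sep n :: rcons w (sep n) = rcons (rcons (x hi) (sep n) ++ w) (sep n).
    by rewrite rcons_cat cat_rcons.
  apply: gpath_step (write_hi _ _ _).
  by apply: last3; rewrite mem_head.
apply: (gpath_trans (l1 := Loc 5 0) (gpath_step _ (read_lo _ _ _)) _).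
  by apply: last3; rewrite !inE eqxx ?orTb ?orbT.
have -> : upd x hi (x hi ++ sep n :: x lo ++ [:: sep n.+1]) =
    set2 lo hi x (x lo) (rcons (x hi ++ sep n :: x lo) (sep n.+1)).
  by rewrite /set2 upd_id -cats1 -catA.
by apply: gpath_step (write_hi _ _ _); apply: last3; rewrite !inE eqxx ?orTb ?orbT.
Qed.

Lemma pop_path op n P u : gadget op = pop n lo hi -> part n (x lo) ->
  part n P -> complete (sep n) P -> x hi = sep n :: P ++ sep n.+1 :: u ->
  gpath op Start x End (upd (upd x hi u) lo P).
Proof.
move=> gE xn Pn cP xE.
have -> : upd (upd x hi u) lo P = set2 lo hi x P u.
  apply: functional_extensionality => c; rewrite /set2 /upd.
  by have [->|//] := eqVneq c lo; rewrite (negPf lohi).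
have e1 : (Start, lo, true, sep n.+1, Loc 0 0) \in gadget op by rewrite gE mem_head.
have e2 b : b <= sep n -> (Loc 0 0, lo, false, b, Loc 0 0) \in gadget op.
  move=> leb; rewrite gE /pop -[_ :: _]cat1s 2!mem_cat.
  apply/or3P/Or32/mapP; exists b => //; by rewrite mem_iota.
have e3 e : e \in [:: (Loc 0 0, lo, false, sep n.+1, Loc 5 0);
      (Loc 5 0, hi, false, sep n, Loc 1 0); (Loc 5 0, hi, false, sep n, Loc 2 0)] ->
    e \in gadget op.
  by move=> eE; rewrite gE /pop -[_ :: _]cat1s 3!mem_cat eE !orbT.
have e4 b e : b <= sep n -> e \in [:: (Loc 1 0, hi, false, b, Loc 3 b);
      (Loc 3 b, lo, true, b, Loc 1 0)] -> e \in gadget op.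
  move=> leb eE; rewrite gE /pop -[_ :: _]cat1s 4!mem_cat.
  rewrite (_ : _ \in flatten _) ?orbT //.
  by apply/flatten_mapP; exists b; rewrite ?mem_iota.
have e5 e : e \in [:: (Loc 3 (sep n), lo, true, sep n, Loc 2 0);
      (Loc 2 0, hi, false, sep n.+1, End)] -> e \in gadget op.
  by move=> eE; rewrite gE /pop -[_ :: _]cat1s 4!mem_cat eE !orbT.
have clear w v : part n w -> gpath op (Loc 0 0) (set2 lo hi x (w ++ [:: sep n.+1]) v)
    (Loc 0 0) (set2 lo hi x [:: sep n.+1] v).
  elim: w => [|b w IH] /=; first by move=> _; apply: rt_refl.
  case/andP=> leb /IH; apply: gpath_trans; exact: gpath_step (e2 b leb) (read_lo _ _ _).
have move1 b w v : b <= sep n -> gpath op (Loc 1 0) (set2 lo hi x w (b :: v))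
    (Loc 3 b) (set2 lo hi x w v).
  by move=> leb; apply: gpath_step (read_hi b w v); apply: (e4 b) => //; rewrite ?mem_head.
have moves P0 w v : part n P0 -> gpath op (Loc 1 0) (set2 lo hi x w (P0 ++ v))
    (Loc 1 0) (set2 lo hi x (w ++ P0) v).
  elim: P0 w => [|b P0 IH] w; first by move=> _; rewrite cats0; apply: rt_refl.
  case/andP=> leb P0n; apply: gpath_trans (move1 b w _ leb) _.
  apply: (gpath_trans (l1 := Loc 1 0) (gpath_step _ (write_lo b w _)) _).
    by apply: (e4 b) => //; rewrite ?inE ?eqxx ?orTb ?orbT.
  by have := IH (rcons w b) P0n; rewrite cat_rcons.
rewrite -{1}set2_id.
apply: gpath_trans (gpath_step e1 (write_lo _ _ _)) _.
rewrite -cats1; apply: gpath_trans (clear _ _ xn) _.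
apply: gpath_trans (gpath_step (e3 _ (mem_head _ _)) (read_lo _ _ _)) _.
rewrite xE; apply: (@gpath_trans _ _ _ (Loc 2 0) (set2 lo hi x P (sep n.+1 :: u))).
  move: Pn cP; rewrite /complete; case/lastP: (P) => [|w b].
    move=> _ _; apply: gpath_step (read_hi _ _ _).
    by apply: e3; rewrite !inE eqxx ?orTb ?orbT.
  rewrite last_rcons /part all_rcons => /andP[_ wn] /eqP ->.
  apply: (@gpath_trans _ _ _ (Loc 1 0) _ _ _ (gpath_step _ (read_hi (sep n) _ _))).
    by apply: e3; rewrite !inE eqxx ?orTb ?orbT.
  rewrite cat_rcons; apply: gpath_trans (moves w _ _ wn) _.
  apply: gpath_trans (move1 _ _ _ (leqnn _)) _.
  apply: gpath_step (write_lo (sep n) w _).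
  by apply: e5; rewrite mem_head.
by apply: gpath_step (read_hi _ _ _); apply: e5; rewrite !inE eqxx ?orTb ?orbT.
Qed.

End TwoChannels.

Lemma chan_lt (n : 'I_k) (i : 'I_m) : n * m + i < k * m.
Proof. by rewrite -ltn_divLR ?chan_div //; apply: leq_ltn_trans (ltn_ord i). Qed.

Lemma chanP c : c < k * m -> exists (n : 'I_k) (i : 'I_m), c = n * m + i.
Proof.
move=> ltc; have m_gt0 : 0 < m by move: ltc; case: (m); rewrite ?muln0.
have ltn : c %/ m < k by rewrite ltn_divLR.
have ltm : c %% m < m by rewrite ltn_mod.
by exists (Ordinal ltn), (Ordinal ltm); apply: divn_eq.
Qed.

Lemma strings_eq (C : hconfig S) f :
  (forall (n : 'I_k) (i : 'I_m), f (n * m + i) = wcode (C.2 n i)) ->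
  (forall c, k * m <= c -> f c = [::]) -> f = strings C.
Proof.
move=> fE out; apply: functional_extensionality => c.
have [/chanP[n [i ->]]|ge] := ltnP c (k * m); first by rewrite fE stringsE.
by rewrite out ?strings_out.
Qed.

Lemma wcode_rcons n (x : hseq 'I_s n.+1) y :
  @wcode s n (rcons x y) = wcode x ++ ecode y ++ [:: sep n].
Proof. by rewrite /wcode map_rcons flatten_rcons. Qed.

Lemma wcode_cons n (x : hseq 'I_s n.+1) y :
  @wcode s n (y :: x) = ecode y ++ sep n :: wcode x.
Proof. by rewrite /wcode /= -catA. Qed.

Lemma upd_out (x : nat -> seq nat) c u c' : c < k * m -> k * m <= c' ->
  upd x c u c' = x c'.
Proof. by move=> ltc le; rewrite upd_neq // gtn_eqF // (leq_trans ltc). Qed.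

Lemma strings_upd (C C' : hconfig S) (n : 'I_k) (i : 'I_m) u :
  wcode (C'.2 n i) = u -> hunchanged [:: (n, i)] C.2 C'.2 ->
  upd (strings C) (n * m + i) u = strings C'.
Proof.
move=> uE unch; apply: strings_eq => [n' i'|c le]; last first.
  by rewrite upd_out ?chan_lt ?strings_out.
have [[-> ->]|ne] := eqVneq (n', i') (n, i); first by rewrite upd_eq.
by rewrite upd_neq ?chan_neq // stringsE unch // inE.
Qed.

Lemma good_path_part n i (C : hconfig S) : i < m -> part n (strings C (n * m + i)) /\
  complete (sep n) (strings C (n * m + i)).
Proof.
by move=> lti; have := @strings_good _ S C (n * m + i); rewrite chan_div // => -[].
Qed.

Lemma reliable_forward (C C' : hconfig S) : hreliable C C' ->
  psteps C.1 (strings C) C'.1 (strings C').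
Proof.
case=> op [/onth_mem[r ruE] st].
suff path : gpath op Start (strings C) End (strings C') by apply: (gpath_psteps ruE path).
case: op ruE st => [k0 i a|k0 i a|n ltn j i|n ltn j i] _.
- case=> yE unch; apply: (@chain_path _ i true a) => //.
  apply/esym/(@strings_upd C C' (Ordinal k0) i) => //.
  by rewrite yE wcode_rcons -(stringsE C (Ordinal k0) i).
- case=> xE unch; apply: (@chain_path _ i false a) => //.
  exists (wcode (C'.2 (Ordinal k0) i)); split.
    by have := stringsE C (Ordinal k0) i; rewrite xE wcode_cons.
  by rewrite -(strings_upd (erefl _) unch).
- case=> yE unch; have [xn cx] := good_path_part n C (ltn_ord j).
  have := push_path (lohi_neq n i (ltn_ord j)) (erefl (gadget (@HPush k m s n ltn j i))) xn cx.
  have -> // : upd (strings C) (n.+1 * m + i) (strings C (n.+1 * m + i) ++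
      sep n :: strings C (n * m + j) ++ [:: sep n.+1]) = strings C'.
  have lo : strings C (n * m + j) = wcode (C.2 (Ordinal (ltnW ltn)) j) := stringsE C (Ordinal (ltnW ltn)) j.
  have hi : strings C (n.+1 * m + i) = wcode (C.2 (Ordinal ltn) i) := stringsE C (Ordinal ltn) i.
  apply: (@strings_upd C C' (Ordinal ltn) i) => //.
  by rewrite yE wcode_rcons lo hi.
case=> xE unch; have [xn cx] := good_path_part n C (ltn_ord i).
set P := wcode (C'.2 (Ordinal (ltnW ltn)) i).
set u := wcode (C'.2 (Ordinal ltn) j).
have hi : strings C (n.+1 * m + j) = sep n :: P ++ sep n.+1 :: u.
  by rewrite (stringsE C (Ordinal ltn) j) xE wcode_cons.
have [Pn cP _] := good_wcode (C'.2 (Ordinal (ltnW ltn)) i).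
have := pop_path (lohi_neq n j (ltn_ord i)) (erefl (gadget (@HPop k m s n ltn j i))) xn Pn cP hi.
have -> // : upd (upd (strings C) (n.+1 * m + j) u) (n * m + i) P = strings C'.
apply: strings_eq => [n' i'|c le]; last first.
  rewrite upd_out ?(chan_lt (Ordinal (ltnW ltn))) // upd_out ?strings_out //.
  exact: (chan_lt (Ordinal ltn)).
have [[-> ->]|ne1] := eqVneq (n', i') (Ordinal (ltnW ltn), i); first by rewrite upd_eq.
rewrite upd_neq; last exact: (chan_neq ne1).
have [[-> ->]|ne2] := eqVneq (n', i') (Ordinal ltn, j); first by rewrite upd_eq.
rewrite upd_neq; last exact: (chan_neq ne2).
by rewrite stringsE unch // !inE negb_or ne1 ne2.
Qed.

Lemma discard_forward (p : 'I_q) x (n : 'I_k) (i : 'I_m) u :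
  x (n * m + i) = sep n :: u -> psteps p x p (upd x (n * m + i) u).
Proof.
move=> xE; apply: (@psteps_rule _ (n * m + i) false (sep n)); last by exists u.
by apply/raw_rulesP; left; exists p, n, i.
Qed.

Lemma losing_forward (C C' : hconfig S) : hconfig_le C' C ->
  psteps C.1 (strings C) C'.1 (strings C').
Proof.
case=> -> le; set p := C.1.
(* Channels are treated one at a time; those below [j] have their final content. *)
pose X j c := if c < j then strings C' c else strings C c.
have step j : j <= k * m -> psteps p (strings C) p (X j).
  elim: j => [|j IH] lej.
    by rewrite (_ : X 0 = strings C); [apply: rt_refl | apply: functional_extensionality].
  apply: psteps_trans (IH (ltnW lej)) _.
  have -> : X j.+1 = upd (X j) j (strings C' j).
    apply: functional_extensionality => c; rewrite /X /upd ltnS leq_eqVlt.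
    by have [->|] := eqVneq c j.
  have Xj : X j j = strings C j by rewrite /X ltnn.
  have Xk : all (leq^~ k.+1) (X j j) by rewrite Xj; apply: strings_le.
  have [n [i jE]] := chanP lej.
  have := wcode_lose (le n i); rewrite -!stringsE -jE -Xj.
  case=> [/(psteps_sups p lej Xk)//|/(psteps_sups p lej Xk)/psteps_trans]; apply.
  have -> : upd (X j) j (strings C' j) =
      upd (upd (X j) j (sep n :: strings C' j)) j (strings C' j) by rewrite upd_upd.
  have := @discard_forward p (upd (X j) j (sep n :: strings C' j)) n i (strings C' j).
  by rewrite -jE; apply; rewrite upd_eq.
have -> : strings C' = X (k * m); last exact: step.
apply: functional_extensionality => c; rewrite /X; case: ltnP => // ge.
by rewrite !strings_out.
Qed.

Lemma simulation_forward (C C' : hconfig S) : reach C C' ->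
  clos_refl_trans _ (@pstep k.+1 (the_pcs S)) (config_of C) (config_of C').
Proof.
elim=> [D D' [/reliable_forward|[/losing_forward le _]]|D|D D' D'' _ IH1 _ IH2] //.
  exact: rt_refl.
exact: rt_trans IH1 IH2.
Qed.

End Forward.

(** * Computing the reduction *)

Lemma exec_seq c1 c2 env s o1 s1 o2 s2 : exec c1 env s o1 s1 ->
  exec c2 env s1 o2 s2 -> exec (Seq c1 c2) env s (o1 ++ o2) s2.
Proof. by move=> ex1 ex2; exists o1, s1, o2. Qed.

Lemma exec_out b env s : exec (Out b) env s [:: b] s.
Proof. by []. Qed.

Lemma exec_read c env n s o s' : exec c (rcons env n) s o s' ->
  exec (ReadNat c) env (enc_nat n ++ s) o s'.
Proof. by move=> ex; exists n, s. Qed.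

Lemma exec_for v c env (inp out : nat -> seq bool) s : v < size env ->
  (forall i s, i < nth 0 env v -> exec c (rcons env i) (inp i ++ s) (out i) s) ->
  exec (For v c) env (flatten [seq inp i | i <- iota 0 (nth 0 env v)] ++ s)
    (flatten [seq out i | i <- iota 0 (nth 0 env v)]) s.
Proof.
move=> ltv body; split=> //; set n := nth 0 env v in body *.
have H j i : i + j = n -> for_loop n (fun i => exec c (rcons env i)) i
    (flatten [seq inp i | i <- iota i j] ++ s) (flatten [seq out i | i <- iota i j]) s.
  elim: j i => [|j IH] i ij /=; first by rewrite addn0 in ij; rewrite ij; apply: ForStop.
  rewrite -catA; apply: ForNext (IH _ _); last by rewrite addSnnS.
    by rewrite -ij -addSnnS leq_addr.
  by apply: body; rewrite -ij -addSnnS leq_addr.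
exact: H.
Qed.

Lemma exec_print_for v c env (out : nat -> seq bool) s : v < size env ->
  (forall i, i < nth 0 env v -> exec c (rcons env i) s (out i) s) ->
  exec (For v c) env s (flatten [seq out i | i <- iota 0 (nth 0 env v)]) s.
Proof.
move=> ltv body; split=> //; set n := nth 0 env v in body *.
have H j i : i + j = n -> for_loop n (fun i => exec c (rcons env i)) i s
    (flatten [seq out i | i <- iota i j]) s.
  elim: j i => [|j IH] i ij /=; first by rewrite addn0 in ij; rewrite ij; apply: ForStop.
  apply: ForNext (IH _ _); last by rewrite addSnnS.
    by rewrite -ij -addSnnS leq_addr.
  by apply: body; rewrite -ij -addSnnS leq_addr.
exact: H.
Qed.

Lemma exec_while (T : Type) c env (enc : T -> seq bool) (out : nat -> T -> seq bool) xs s :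
  (forall i x s, exec c (rcons env i) (enc x ++ s) (out i x) s) ->
  exec (While c) env (enc_seq enc xs ++ s)
    (flatten [seq out r.1 r.2 | r <- zip (iota 0 (size xs)) xs]) s.
Proof.
move=> body; rewrite /exec -/exec /enc_seq -catA /=.
elim: xs 0 => [|x xs IH] i /=; first exact: WhileStop.
by rewrite -catA; apply: WhileNext (IH _); apply: body.
Qed.

(** Numbers to be printed in unary. [Mulc] has a constant factor and is unrolled into the program,
    whereas [Mulv] becomes a loop; no product is ever stored in a register. *)
Inductive uexp : Type :=
  | Cst of nat
  | Var of nat
  | Add of uexp & uexp
  | Mulc of nat & uexp
  | Mulv of nat & uexp.

Fixpoint uval (env : seq nat) (e : uexp) : nat :=
  match e with
  | Cst n => n
  | Var v => nth 0 env v
  | Add e1 e2 => uval env e1 + uval env e2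
  | Mulc n e1 => n * uval env e1
  | Mulv v e1 => nth 0 env v * uval env e1
  end.

Fixpoint uvars (d : nat) (e : uexp) : bool :=
  match e with
  | Cst _ => true
  | Var v => v < d
  | Add e1 e2 => uvars d e1 && uvars d e2
  | Mulc _ e1 => uvars d e1
  | Mulv v e1 => (v < d) && uvars d e1
  end.

Definition block (l : seq cmd) : cmd := foldr Seq Skip l.

Fixpoint emit (e : uexp) : cmd :=
  match e with
  | Cst n => block (nseq n (Out true))
  | Var v => For v (Out true)
  | Add e1 e2 => Seq (emit e1) (emit e2)
  | Mulc n e1 => block (nseq n (emit e1))
  | Mulv v e1 => For v (emit e1)
  end.

Lemma exec_block (T : eqType) env (cs : T -> cmd) (inp out : T -> seq bool) (l : seq T) s :
  (forall x s, x \in l -> exec (cs x) env (inp x ++ s) (out x) s) ->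
  exec (block [seq cs x | x <- l]) env (flatten [seq inp x | x <- l] ++ s)
    (flatten [seq out x | x <- l]) s.
Proof.
elim: l => [|x l IH] //= ex; rewrite -catA; apply: exec_seq (ex _ _ (mem_head _ _)) _.
by apply: IH => y s' yl; apply: ex; rewrite inE yl orbT.
Qed.

Lemma exec_print_block (T : eqType) env (cs : T -> cmd) (out : T -> seq bool) (l : seq T) s :
  (forall x, x \in l -> exec (cs x) env s (out x) s) ->
  exec (block [seq cs x | x <- l]) env s (flatten [seq out x | x <- l]) s.
Proof.
elim: l => [|x l IH] ex //=; apply: exec_seq (ex _ (mem_head _ _)) _.
by apply: IH => y yl; apply: ex; rewrite inE yl orbT.
Qed.

Lemma flatten_nseq (T : Type) (x : T) n (l : nat) :
  flatten (nseq l (nseq n x)) = nseq (l * n) x.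
Proof. by elim: l => //= l ->; rewrite mulSn nseqD. Qed.

Lemma map_const (T U : Type) (y : U) (l : seq T) : [seq y | _ <- l] = nseq (size l) y.
Proof. by elim: l => //= x l ->. Qed.

Lemma uval_rcons env i e : uvars (size env) e -> uval (rcons env i) e = uval env e.
Proof.
elim: e => //= [v ltv|e1 IH1 e2 IH2 /andP[/IH1-> /IH2->]|n e IH /IH->|v e IH /andP[ltv /IH->]] //;
by rewrite nth_rcons ltv.
Qed.

Lemma uvars_le d d' e : d <= d' -> uvars d e -> uvars d' e.
Proof.
move=> le; elim: e => //= [v /leq_trans|e1 IH1 e2 IH2 /andP[/IH1-> /IH2->]|v e IH /andP[lt /IH->]] //.
  exact.
by rewrite (leq_trans lt).
Qed.

Lemma exec_emit env e s : uvars (size env) e ->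
  exec (emit e) env s (nseq (uval env e) true) s.
Proof.
elim: e env => [n|v|e1 IH1 e2 IH2|n e IH|v e IH] env /=.
- by move=> _; elim: n => [|n IHn] //=; apply: (exec_seq (exec_out _ _ _) IHn).
- move=> ltv; have := @exec_print_for v (Out true) env (fun=> [:: true]) s ltv (fun i _ => exec_out true _ s).
  by rewrite map_const size_iota (flatten_nseq true 1) muln1.
- by case/andP=> u1 u2; rewrite nseqD; apply: exec_seq (IH1 _ u1) (IH2 _ u2).
- move=> u1; elim: n => [|n IHn] //=.
  by rewrite mulSn nseqD; apply: exec_seq (IH _ u1) IHn.
case/andP=> ltv u1.
have := @exec_print_for v (emit e) env (fun=> nseq (uval env e) true) s ltv.
rewrite map_const size_iota flatten_nseq; apply=> i _.
rewrite -(uval_rcons i) //; apply: IH; rewrite size_rcons.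
exact: uvars_le u1.
Qed.

Definition emit_nat (e : uexp) : cmd := Seq (emit e) (Out false).

Lemma exec_emit_nat env e s : uvars (size env) e ->
  exec (emit_nat e) env s (enc_nat (uval env e)) s.
Proof. by move=> u; apply: exec_seq (exec_emit s u) (exec_out _ _ _). Qed.

Definition emit_rule (p c : uexp) (w : bool) (a p' : uexp) : cmd :=
  block [:: Out true; emit_nat p; emit_nat c; Out w; emit_nat a; emit_nat p'].

Definition enc_raw (e : rawrule) : seq bool :=
  let: (p, c, w, a, p') := e in
  enc_nat p ++ enc_nat c ++ [:: w] ++ enc_nat a ++ enc_nat p'.

Lemma exec_emit_rule env p c w a p' s e : all (uvars (size env)) [:: p; c; a; p'] ->
  e = (uval env p, uval env c, w, uval env a, uval env p') ->
  exec (emit_rule p c w a p') env s (true :: enc_raw e) s.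
Proof.
move=> /= /and5P[up uc ua up' _] ->.
rewrite /enc_raw -[enc_nat (uval env p')]cats0 -cat1s.
apply: exec_seq (exec_out _ _ _) _; apply: exec_seq (exec_emit_nat _ up) _.
apply: exec_seq (exec_emit_nat _ uc) _; apply: exec_seq (exec_out _ _ _) _.
apply: exec_seq (exec_emit_nat _ ua) _.
by apply: exec_seq (exec_emit_nat _ up') _.
Qed.

(** Dispatch on a number read in unary, binding no variable. The cases are finitely many for a fixed
    [k]: the kinds of operation and the orders. *)
Fixpoint switch (j : nat) (f : nat -> cmd) : cmd :=
  if j is j'.+1 then IfBit (switch j' (fun n => f n.+1)) (f 0) else Skip.

Lemma exec_switch j f n env s o s' : n < j -> exec (f n) env s o s' ->
  exec (switch j f) env (enc_nat n ++ s) o s'.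
Proof.
elim: j f n => [|j IH] f [|n] //= ltn ex; first by exists false, s.
by exists true, (enc_nat n ++ s); split=> //; apply: IH.
Qed.

Definition letters (w : seq nat) : seq bool := flatten [seq true :: enc_nat a | a <- w].

Lemma letters_cat u v : letters (u ++ v) = letters u ++ letters v.
Proof. by rewrite /letters map_cat flatten_cat. Qed.

Definition letter (a : nat) : cmd := Seq (Out true) (emit_nat (Cst a)).

Lemma exec_letter a env s : exec (letter a) env s (letters [:: a]) s.
Proof.
rewrite /letters /= cats0; apply: (@exec_seq _ _ _ _ [:: true]); first exact: exec_out.
exact: (@exec_emit_nat env (Cst a)).
Qed.

(* Variable 0 is the number of letters, and [d] the number of variables. *)
Fixpoint conv (n d : nat) : cmd :=
  if n is n'.+1 then
    Seq (letter (sep n')) (While (Seq (conv n' d.+1) (letter (sep n'))))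
  else ReadNat (Seq (letter 0) (For 0 (IfEq d.+1 d (letter 1) (letter 0)))).

Lemma zip_map_snd (T U : Type) (f : T -> U) i (l : seq T) :
  [seq f r.2 | r <- zip (iota i (size l)) l] = map f l.
Proof. by elim: l i => //= x l IH i; rewrite IH. Qed.

Lemma letters_flatten (T : Type) (f : T -> seq nat) (l : seq T) :
  letters (flatten [seq f x | x <- l]) = flatten [seq letters (f x) | x <- l].
Proof. by elim: l => //= x l IH; rewrite letters_cat IH. Qed.

Lemma exec_conv s n (x : hseq 'I_s n) env rest : 0 < size env -> nth 0 env 0 = s ->
  exec (conv n (size env)) env (enc_hseq x ++ rest) (letters (ecode x)) rest.
Proof.
elim: n x env rest => [|n IH] x env rest env_gt0 envs.
  have [a xE] : {a : nat | a = (x : 'I_s)} by exists (x : 'I_s).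
  rewrite [ecode x]/(code s (x : 'I_s)) [enc_hseq x]/(enc_nat (x : 'I_s)) -xE.
  apply: exec_read; rewrite /code -cat1s letters_cat.
  apply: exec_seq (exec_letter _ _ _) _.
  have -> : letters [seq (t == a : nat) | t <- iota 0 s] =
    flatten [seq letters [:: (t == a : nat)] | t <- iota 0 (nth 0 (rcons env a) 0)].
    rewrite nth_rcons env_gt0 envs /letters -map_comp; congr flatten.
    by apply: eq_map => t /=; rewrite cats0.
  apply: exec_print_for => [|t ltt]; first by rewrite size_rcons.
  split; rewrite ?size_rcons ?ltnS ?leqnn ?leqnSn //.
  rewrite -{1}(size_rcons env a) nth_rcons ltnn eqxx.
  rewrite nth_rcons size_rcons ltnSn nth_rcons ltnn eqxx.
  by case: eqP => _; apply: exec_letter.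
rewrite ecodeS -[_ :: wcode x]cat1s letters_cat; apply: exec_seq (exec_letter _ _ _) _.
rewrite /wcode letters_flatten -(zip_map_snd (fun y => letters (ecode y ++ [:: sep n])) 0).
apply: (exec_while (out := fun=> fun y => letters (ecode y ++ [:: sep n]))) => i y r.
rewrite letters_cat; apply: exec_seq (exec_letter _ _ _).
rewrite -(size_rcons env i); apply: IH; first by rewrite size_rcons.
by rewrite nth_rcons env_gt0.
Qed.

Lemma iota_mul j d :
  iota 0 (j * d) = flatten [seq [seq n * d + i | i <- iota 0 d] | n <- iota 0 j].
Proof.
elim: j => // j IH; rewrite mulSnr iotaD IH -addn1 iotaD map_cat flatten_cat /= cats0.
by congr (_ ++ _); rewrite add0n -[X in iota X _]addn0 iotaDl.
Qed.

(** * The program that prints the reduction *)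

Section Program.

Variable k : nat.

Definition width : uexp := Mulc 6 (Add (Var 0) (Cst (k + 3))).

Definition loc (f : nat) (t : uexp) : uexp :=
  Add (Add (Var 2) (Mulv 3 width)) (Add (Cst f) (Mulc 6 t)).

(* In the code of a gadget, the variables are the numbers of letters, of
   channels and of states, the index of the rule, its source, the last two
   arguments of its operation and its target. *)
Definition lab_exp (l : lab) : uexp :=
  match l with Start => Var 4 | End => Var 7 | Loc f t => loc f (Cst t) end.

Definition chan_exp (n v : nat) : uexp := Add (Mulc n (Var 1)) (Var v).

(** The edges of a push or a pop are compiled with [0] and [1] as placeholders for the two channels,
    whose numbers are known only at run time. *)
Definition emit_edge (lo hi : uexp) (e : edge) : cmd :=
  let: (l, c, w, a, l') := e in
  emit_rule (lab_exp l) (if c == 0 then lo else hi) w (Cst a) (lab_exp l').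

Definition emit_chain (w : bool) : cmd :=
  block [:: emit_rule (Var 4) (Var 5) w (Cst 0) (loc 0 (Cst 0));
    For 0 (IfEq 8 6
      (emit_rule (loc 0 (Var 8)) (Var 5) w (Cst 1) (loc 0 (Add (Var 8) (Cst 1))))
      (emit_rule (loc 0 (Var 8)) (Var 5) w (Cst 0) (loc 0 (Add (Var 8) (Cst 1)))));
    emit_rule (loc 0 (Var 0)) (Var 5) w (Cst 2) (Var 7)].

Definition emit_gadget (tag n : nat) : cmd :=
  match tag with
  | 0 => emit_chain true
  | 1 => emit_chain false
  | 2 => block [seq emit_edge (chan_exp n 5) (chan_exp n.+1 6) e | e <- push n 0 1]
  | _ => block [seq emit_edge (chan_exp n 6) (chan_exp n.+1 5) e | e <- pop n 0 1]
  end.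

Definition pass (c : cmd) : cmd := ReadNat (ReadNat (ReadNat c)).

Definition parse_rule (f : nat -> nat -> cmd) : cmd :=
  ReadNat (switch 4 (fun tag =>
    if tag < 2 then pass (f tag 0) else switch k (fun n => pass (f tag n)))).

Definition emit_discards : cmd :=
  For 2 (block [seq For 1 (emit_rule (Var 3) (chan_exp n 4) false (Cst (sep n)) (Var 3))
               | n <- iota 0 k]).

(** The last [Out false] codes the spare channel, which is always empty. The [5] passed to [conv]
    counts the three sizes, the channel index and the iteration number. *)
Definition emit_config : cmd :=
  block [:: ReadNat (emit_nat (Var 3));
    block [seq For 1 (Seq (While (Seq (conv n 5) (letter (sep n)))) (Out false))
          | n <- iota 0 k];
    Out false].

(** The number of states is printed as a sum while the rules go by: the control states, one [width]
    for each rule, and one for the spare state. *)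
Definition first_pass : cmd := pass
  (block [:: emit_nat (Add (Mulc k (Var 1)) (Cst 1)); emit (Var 2);
     While (parse_rule (fun _ _ => emit width)); Out true; Out false]).

Definition second_pass : cmd := pass
  (block [:: emit_discards; While (parse_rule emit_gadget); Out false;
     emit_config; emit_config]).

Section Instance.

Variable S : holcs k.

Notation m := (h_chans S).
Notation s := (h_letters S).
Notation q := (h_states S).
Notation hrule := ('I_q * hop k m s * 'I_q)%type.

Definition raws (l : seq rawrule) : seq bool := flatten [seq true :: enc_raw e | e <- l].

Lemma raws_cat l1 l2 : raws (l1 ++ l2) = raws l1 ++ raws l2.
Proof. by rewrite /raws map_cat flatten_cat. Qed.

Definition hop_args (op : hop k m s) : nat * nat * nat * nat :=
  match op with
  | HWrite _ i a => (0, 0, i : nat, a : nat)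
  | HRead _ i a => (1, 0, i : nat, a : nat)
  | HPush n _ j i => (2, n, j : nat, i : nat)
  | HPop n _ j i => (3, n, j : nat, i : nat)
  end.

Lemma exec_parse_rule f (env : seq nat) (ru : hrule) o rest :
  (let: (tag, n, x, y) := hop_args ru.1.2 in
   exec (f tag n) (rcons (rcons (rcons (rcons env ru.1.1) x) y) ru.2) rest o rest) ->
  exec (parse_rule f) env (enc_hrule ru ++ rest) o rest.
Proof.
case: ru => [[p op] p'] /= ex.
have -> : enc_hrule (p, op, p') ++ rest = enc_nat p ++ (enc_hop op ++ (enc_nat p' ++ rest)).
  by rewrite /enc_hrule -!catA.
apply: exec_read.
have cat3 n1 n2 n3 : (enc_nat n1 ++ enc_nat n2 ++ enc_nat n3) ++ (enc_nat p' ++ rest) =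
    enc_nat n1 ++ (enc_nat n2 ++ (enc_nat n3 ++ (enc_nat p' ++ rest))) by rewrite -!catA.
have cat4 n1 n2 n3 n4 :
    (enc_nat n1 ++ enc_nat n2 ++ enc_nat n3 ++ enc_nat n4) ++ (enc_nat p' ++ rest) =
    enc_nat n1 ++ (enc_nat n2 ++ (enc_nat n3 ++ (enc_nat n4 ++ (enc_nat p' ++ rest)))).
  by rewrite -!catA.
case: op ex => [k0 i a|k0 i a|n ltn j i|n ltn j i] ex; rewrite /enc_hop ?cat3 ?cat4.
- by apply: (@exec_switch 4 _ 0) => //; do 3!apply: exec_read.
- by apply: (@exec_switch 4 _ 1) => //; do 3!apply: exec_read.
- apply: (@exec_switch 4 _ 2) => //.
  apply: (@exec_switch k (fun n => pass (f 2 n)) n); first exact: ltnW.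
  by do 3!apply: exec_read.
apply: (@exec_switch 4 _ 3) => //.
apply: (@exec_switch k (fun n => pass (f 3 n)) n); first exact: ltnW.
by do 3!apply: exec_read.
Qed.

Lemma slotsE : s + (k + 3) = slots S.
Proof. exact: addnA. Qed.

Section Rule.

Variables (r : nat) (ru : hrule) (x y : nat) (rest : seq bool).

Notation env := [:: s; m; q; r; ru.1.1 : nat; x; y; ru.2 : nat].

Lemma uval_lab l : uval env (lab_exp l) = state_num S r ru.1.1 ru.2 l.
Proof. by case: l => //= f t; rewrite slotsE. Qed.

Lemma exec_emit_chain w :
  exec (emit_chain w) env rest (raws [seq relabel r ru e | e <- chain s x w y]) rest.
Proof.
rewrite /chain -[_ :: _ ++ _]cat1s 2!map_cat 2!raws_cat /emit_chain.
have raws1 e : raws [seq relabel r ru e | e <- [:: e]] = true :: enc_raw (relabel r ru e).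
  exact: cats0.
apply: exec_seq; first by rewrite raws1; apply: exec_emit_rule => //=; rewrite slotsE.
apply: exec_seq; last first.
  rewrite -[raws _]cats0; apply: (@exec_seq _ Skip) => //.
  by rewrite raws1; apply: exec_emit_rule => //=; rewrite slotsE.
have -> : raws [seq relabel r ru e | e <-
    [seq (Loc 0 t, x, w, (t == y : nat), Loc 0 t.+1) | t <- iota 0 s]] =
  flatten [seq true :: enc_raw (relabel r ru (Loc 0 t, x, w, (t == y : nat), Loc 0 t.+1))
          | t <- iota 0 (nth 0 env 0)] by rewrite /raws -!map_comp.
apply: exec_print_for => // t ltt; split=> //.
have -> : (nth 0 (rcons env t) 8 == nth 0 (rcons env t) 6) = (t == y) by [].
by case: eqP => _; apply: exec_emit_rule => //=; rewrite slotsE addn1.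
Qed.

Lemma exec_emit_edges lo hi es : uvars 8 lo -> uvars 8 hi ->
  exec (block [seq emit_edge lo hi e | e <- es]) env rest
    (raws [seq relabel r ru (let: (l, c, w, a, l') := e in
             (l, if c == 0 then uval env lo else uval env hi, w, a, l')) | e <- es]) rest.
Proof.
move=> ulo uhi; rewrite /raws -map_comp; apply: exec_print_block.
move=> [[[[l c] w] a] l'] _; have ulab l0 : uvars 8 (lab_exp l0) by case: l0.
apply: exec_emit_rule; first by rewrite /= !ulab; case: eqP => _; rewrite ?ulo ?uhi.
by rewrite !uval_lab; case: eqP.
Qed.

End Rule.

Lemma push_color n lo hi : push n lo hi =
  [seq (let: (l, c, w, a, l') := e in (l, if c == 0 then lo else hi, w, a, l')) | e <- push n 0 1].
Proof.
rewrite /push !map_cat map_flatten -map_comp; congr (_ ++ (flatten _ ++ _)).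
Qed.

Lemma pop_color n lo hi : pop n lo hi =
  [seq (let: (l, c, w, a, l') := e in (l, if c == 0 then lo else hi, w, a, l')) | e <- pop n 0 1].
Proof.
rewrite /pop -2![_ :: _ ++ _]cat1s 4!map_cat map_flatten -2!map_comp.
by congr (_ :: (_ ++ (_ ++ (flatten _ ++ _)))).
Qed.

Lemma exec_gadget r (ru : hrule) rest :
  exec (parse_rule emit_gadget) [:: s; m; q; r] (enc_hrule ru ++ rest)
    (raws (gadget_rules r ru)) rest.
Proof.
apply: exec_parse_rule; rewrite /gadget_rules.
case: ru => [[p op] p']; case: op => [k0 i a|k0 i a|n ltn j i|n ltn j i].
- exact: (@exec_emit_chain r (p, _, p') i a).
- exact: (@exec_emit_chain r (p, _, p') i a).
- have gE : gadget (@HPush k m s n ltn j i) = push n (n * m + j) (n.+1 * m + i) by [].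
  rewrite gE push_color -map_comp.
  exact: (@exec_emit_edges r (p, _, p') j i rest (chan_exp n 5) (chan_exp n.+1 6)).
have gE : gadget (@HPop k m s n ltn j i) = pop n (n * m + i) (n.+1 * m + j) by [].
rewrite gE pop_color -map_comp.
exact: (@exec_emit_edges r (p, _, p') j i rest (chan_exp n 6) (chan_exp n.+1 5)).
Qed.

Lemma exec_discards rest :
  exec emit_discards [:: s; m; q] rest (raws (discards S)) rest.
Proof.
have -> : raws (discards S) = flatten [seq flatten [seq flatten [seq
    true :: enc_raw (p, n * m + i, false, sep n, p) | i <- iota 0 m]
    | n <- iota 0 k] | p <- iota 0 q].
  rewrite /discards; elim: (iota 0 q) => //= p l IH; rewrite raws_cat IH; congr (_ ++ _).
  by elim: (iota 0 k) => //= n l' IH'; rewrite raws_cat IH' /raws -map_comp.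
apply: exec_print_for => // p ltp; apply: exec_print_block => n _.
by apply: exec_print_for => // i lti; apply: exec_emit_rule.
Qed.

Lemma flatten_ord (f : nat -> seq bool) n (g : 'I_n -> seq bool) :
  (forall i : 'I_n, f i = g i) ->
  flatten [seq f i | i <- iota 0 n] = flatten [seq g i | i <- enum 'I_n].
Proof.
by move=> fg; rewrite -val_enum_ord -map_comp; congr flatten; apply: eq_map => i /=.
Qed.

Definition enc_chan (u : seq nat) : seq bool := letters u ++ [:: false].

Definition enc_strings (C : hconfig S) : seq bool :=
  enc_nat C.1 ++ flatten [seq enc_chan (strings C c) | c <- iota 0 (k * m)] ++ [:: false].

Lemma exec_emit_config (C : hconfig S) rest :
  exec emit_config [:: s; m; q] (enc_hconfig C ++ rest) (enc_strings C) rest.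
Proof.
rewrite /enc_hconfig /enc_strings -[in X in exec _ _ X]catA; apply: exec_seq.
  by apply: exec_read; apply: exec_emit_nat.
(* Extending the codes to all numbers lets loops over [iota] be matched with the enumerations of
   ordinals in [enc_hconfig]. *)
pose inp n i := if insub n is Some n' then if insub i is Some i' then
  enc_hseq (C.2 n' i') else [::] else [::].
have -> : flatten [seq enc_hseq (C.2 n i) | n <- enum 'I_k, i <- enum 'I_m] =
    flatten [seq flatten [seq inp n i | i <- iota 0 m] | n <- iota 0 k].
  rewrite -[iota 0 k]val_enum_ord -map_comp; elim: (enum 'I_k) => //= n l IH.
  rewrite flatten_cat IH; congr (_ ++ _); symmetry; apply: flatten_ord => i.
  by rewrite /inp !valK.
have -> : flatten [seq enc_chan (strings C c) | c <- iota 0 (k * m)] =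
    flatten [seq flatten [seq enc_chan (strings C (n * m + i)) | i <- iota 0 m] | n <- iota 0 k].
  rewrite iota_mul; elim: (iota 0 k) => //= n l IH; rewrite map_cat flatten_cat IH.
  by rewrite -map_comp.
apply: exec_seq; last exact: (@exec_seq _ Skip _ _ [:: false]).
apply: (exec_block (inp := fun n => flatten [seq inp n i | i <- iota 0 m])
  (out := fun n => flatten [seq enc_chan (strings C (n * m + i)) | i <- iota 0 m])).
move=> n rest'; rewrite mem_iota => /= ltnk.
apply: (@exec_for 1 _ [:: s; m; q] (inp n) (fun i => enc_chan (strings C (n * m + i)))) => // i rest'' ltim.
have -> : inp n i = enc_hseq (C.2 (Ordinal ltnk) (Ordinal ltim)).
  by rewrite /inp !insubT.
rewrite (stringsE C (Ordinal ltnk) (Ordinal ltim)); apply: exec_seq (exec_out _ _ _).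
move: (C.2 _ _) => x; rewrite /wcode letters_flatten.
rewrite -(zip_map_snd (fun y => letters (ecode y ++ [:: sep n])) 0).
apply: (exec_while (out := fun=> fun y => letters (ecode y ++ [:: sep n]))) => j y r.
by rewrite letters_cat; apply: exec_seq (exec_letter _ _ _); apply: exec_conv.
Qed.

Lemma enc_hinstance_cat C C' :
  enc_hinstance (@HInstance k S C C') =
  enc_nat s ++ (enc_nat m ++ (enc_nat q ++
    (enc_seq (@enc_hrule k m s q) (h_rules S) ++ (enc_hconfig C ++ (enc_hconfig C' ++ [::]))))).
Proof. by rewrite cats0 /enc_hinstance /enc_holcs -!catA. Qed.

Lemma exec_first_pass C C' : exists rest,
  exec (first_pass) [::] (enc_hinstance (@HInstance k S C C'))
    (enc_nat (k * m).+1 ++ enc_nat (nstates S).+1) rest.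
Proof.
rewrite enc_hinstance_cat; eexists; do 3!apply: exec_read.
apply: exec_seq.
  have -> : (k * m).+1 = uval [:: s; m; q] (Add (Mulc k (Var 1)) (Cst 1)) by rewrite /= addn1.
  exact: exec_emit_nat.
have -> : enc_nat (nstates S).+1 = nseq q true ++
    (flatten [seq nseq (6 * slots S) true | r <- zip (iota 0 (size (h_rules S))) (h_rules S)] ++
     ([:: true] ++ [:: false])).
  rewrite /enc_nat /nstates map_const size_zip size_iota minnn flatten_nseq.
  by rewrite -addn1 !nseqD -!catA.
apply: exec_seq; first exact: (@exec_emit [:: s; m; q] (Var 2)).
apply: exec_seq.
  apply: (exec_while (out := fun _ _ => nseq (6 * slots S) true)) => i ru r.
  apply: exec_parse_rule; case: hop_args => [[[tag n] x] y].
  by rewrite -slotsE; apply: exec_emit.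
apply: exec_seq (exec_out _ _ _) _.
exact: (@exec_seq _ Skip _ _ [:: false]).
Qed.

Lemma exec_second_pass C C' :
  exec second_pass [::] (enc_hinstance (@HInstance k S C C'))
    (raws (raw_rules S) ++ [:: false] ++ enc_strings C ++ enc_strings C') [::].
Proof.
rewrite enc_hinstance_cat; do 3!apply: exec_read.
rewrite raws_cat -[enc_strings C']cats0 -catA.
apply: exec_seq; first exact: exec_discards.
apply: exec_seq.
  have -> : raws (flatten [seq gadget_rules r.1 r.2
      | r <- zip (iota 0 (size (h_rules S))) (h_rules S)]) =
    flatten [seq raws (gadget_rules r.1 r.2) | r <- zip (iota 0 (size (h_rules S))) (h_rules S)].
    by elim: (zip _ _) => //= r l IH; rewrite raws_cat IH.
  apply: (exec_while (out := fun r ru => raws (gadget_rules r ru))) => i ru r.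
  exact: exec_gadget.
apply: exec_seq (exec_out _ _ _) _.
apply: exec_seq (exec_emit_config _ _) _.
by apply: exec_seq (exec_emit_config _ _) _.
Qed.

Lemma enc_the_pcs : enc_pcs (the_pcs S) =
  enc_nat (k * m).+1 ++ enc_nat (nstates S).+1 ++ raws (raw_rules S) ++ [:: false].
Proof.
rewrite /enc_pcs /enc_seq /raws; do 2!congr (_ ++ _); congr (flatten _ ++ _).
rewrite -map_comp; apply/eq_in_map => -[[[[p c] w] a] p'] /raw_bounds[ltp ltp' ltc lta] /=.
by rewrite !inordK // ltnS ltnW.
Qed.

Lemma enc_config_of C : enc_pconfig (config_of C) = enc_strings C.
Proof.
rewrite /enc_pconfig config_of_state /enc_strings; congr (_ ++ _).
have <- : flatten [seq enc_chan (strings C c) | c <- iota 0 (k * m).+1] =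
    flatten [seq enc_chan (strings C c) | c <- iota 0 (k * m)] ++ [:: false].
  by rewrite -addn1 iotaD map_cat flatten_cat /= add0n strings_out.
symmetry; apply: flatten_ord => c; rewrite /enc_chan /letters /enc_seq; congr (flatten _ ++ _).
rewrite ffunE -map_comp; apply/eq_in_map => a /(allP (strings_le C c)) lea /=.
by rewrite inordK.
Qed.

End Instance.

Definition reduction (I : hinstance k) : pinstance k.+1 :=
  PInstance (config_of (hi_src I)) (config_of (hi_tgt I)).

Lemma reduction_logspace :
  logspace_computable (@enc_hinstance k) (@enc_pinstance k.+1) reduction.
Proof.
apply: (@logspace_two_passes _ _ _ _ _ first_pass second_pass) => -[S C C'].
have [rest ex1] := exec_first_pass C C'; have ex2 := exec_second_pass C C'.
do 4!eexists; split; [exact: ex1 | exact: ex2 |].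
transitivity (enc_pcs (the_pcs S) ++ enc_pconfig (config_of C) ++ enc_pconfig (config_of C')) => //.
by rewrite enc_the_pcs !enc_config_of -!catA.
Qed.

End Program.

Theorem theorem7p7 (k : nat) :
  exists f : hinstance k -> pinstance k.+1,
    logspace_computable (@enc_hinstance k) (@enc_pinstance k.+1) f /\
    forall I : hinstance k, hreachable I <-> preachable (f I).
Proof.
exists (@reduction k); split; first exact: reduction_logspace.
move=> [S C C']; split; first exact: simulation_forward.
exact: simulation_back.
Qed.
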